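(* Let $d\ge1$ and let $\mathcal Q_d,\mathcal Q^0_d\subset\mathbb{R}^d$ be built from $m$ independent Gaussian walks in $\mathbb{R}^d$ with $n_1,\dots,n_m$ steps. Then $$\mathbb E|\mathcal Q_d|=\frac{\Gamma(\frac{d+1}2)}{d\sqrt\pi\,\Gamma(\frac d2)}\sum_{\text{configs of size }d+1}\frac{s}{2^{(d+1)/2-1}\Gamma(\frac{d+1}2)}\prod_{l:k_l>0}\Big[\sqrt{i^{(l)}_1}\,\Delta_l^{-1/2}c_l\Big]J_{(-\infty,\infty)},$$ $$\mathbb E|\mathcal Q^0_d|=\frac{\Gamma(\frac{d+1}2)}{d\sqrt\pi\,\Gamma(\frac d2)}\Bigg(\sum_{\text{configs of size }d+1}\frac{s}{2^{(d+1)/2-1}\Gamma(\frac{d+1}2)}\prod_{l:k_l>0}\Big[\sqrt{i^{(l)}_1}\,\Delta_l^{-1/2}c_l\Big]J_{(0,\infty)}+\sum_{\text{configs of size }d}\frac{\sqrt{2\pi}}{2^{(d+1)/2-1}\Gamma(\frac{d+1}2)}\prod_{l=1}^m e_l\Bigg),$$ where $e_l=(i^{(l)}_1\Delta_l)^{-1/2}c_l$ if $k_l>0$ and $e_l=\frac{(2n_l-1)!!}{(2n_l)!!}$ if $k_l=0$, and $s,\Delta_l,c_l,J$ are computed for the configuration being summed. (Equivalently, $\mathbb E|\mathcal Q_d|=\frac{\Gamma(\frac{d+1}2)}{d\sqrt\pi\,\Gamma(\frac d2)}\mathbb E|\mathrm{bd}\,\mathcal Q_{d+1}|$ and likewise for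 $\mathcal Q^0$, where $\mathcal Q_{d+1}$ is the analogous hull of $m$ independent Gaussian walks in $\mathbb{R}^{d+1}$ with the same step numbers.)
   Context: Setting. Fix integers $m\ge1$, $n_1,\dots,n_m\ge1$. For a dimension $D$, let $X^{(l)}_i$ ($1\le l\le m$, $1\le i\le n_l$) be independent standard Gaussian vectors in $\mathbb{R}^D$, $S^{(l)}_i=X^{(l)}_1+\dots+X^{(l)}_i$, $\mathcal Q_D=\mathrm{conv}\{S^{(l)}_i\}$, $\mathcal Q^0_D=\mathrm{conv}(\{0\}\cup\{S^{(l)}_i\})$. $|\cdot|$ denotes $d$-dimensional volume; $|\mathrm{bd}\,K|$ denotes surface area. An index configuration of size $k$ consists of nonnegative integers $k_1,\dots,k_m$ with $k_l\le n_l$ and $\sum_l k_l=k$, together with, for each $l$ with $k_l>0$, indices $1\le i^{(l)}_1<\dots<i^{(l)}_{k_l}\le n_l$. Persistence probabilities: with $N_1,N_2,\dots$ i.i.d. standard Gaussian real variables, $p_n(r)=\mathbb P[\sum_{i=1}^kN_i\le r,\ k=1,\dots,n]$ and $q_n(r)=\mathbb P[\sum_{i=1}^kN_i\le r,\ k=1,\dots,n\mid \sum_{i=1}^nN_i=r]$ (so $q_1\equiv1$). Notation: for $l$ with $k_l>0$, $\Delta_l=(i^{(l)}_2-i^{(l)}_1)\cdots(i^{(l)}_{k_l}-i^{(l)}_{k_l-1})$ (empty product $=1$), $c_l=\frac{(2(n_l-i^{(l)}_{k_l})-1)!!}{(2(n_l-i^{(l)}_{k_l}))!!}$ with $(-1)!!=0!!=1$;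 $s=\sum_{l:k_l>0}1/i^{(l)}_1$; $J_{(a,b)}=\int_a^b e^{-sr^2/2}\prod_{l:k_l=0}p_{n_l}(r)\prod_{l:k_l>0}q_{i^{(l)}_1}(r)\,dr$. *)

(* Defs.v *)
From HB Require Import structures.
From mathcomp Require Import all_boot all_order all_algebra.
From mathcomp Require Import all_classical all_reals all_analysis.
Set Implicit Arguments. Unset Strict Implicit. Unset Printing Implicit Defensive.
Import Order.TTheory GRing.Theory Num.Theory.
Local Open Scope classical_set_scope.
Local Open Scope ring_scope.

Section Defs.
Variable R : realType.
Notation mu := (@lebesgue_measure R).

Definition upd (I : eqType) (w : I -> R) (i : I) (x : R) : I -> R :=
  fun j => if j == i then x else w j.

Fixpoint lint (I : eqType) (s : seq I) (F : (I -> R) -> \bar R) : \bar R :=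
  match s with
  | [::] => F (fun _ => 0)
  | i :: s' => (\int[mu]_x lint s' (fun w => F (upd w i x)))%E
  end.

Fixpoint gint (I : eqType) (s : seq I) (F : (I -> R) -> \bar R) : \bar R :=
  match s with
  | [::] => F (fun _ => 0)
  | i :: s' =>
      (\int[mu]_x ((normal_pdf 0 1 x)%:E * gint s' (fun w => F (upd w i x))))%E
  end.

Definition gauss_exp (I : finType) (F : (I -> R) -> \bar R) : \bar R :=
  gint (enum I) F.

Definition vol (d : nat) (K : set ('I_d -> R)) : \bar R :=
  lint (enum 'I_d) (fun x => (\1_K x)%:E).

Definition hull (d : nat) (J : finType) (P : J -> 'I_d -> R) : set ('I_d -> R) :=
  [set x | exists lam : J -> R, (forall j, 0 <= lam j) /\ (\sum_j lam j = 1) /\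
     (forall c, x c = \sum_j lam j * P j c)].

Definition Gamma (x : R) : R :=
  fine (\int[mu]_(t in `]0%R, +oo[%classic) ((powR t (x - 1)) * expR (- t))%:E)%E.

(* double factorial and the ratio (2k-1)!!/(2k)!!, with (-1)!! = 0!! = 1 *)
Fixpoint dfact (k : nat) : nat :=
  match k with 0 => 1 | 1 => 1 | (k'.+1 as k1).+1 => k1.+1 * dfact k' end.
Definition dratio (k : nat) : R := (dfact (2 * k - 1))%:R / (dfact (2 * k))%:R.

Definition psum (n : nat) (w : 'I_n -> R) (k : 'I_n) : R :=
  \sum_(i < n | (i <= k)%N) w i.

Definition pers_p (n : nat) (r : R) : R :=
  fine (gauss_exp (fun w : 'I_n -> R =>
    ((\1_[set w' : 'I_n -> R | forall k, psum w' k <= r] w) : R)%:E)).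

(* conditional persistence probability given sum_{i<=n} N_i = r,
   defined through densities: the last variable equals r - (sum of the others);
   the condition for k = n (r <= r) is automatic. *)
Definition pers_q (n : nat) (r : R) : R :=
  fine (gauss_exp (fun w : 'I_n.-1 -> R =>
    ((\1_[set w' : 'I_n.-1 -> R | forall k, psum w' k <= r] w) *
     normal_pdf 0 1 (r - \sum_i w i))%:E))
  / normal_pdf 0 (Num.sqrt n%:R) r.

Variables (m : nat) (n : 'I_m -> nat).

(* index of the points S^{(l)}_{i+1}: pairs (l, i) with i < n_l *)
Definition PT := {l : 'I_m & 'I_(n l)}.

(* partial sums: w (t, c) = coordinate c of step t;  point p = (l,i) is
   S^{(l)}_{i+1} = X^{(l)}_1 + ... + X^{(l)}_{i+1} *)
Definition walk_pt (d : nat) (w : PT * 'I_d -> R) (p : PT) (c : 'I_d) : R :=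
  \sum_(t : PT | (tag t == tag p) && ((tagged t : nat) <= tagged p)%N) w (t, c).

Definition walk_pt0 (d : nat) (w : PT * 'I_d -> R) (p : option PT) (c : 'I_d) : R :=
  if p is Some q then walk_pt w q c else 0.

Definition EvolQ (d : nat) : \bar R :=
  gauss_exp (fun w : PT * 'I_d -> R => vol (hull (walk_pt w))).
Definition EvolQ0 (d : nat) : \bar R :=
  gauss_exp (fun w : PT * 'I_d -> R => vol (hull (walk_pt0 w))).

(* index configurations: a configuration of size k is a set A of points with
   #|A| = k; its indices in walk l (1-based, increasing) are: *)
Definition cidx (A : {set PT}) (l : 'I_m) : seq nat :=
  sort leq [seq (nat_of_ord (tagged p)).+1 | p : PT <- enum A & tag p == l].
Definition ck (A : {set PT}) l := size (cidx A l).
Definition ci1 (A : {set PT}) l : nat := head 0%N (cidx A l).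
Definition cilast (A : {set PT}) l : nat := last 0%N (cidx A l).
Definition cDelta (A : {set PT}) l : nat :=
  \prod_(x <- pairmap (fun a b => b - a)%N (ci1 A l) (behead (cidx A l))) x.
Definition cc (A : {set PT}) l : R := dratio (n l - cilast A l).
Definition cs (A : {set PT}) : R :=
  \sum_(l < m | (0 < ck A l)%N) ((ci1 A l)%:R)^-1.
Definition cJ (A : {set PT}) (D : set R) : \bar R :=
  (\int[mu]_(r in D)
     (expR (- (cs A * r ^+ 2) / 2) *
      \prod_(l < m | ck A l == 0%N) pers_p (n l) r *
      \prod_(l < m | (0 < ck A l)%N) pers_q (ci1 A l) r)%:E)%E.
Definition ce (A : {set PT}) l : R :=
  if (0 < ck A l)%N then (Num.sqrt ((ci1 A l)%:R * (cDelta A l)%:R))^-1 * cc A l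
  else dratio (n l).

End Defs.

(* Main.v *)
Require Import Defs.
From HB Require Import structures.
From mathcomp Require Import all_boot all_order all_algebra.
From mathcomp Require Import all_classical all_reals all_analysis.
From mathcomp Require Import measurable_realfun perm ring lra zify.
Set Implicit Arguments. Unset Strict Implicit. Unset Printing Implicit Defensive.
Import Order.TTheory GRing.Theory Num.Theory.
Import numFieldNormedType.Exports.
Local Open Scope classical_set_scope.
Local Open Scope ring_scope.

(** Attach to the points of the walks independent heights which are themselves
    one-dimensional Gaussian walks.  The upper faces of the lifted point set
    triangulate the hull, so [E|Q_d|] is a sum over the [d+1]-subsets [B] of
    [E (|det| / d! ; B spans an upper face)].  Trading the heights over [B] for
    the affine function of the face, with slope [b], costs another [|det|], and
    a linear change of the steps turns the joint density into a product: the
    slope contributes the factor [\int (1 + |b|^2)^(-(d+2)/2) db], the steps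
    contribute the second moment of a determinant, and the remaining heights
    contribute the mass of one-dimensional walks that stay below a level [r] and
    touch it exactly at [B].  This mass factors over the gaps of [B]: the first
    piece gives [q], a bridge of [k] steps stays nonpositive with probability
    [1/k], and the last piece is given by Sparre Andersen's formula. *)

(** * Iterated integrals *)

Local Notation mu := (@lebesgue_measure _).

(** With the heights adjoined, the [m] walks become Gaussian walks in dimension [d+1], and the
    triangulation is the projection of the upper boundary of their hull; this explains the surface
    area in the equivalent form of the theorem. The obstacle is measurability: iterated integrals
    make sense for arbitrary integrands, but the volume of a hull is not known to be measurable in
    the steps. It is therefore replaced, for every fixed value of the steps, by a finite sum of
    determinants times height integrals, and only these are integrated. The level of a face above
    the origin, divided by [sigma b], becomes the variable of [J]. When the origin is added as a
    point of height [0], a face either misses it, which forces [r >= 0], or contains it, which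
    forces [r = 0] and leaves [d] other vertices. The slope integral is the volume of the unit
    [d]-ball, and [Gamma((d+1)/2)] cancels between the two quotients of the statement. The product
    of the gap sizes in the second moment cancels against the mass of the heights; what remains from
    the column of ones of an affine determinant is the sum [s] of the inverse first gaps. *)

Definition cylinders (R : realType) (I : Type) : set (set (I -> R)) :=
  [set A | exists i, exists2 B : set R, measurable B & A = (fun w => w i) @^-1` B].

(** The product sigma-algebra, on a type of its own: integrands keep the plain type [I -> R], and
    [vec R I] is ascribed only in measurability statements. *)
Definition vec (R : realType) (I : Type) := g_sigma_algebraType (@cylinders R I).

HB.instance Definition _ (R : realType) I := Measurable.on (vec R I).

(** Composition in applied form, so that [f] and [g] can be named where unification does not find
    them. *)
Lemma measurable_precomp d1 d2 d3 (X : measurableType d1) (Y : measurableType d2)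
    (Z : measurableType d3) (f : X -> Y) (g : Y -> Z) :
  measurable_fun [set: Y] g -> measurable_fun [set: X] f ->
  measurable_fun [set: X] (fun x => g (f x)).
Proof. exact: measurableT_comp. Qed.

Section vec_measurability.
Context {R : realType}.

Lemma measurable_coord (I : Type) (i : I) :
  measurable_fun [set: vec R I] (fun w : vec R I => w i).
Proof.
move=> _ B mB; rewrite setTI.
by apply: sub_sigma_algebra; exists i, B.
Qed.

Lemma measurable_vec (I : Type) d (X : measurableType d) (f : X -> vec R I) :
  (forall i, measurable_fun [set: X] (fun x => f x i)) ->
  measurable_fun [set: X] f.
Proof.
move=> mf; apply: (@measurability _ _ X (vec R I) setT f (@cylinders R I)) => //= A [B [i [C mC ->]] <-].
rewrite setTI; have := mf i measurableT C mC; by rewrite setTI.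
Qed.

Lemma measurable_coord_comp (I : Type) d (X : measurableType d) (f : X -> vec R I) i :
  measurable_fun [set: X] f -> measurable_fun [set: X] (fun x => f x i).
Proof. by move=> mf; exact: (measurableT_comp (measurable_coord i) mf). Qed.

Lemma measurable_upd (I : eqType) d (X : measurableType d) (f : X -> vec R I) i
    (g : X -> R) :
  measurable_fun [set: X] f -> measurable_fun [set: X] g ->
  measurable_fun [set: X] (fun x => upd (f x) i (g x) : vec R I).
Proof.
move=> mf mg; apply: measurable_vec => j; rewrite /upd.
case: (j == i) => //; exact: measurable_coord_comp.
Qed.

End vec_measurability.

Section lint.
Context {R : realType}.
Local Open Scope ereal_scope.

Lemma measurable_integral d (X : measurableType d) (F : X -> R -> \bar R) :
  (forall x y, 0 <= F x y) ->
  measurable_fun [set: X * R] (fun z => F z.1 z.2) ->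
  measurable_fun [set: X] (fun x => \int[mu]_y F x y).
Proof.
move=> F0 mF.
exact: (measurable_fun_fubini_tonelli_F (m2 := mu) (fun z : X * R => F z.1 z.2)).
Qed.

Lemma integral_swap (F : R -> R -> \bar R) :
  (forall x y, 0 <= F x y) ->
  measurable_fun [set: R * R] (fun z => F z.1 z.2) ->
  \int[mu]_x \int[mu]_y F x y = \int[mu]_y \int[mu]_x F x y.
Proof.
move=> F0 mF.
exact: (fubini_tonelli (m1 := mu) (m2 := mu) (fun z : R * R => F z.1 z.2)).
Qed.

Lemma lint_ge0 (I : eqType) (s : seq I) (F : (I -> R) -> \bar R) :
  (forall w, 0 <= F w) -> 0 <= lint s F.
Proof.
elim: s F => [|i s IH] F F0 //=.
by apply: integral_ge0 => x _; apply: IH.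
Qed.

(** Tonelli at each integration. The induction moves the integrated variable into the parameter
    space, from [X] to [X * R], so [X] has to vary. *)
Lemma measurable_lint (I : eqType) (s : seq I) d (X : measurableType d)
    (F : X -> (I -> R) -> \bar R) :
  (forall x w, 0 <= F x w) ->
  measurable_fun [set: X * vec R I] (fun z => F z.1 z.2) ->
  measurable_fun [set: X] (fun x => lint s (F x)).
Proof.
elim: s d X F => [|i s IH] d X F F0 mF /=.
  apply: (measurable_precomp (f := fun x : X => (x, (fun=> 0%R) : vec R I)) mF).
  exact: measurable_fun_pair.
apply: (measurable_integral (F := fun x y => lint s (fun w => F x (upd w i y)))).
  by move=> x y; apply: lint_ge0.
apply: (IH _ (X * R)%type (fun z w => F z.1 (upd w i z.2))) => //.
apply: (measurable_precomp
  (f := fun z : (X * R) * vec R I => (z.1.1, upd z.2 i z.1.2 : vec R I)) mF).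
apply: measurable_fun_pair => /=.
  exact: (measurableT_comp measurable_fst measurable_fst).
apply: measurable_upd => //.
exact: (measurableT_comp measurable_snd measurable_fst).
Qed.

End lint.

(** * Affine substitutions on the line *)

Section affine1.
Context {R : realType}.
Local Open Scope ereal_scope.

Lemma measurable_affine (a c : R) : measurable_fun [set: measurableTypeR R]
  (fun x : measurableTypeR R => a * x + c : measurableTypeR R)%R.
Proof. by apply: measurable_funD => //; exact: measurable_funM. Qed.

(** Uniqueness of Lebesgue measure: the rescaled image measure need only be compared with it on
    half-open intervals. A negative [a] exchanges the closed and the open end of the interval. *)
Lemma lebesgue_measure_affine (a c : R) (A : set R) : (a != 0)%R -> measurable A ->
  `|a|%:E * pushforward mu
     (fun x : measurableTypeR R => a * x + c : measurableTypeR R)%R A = mu A.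
Proof.
move=> a0 mA.
have a0' : (0 <= `|a|)%R by [].
pose f := (fun x : measurableTypeR R => a * x + c : measurableTypeR R)%R.
pose nu := mscale (NngNum a0') (pushforward mu f : {measure set (measurableTypeR R) -> \bar R}).
transitivity (nu (measurable_affine a c) A) => //.
apply/esym/lebesgue_measure_unique => //= _ [[u v]] _ <-.
rewrite /nu /mscale /=; rewrite /pushforward /f /=.
have [ap|an] : (0 < a \/ a < 0)%R.
  by case: (ltgtP a 0%R) a0 => //; [right|left].
- rewrite (_ : _ @^-1` _ = `](u - c) / a, (v - c) / a]%classic)%R; last first.
    apply/seteqP; split => x /=; rewrite !in_itv /= ltr_pdivrMr// ler_pdivlMr// (mulrC x a);
    by rewrite lerBrDr ltrBlDr.
  rewrite lebesgue_measure_itv /= lebesgue_measure_itv /= !lte_fin.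
  rewrite ltr_pM2r ?invr_gt0// ltrD2r; case: ifPn => uv; last by rewrite mule0.
  by rewrite -EFinB -EFinM gtr0_norm// ; congr EFin; field.
- rewrite (_ : _ @^-1` _ = `[(v - c) / a, (u - c) / a[%classic)%R; last first.
    apply/seteqP; split => x /=; rewrite !in_itv /= ltr_ndivlMr// ler_ndivrMr// (mulrC x a);
    by rewrite lerBrDr ltrBlDr andbC.
  rewrite lebesgue_measure_itv /= lebesgue_measure_itv /= !lte_fin.
  rewrite ltr_nM2r ?invr_lt0// ltrD2r; case: ifPn => uv; last by rewrite mule0.
  by rewrite -EFinB -EFinM ltr0_norm// ; congr EFin; field.
Qed.

Lemma integral_affine (a c : R) (F : R -> \bar R) : (a != 0)%R ->
  (forall x, 0 <= F x) -> measurable_fun [set: R] F ->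
  \int[mu]_x F (a * x + c)%R = (`|a|^-1)%:E * \int[mu]_x F x.
Proof.
move=> a0 F0 mF.
have a0' : (0 <= `|a|)%R by [].
pose f := (fun x : measurableTypeR R => a * x + c : measurableTypeR R)%R.
pose nu := mscale (NngNum a0') (pushforward mu f : {measure set (measurableTypeR R) -> \bar R}).
have -> : \int[mu]_x F x = \int[nu (measurable_affine a c)]_x F x.
  apply: eq_measure_integral => /= A mA _.
  by rewrite -(lebesgue_measure_affine c a0 mA).
rewrite ge0_integral_mscale//= ge0_integral_pushforward//=; last exact: measurable_affine.
rewrite preimage_setT muleA -EFinM mulVf ?mul1e ?normr_eq0//.
Qed.

Lemma integral_shift (c : R) (F : R -> \bar R) :
  (forall x, 0 <= F x) -> measurable_fun [set: R] F ->
  \int[mu]_x F (x + c)%R = \int[mu]_x F x.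
Proof.
move=> F0 mF; have := @integral_affine 1%R c F (oner_neq0 _) F0 mF.
rewrite normr1 invr1 mul1e => <-; by under [in RHS]eq_integral do rewrite mul1r.
Qed.

Lemma integral_pred1 (a c : R) : (a != 0)%R ->
  \int[mu]_x ((a * x + c == 0)%R%:R%:E : \bar R) = 0.
Proof.
move=> a0; transitivity (\int[mu]_x ((\1_[set - c / a] x)%R%:E : \bar R)).
  apply: eq_integral => x _; rewrite indicE; congr ((nat_of_bool _)%:R%:E).
  rewrite in_set1 addr_eq0; apply/eqP/eqP => [<-|->]; field => //.
rewrite integral_indic// setIT; exact: lebesgue_measure_set1.
Qed.

(** The integral of a nonnegative function is a supremum over the simple functions below it, which
    is monotone for arbitrary integrands; this is what allows the volume of a hull to be
    squeezed. *)
Lemma le_integral0 d (T : measurableType d) (m : {measure set T -> \bar R})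
   (F G : T -> \bar R) : (forall x, 0 <= F x) -> (forall x, F x <= G x) ->
   \int[m]_x F x <= \int[m]_x G x.
Proof.
move=> F0 FG; have G0 x : 0 <= G x by apply: le_trans (FG x).
rewrite !ge0_integralTE//.
apply: le_ereal_sup => _ [h hF <-]; exists h => //= x.
exact: le_trans (FG x).
Qed.

End affine1.

(** * Calculus of iterated integrals *)

Section lint_theory.
Context {R : realType}.
Local Open Scope ereal_scope.

Lemma updE (I : eqType) (w : I -> R) i x : upd w i x i = x.
Proof. by rewrite /upd eqxx. Qed.

Lemma upd_neq (I : eqType) (w : I -> R) i x j : j != i -> upd w i x j = w j.
Proof. by rewrite /upd => /negbTE ->. Qed.

Lemma updC (I : eqType) (w : I -> R) i j x y : i != j ->
  upd (upd w i x) j y = upd (upd w j y) i x.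
Proof.
move=> ij; apply/funext => k; rewrite /upd; case: eqP => // ->; case: eqP => // ji.
by rewrite ji eqxx in ij.
Qed.

Lemma eq_lint (I : eqType) (s : seq I) (F G : (I -> R) -> \bar R) :
  F =1 G -> lint s F = lint s G.
Proof. by move=> /funext ->. Qed.

(** Coordinates outside [s] are [0] in [lint s]; a position pinned at level [0] is obtained by
    leaving it out of [s]. *)
Lemma eq_lint_supp (I : eqType) (s : seq I) (F G : (I -> R) -> \bar R) :
  (forall w, (forall i, i \notin s -> w i = 0%R) -> F w = G w) -> lint s F = lint s G.
Proof.
elim: s F G => [|i s IH] F G FG /=; first exact: FG.
apply: eq_integral => x _; apply: IH => w w0; apply: FG => j.
rewrite inE negb_or => /andP[ji js]; rewrite upd_neq//; exact: w0.
Qed.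

Lemma le_lint (I : eqType) (s : seq I) (F G : (I -> R) -> \bar R) :
  (forall w, 0 <= F w) -> (forall w, F w <= G w) -> lint s F <= lint s G.
Proof.
elim: s F G => [|i s IH] F G F0 FG //=.
by apply: le_integral0 => x; [exact: lint_ge0|exact: IH].
Qed.

Lemma lint_integral (I : eqType) (s : seq I) (F : R -> (I -> R) -> \bar R) :
  (forall x w, 0 <= F x w) ->
  measurable_fun [set: R * vec R I] (fun z => F z.1 z.2) ->
  \int[mu]_x lint s (F x) = lint s (fun w => \int[mu]_x F x w).
Proof.
elim: s F => [//|i s IH] F F0 mF /=.
rewrite integral_swap; first last.
- apply: (measurable_lint _ (X := (R * R)%type) (F := fun z w => F z.1 (upd w i z.2))) => //.
  apply: (measurable_precomp
    (f := fun z : (R * R) * vec R I => (z.1.1, upd z.2 i z.1.2 : vec R I)) mF).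
  apply: measurable_fun_pair => /=.
    exact: (measurableT_comp measurable_fst measurable_fst).
  apply: measurable_upd => //.
  exact: (measurableT_comp measurable_snd measurable_fst).
- by move=> x y; apply: lint_ge0.
apply: eq_integral => y _; rewrite -IH//.
apply: (measurable_precomp
  (f := fun z : R * vec R I => (z.1, upd z.2 i y : vec R I)) mF).
by apply: measurable_fun_pair => //; apply: measurable_upd.
Qed.

Lemma lint_swap (I J : eqType) (s : seq I) (t : seq J) (F : (I -> R) -> (J -> R) -> \bar R) :
  (forall v w, 0 <= F v w) ->
  measurable_fun [set: vec R I * vec R J] (fun z => F z.1 z.2) ->
  lint s (fun v => lint t (F v)) = lint t (fun w => lint s (F ^~ w)).
Proof.
elim: s F => [//|i s IH] F F0 mF /=.
rewrite -lint_integral; first last.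
- apply: (measurable_lint _ (X := (R * vec R J)%type) (F := fun z w => F (upd w i z.1) z.2)) => //.
  apply: (measurable_precomp
    (f := fun z : (R * vec R J) * vec R I => (upd z.2 i z.1.1 : vec R I, z.1.2)) mF).
  apply: measurable_fun_pair => /=; last first.
    exact: (measurableT_comp measurable_snd measurable_fst).
  apply: measurable_upd => //.
  exact: (measurableT_comp measurable_fst measurable_fst).
- by move=> x w; apply: lint_ge0.
apply: eq_integral => x _; rewrite IH//.
apply: (measurable_precomp
  (f := fun z : vec R I * vec R J => (upd z.1 i x : vec R I, z.2)) mF).
by apply: measurable_fun_pair => //; apply: measurable_upd.
Qed.

Definition mrg (I : eqType) (s : seq I) (w v : I -> R) : I -> R :=
  fun i => if i \in s then w i else v i.

Lemma lint_cat (I : eqType) (s t : seq I) (F : (I -> R) -> \bar R) :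
  lint (s ++ t) F = lint s (fun w => lint t (fun v => F (mrg s w v))).
Proof.
elim: s F => [|i s IH] F /=; first by [].
apply: eq_integral => x _; rewrite IH; apply: eq_lint => w; apply: eq_lint => v.
congr F; apply/funext => j; rewrite /mrg /upd inE.
by case: eqP.
Qed.

Lemma lint_map (I J : eqType) (f : J -> I) (s : seq J) (G : (J -> R) -> \bar R) :
  injective f -> lint (map f s) (fun w => G (w \o f)) = lint s G.
Proof.
move=> injf; elim: s G => [|j s IH] G /=; first by [].
apply: eq_integral => x _; rewrite -[RHS]IH; apply: eq_lint => w; congr G.
by apply/funext => k; rewrite /upd /= inj_eq.
Qed.

Lemma measurable_updx (I : eqType) (i : I) (x : R) (F : (I -> R) -> \bar R) :
  measurable_fun [set: vec R I] F ->
  measurable_fun [set: vec R I] (fun w : vec R I => F (upd w i x)).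
Proof.
move=> mF; apply: (measurable_precomp (f := fun w : vec R I => upd w i x : vec R I) mF).
by apply: measurable_upd.
Qed.

Lemma measurable_upd2 (I : eqType) (i : I) (F : (I -> R) -> \bar R) :
  measurable_fun [set: vec R I] F ->
  measurable_fun [set: R * vec R I] (fun z : R * vec R I => F (upd z.2 i z.1)).
Proof.
move=> mF; apply: (measurable_precomp (f := fun z : R * vec R I => upd z.2 i z.1 : vec R I) mF).
by apply: measurable_upd.
Qed.

Lemma measurable_lint_upd (I : eqType) (s : seq I) (i : I) (F : (I -> R) -> \bar R) :
  (forall w, 0 <= F w) -> measurable_fun [set: vec R I] F ->
  measurable_fun [set: R] (fun x : R => lint s (fun w => F (upd w i x))).
Proof.
move=> F0 mF; apply: (measurable_lint _ (F := fun x w => F (upd w i x))) => //.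
exact: measurable_upd2.
Qed.

Lemma lint_cons (I : eqType) (i : I) (s : seq I) (F : (I -> R) -> \bar R) :
  (forall w, 0 <= F w) -> measurable_fun [set: vec R I] F ->
  lint (i :: s) F = lint s (fun w => \int[mu]_x F (upd w i x)).
Proof.
by move=> F0 mF /=; rewrite lint_integral//; exact: measurable_upd2.
Qed.

Lemma lint_move (I : eqType) (i : I) (s t : seq I) (F : (I -> R) -> \bar R) :
  i \notin s -> (forall w, 0 <= F w) -> measurable_fun [set: vec R I] F ->
  lint (s ++ i :: t) F = lint (i :: s ++ t) F.
Proof.
elim: s F => [//|a s IH] F; rewrite inE negb_or => /andP[ia is_] F0 mF.
rewrite [LHS]/= [RHS]/=.
transitivity (\int[mu]_y \int[mu]_x lint (s ++ t) (fun w => F (upd (upd w i x) a y))).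
  by apply: eq_integral => y _; rewrite IH//; exact: measurable_updx.
rewrite integral_swap.
- by apply: eq_integral => x _; apply: eq_integral => y _; apply: eq_lint => w; rewrite updC.
- by move=> x y; apply: lint_ge0.
apply: (measurable_lint _ (X := (R * R)%type) (F := fun z w => F (upd (upd w i z.2) a z.1))) => //.
apply: (measurable_precomp
  (f := fun z : (R * R) * vec R I => (upd (upd z.2 i z.1.2) a z.1.1 : vec R I)) mF).
apply: measurable_upd; last exact: (measurableT_comp measurable_fst measurable_fst).
apply: measurable_upd => //; exact: (measurableT_comp measurable_snd measurable_fst).
Qed.

Lemma lint_perm (I : eqType) (s t : seq I) (F : (I -> R) -> \bar R) :
  uniq s -> perm_eq s t ->
  (forall w, 0 <= F w) -> measurable_fun [set: vec R I] F -> lint s F = lint t F.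
Proof.
elim: s t F => [|i s IH] t F.
  by move=> _; rewrite perm_sym => /perm_nilP ->.
move=> /= /andP[is_ us] st F0 mF.
have it : i \in t by rewrite -(perm_mem st) mem_head.
have ut : uniq t by rewrite -(perm_uniq st) /= is_.
case/splitPr: it st ut => t1 t2 st ut.
have st' : perm_eq s (t1 ++ t2).
  by rewrite -(perm_cons i); apply: perm_trans st _; rewrite perm_catC /= perm_cons perm_catC.
have it1 : i \notin t1.
  by move: ut; rewrite cat_uniq /= negb_or => /and3P[_ /andP[]].
rewrite lint_move//=; apply: eq_integral => x _; apply: IH => //.
exact: measurable_updx.
Qed.

Lemma lint_Zl (I : eqType) (s : seq I) (c : \bar R) (F : (I -> R) -> \bar R) :
  0 <= c -> (forall w, 0 <= F w) -> measurable_fun [set: vec R I] F ->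
  lint s (fun w => c * F w) = c * lint s F.
Proof.
elim: s F => [//|i s IH] F c0 F0 mF /=.
rewrite -ge0_integralZl//.
- by apply: eq_integral => x _; rewrite IH//; exact: measurable_updx.
- exact: measurable_lint_upd.
- by move=> x _; apply: lint_ge0.
Qed.

Lemma lint_D (I : eqType) (s : seq I) (F G : (I -> R) -> \bar R) :
  (forall w, 0 <= F w) -> measurable_fun [set: vec R I] F ->
  (forall w, 0 <= G w) -> measurable_fun [set: vec R I] G ->
  lint s (fun w => F w + G w) = lint s F + lint s G.
Proof.
elim: s F G => [//|i s IH] F G F0 mF G0 mG /=.
rewrite -ge0_integralD//.
- by apply: eq_integral => x _; rewrite IH//; exact: measurable_updx.
- by move=> x _; apply: lint_ge0.
- exact: measurable_lint_upd.
- by move=> x _; apply: lint_ge0.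
- exact: measurable_lint_upd.
Qed.

Lemma lint0 (I : eqType) (s : seq I) : lint s (fun _ : I -> R => 0) = 0.
Proof. by elim: s => [//|i s IH] /=; rewrite IH integral0. Qed.

Lemma lint_sum (I : eqType) (s : seq I) (K : Type) (r : seq K) (P : pred K)
    (F : K -> (I -> R) -> \bar R) :
  (forall k w, 0 <= F k w) -> (forall k, measurable_fun [set: vec R I] (F k)) ->
  lint s (fun w => \sum_(k <- r | P k) F k w) = \sum_(k <- r | P k) lint s (F k).
Proof.
move=> F0 mF; elim: r => [|k r IH].
  by rewrite big_nil -[RHS](lint0 s); apply: eq_lint => w; rewrite big_nil.
rewrite big_cons -IH; case: ifPn => Pk.
  rewrite -lint_D//.
  - by apply: eq_lint => w; rewrite big_cons Pk.
  - by move=> w; apply: sume_ge0.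
  - rewrite (_ : (fun w : I -> R => _) = (fun w : vec R I => \sum_(j <- r) (if P j then F j w else 0))).
      by apply: emeasurable_sum => j; case: (P j).
    by apply/funext => w; rewrite big_mkcond.
by apply: eq_lint => w; rewrite big_cons (negbTE Pk).
Qed.

(* No measurability of [F] is required: the hull is not known to be measurable. *)
Lemma lint_sandwich (I : eqType) (s : seq I) (N : (I -> R) -> bool)
    (F G : (I -> R) -> \bar R) :
  (forall w, 0 <= F w) -> (forall w, 0 <= G w) -> measurable_fun [set: vec R I] G ->
  measurable_fun [set: vec R I] (fun w => (N w)%:R%:E : \bar R) ->
  lint s (fun w => (N w)%:R%:E) = 0 ->
  (forall w, ~~ N w -> F w = G w) -> lint s F = lint s G.
Proof.
move=> F0 G0 mG mN N0 FG.
have mN' : measurable_fun [set: vec R I] (fun w => (~~ N w)%:R%:E : \bar R).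
  have -> : (fun w : vec R I => (~~ N w)%:R%:E : \bar R) = (fun w => 1 - (N w)%:R%:E).
    by apply/funext => w; case: (N w); rewrite /= -EFinB ?subrr ?subr0.
  exact: emeasurable_funB.
(* Squeeze: [F] lies between [G] off [N] and [G] plus [+oo] on [N]; since [+oo * 0 = 0], the added
   term integrates to zero. *)
have infN : lint s (fun w => +oo * (N w)%:R%:E) = 0.
  by rewrite lint_Zl// ?N0 ?mule0// => w; case: (N w).
have mGN : measurable_fun [set: vec R I] (fun w => G w * (~~ N w)%:R%:E).
  exact: emeasurable_funM.
have GE : lint s G = lint s (fun w => G w * (~~ N w)%:R%:E).
  apply/eqP; rewrite eq_le; apply/andP; split.
    rewrite -[leRHS]adde0 -infN -lint_D//.
    - by apply: le_lint => // w; case: (N w); rewrite /= ?mule0 ?mule1 ?add0e ?adde0// leey.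
    - by move=> w; apply: mule_ge0.
    - exact: emeasurable_funM.
  apply: le_lint => w; first by apply: mule_ge0.
  by case: (N w); rewrite /= ?mule0 ?mule1.
rewrite GE; apply/eqP; rewrite eq_le; apply/andP; split.
  rewrite -[leRHS]adde0 -infN -lint_D//.
  - apply: le_lint => // w; case: (boolP (N w)) => Nw /=; rewrite ?mule0 ?mule1 ?add0e ?adde0 ?leey//.
    by rewrite FG.
  - by move=> w; apply: mule_ge0.
  - exact: emeasurable_funM.
apply: le_lint => w; first by apply: mule_ge0.
by case: (boolP (N w)) => Nw; rewrite /= ?mule0 ?mule1// FG.
Qed.

End lint_theory.

Section measurability_tools.
Context d (X : measurableType d) {R : realType}.

Lemma measurable_sumr (K : Type) (r : seq K) (P : pred K) (f : K -> X -> R) :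
  (forall k, P k -> measurable_fun [set: X] (f k)) ->
  measurable_fun [set: X] (fun x => \sum_(k <- r | P k) f k x).
Proof.
move=> mf; elim: r => [|k r IH].
  by rewrite (_ : (fun _ => _) = (fun=> 0))//; apply/funext => x; rewrite big_nil.
case: (boolP (P k)) => Pk.
  rewrite (_ : (fun _ => _) = (fun x => f k x + \sum_(j <- r | P j) f j x)).
    by apply: measurable_funD => //; exact: mf.
  by apply/funext => x; rewrite big_cons Pk.
by rewrite (_ : (fun _ => _) = (fun x => \sum_(j <- r | P j) f j x))//;
  apply/funext => x; rewrite big_cons (negbTE Pk).
Qed.

Lemma measurable_prodr (K : Type) (r : seq K) (P : pred K) (f : K -> X -> R) :
  (forall k, P k -> measurable_fun [set: X] (f k)) ->
  measurable_fun [set: X] (fun x => \prod_(k <- r | P k) f k x).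
Proof.
move=> mf; elim: r => [|k r IH].
  by rewrite (_ : (fun _ => _) = (fun=> 1))//; apply/funext => x; rewrite big_nil.
case: (boolP (P k)) => Pk.
  rewrite (_ : (fun _ => _) = (fun x => f k x * \prod_(j <- r | P j) f j x)).
    by apply: measurable_funM => //; exact: mf.
  by apply/funext => x; rewrite big_cons Pk.
by rewrite (_ : (fun _ => _) = (fun x => \prod_(j <- r | P j) f j x))//;
  apply/funext => x; rewrite big_cons (negbTE Pk).
Qed.

Lemma measurable_boolR (b : X -> bool) :
  measurable_fun [set: X] b -> measurable_fun [set: X] (fun x => (b x)%:R : R).
Proof.
by move=> mb; apply: (measurable_precomp (g := fun b : bool => b%:R : R) _ mb).
Qed.

Lemma measurable_boolE (b : X -> bool) :
  measurable_fun [set: X] b -> measurable_fun [set: X] (fun x => (b x)%:R%:E : \bar R).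
Proof. by move=> mb; apply/measurable_EFinP; exact: measurable_boolR. Qed.

Lemma measurable_all (K : Type) (r : seq K) (b : K -> X -> bool) :
  (forall k, measurable_fun [set: X] (b k)) ->
  measurable_fun [set: X] (fun x => all (b^~ x) r).
Proof.
move=> mb; elim: r => [|k r IH] /=; first exact: measurable_cst.
exact: measurable_and.
Qed.

Lemma measurable_forall (K : finType) (b : K -> X -> bool) :
  (forall k, measurable_fun [set: X] (b k)) ->
  measurable_fun [set: X] (fun x => [forall k, b k x]).
Proof.
move=> mb; rewrite (_ : (fun _ => _) = (fun x => all (b^~ x) (enum K))).
  exact: measurable_all.
apply/funext => x; apply/forallP/allP => [h k _|h k]; first exact: h.
by apply: h; rewrite mem_enum.
Qed.

Lemma measurable_exists (K : finType) (b : K -> X -> bool) :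
  (forall k, measurable_fun [set: X] (b k)) ->
  measurable_fun [set: X] (fun x => [exists k, b k x]).
Proof.
move=> mb; rewrite (_ : (fun _ => _) = (fun x => ~~ [forall k, ~~ b k x])).
  by apply: measurable_neg; apply: measurable_forall => k; exact: measurable_neg.
by apply/funext => x; rewrite negb_forall; apply: eq_existsb => k; rewrite negbK.
Qed.

End measurability_tools.

(** * Changes of variables in iterated integrals *)

Section change_of_variables.
Context {R : realType}.
Local Open Scope ereal_scope.

Lemma lint_shift (I : eqType) (s : seq I) (c : I -> R) (F : (I -> R) -> \bar R) :
  (forall w, 0 <= F w) -> measurable_fun [set: vec R I] F ->
  lint s (fun w => F (fun i => if i \in s then w i + c i else w i)%R) = lint s F.
Proof.
elim: s F => [//|i s IH] F F0 mF /=.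
rewrite -(integral_shift (c i) (F := fun x => lint s (fun w => F (upd w i x)))).
- apply: eq_integral => x _.
  rewrite -(IH (fun w => F (upd w i (x + c i)%R)))//; last exact: measurable_updx.
  apply: eq_lint => w; congr F; apply/funext => j; rewrite /upd inE.
  by case: eqP => //= ->.
- by move=> x; apply: lint_ge0.
- exact: measurable_lint_upd.
Qed.

Lemma lint_scale (I : eqType) (s : seq I) (a : R) (F : (I -> R) -> \bar R) :
  a != 0%R -> (forall w, 0 <= F w) -> measurable_fun [set: vec R I] F ->
  lint s (fun w => F (fun i => a * w i)%R) = (`|a| ^- size s)%:E * lint s F.
Proof.
elim: s F => [|i s IH] F a0 F0 mF /=.
  by rewrite expr0 invr1 mul1e; congr F; apply/funext => i; rewrite mulr0.
rewrite exprSr invfM EFinM -muleA.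
rewrite -(integral_affine 0 (F := fun x => lint s (fun w => F (upd w i x))))//.
- rewrite -ge0_integralZl//.
  + apply: eq_integral => x _; rewrite addr0.
    rewrite -(IH (fun w => F (upd w i (a * x)%R)))//; last exact: measurable_updx.
    apply: eq_lint => w; congr F; apply/funext => j; rewrite /upd.
    by case: eqP.
  + apply: (measurable_precomp (f := fun x => (a * x + 0)%R)
             (g := fun x => lint s (fun w => F (upd w i x)))).
      exact: measurable_lint_upd.
    exact: measurable_affine.
  + by move=> x _; apply: lint_ge0.
- by move=> x; apply: lint_ge0.
- exact: measurable_lint_upd.
Qed.

(** For fixed other coordinates the equation determines [w i]. The exceptional sets met later (ties,
    special positions, special heights) are null for this reason. *)
Lemma lint_null_graph (I : eqType) (s : seq I) (i : I) (b : R) (g : (I -> R) -> R) :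
  i \in s -> uniq s -> b != 0%R -> measurable_fun [set: vec R I] g ->
  (forall w x, g (upd w i x) = g w) ->
  lint s (fun w => (b * w i + g w == 0)%R%:R%:E : \bar R) = 0.
Proof.
move=> is_ us b0 mg gi.
have mF : measurable_fun [set: vec R I] (fun w : vec R I => (b * w i + g w == 0)%R%:R%:E : \bar R).
  apply: measurable_boolE; apply: measurable_fun_eqr => //.
  apply: measurable_funD => //; apply: measurable_funM => //; exact: measurable_coord.
rewrite (@lint_perm _ _ s (i :: rem i s))//; last exact: perm_to_rem.
rewrite lint_cons// -[RHS](lint0 (rem i s)); apply: eq_lint => w.
rewrite -[RHS](integral_pred1 (g w) b0).
by apply: eq_integral => x _; rewrite gi updE.
Qed.

End change_of_variables.

(** * Linear changes of variables *)

Section linear_change.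
Context {R : realType} (n : nat).
Local Open Scope ereal_scope.

Definition mxact (M : 'M[R]_n) (w : 'I_n -> R) : 'I_n -> R :=
  fun i => (\sum_j M i j * w j)%R.

Lemma mxact_mul (M N : 'M[R]_n) w : mxact (M *m N) w = mxact M (mxact N w).
Proof.
apply/funext => i; rewrite /mxact.
under eq_bigr do rewrite mxE mulr_suml.
rewrite exchange_big /=; apply: eq_bigr => j _; rewrite mulr_sumr.
by apply: eq_bigr => k _; rewrite mulrA.
Qed.

Lemma measurable_mxact (M : 'M[R]_n) :
  measurable_fun [set: vec R 'I_n] (fun w => mxact M w : vec R 'I_n).
Proof.
apply: measurable_vec => i; apply: measurable_sumr => j _.
by apply: measurable_funM => //; exact: measurable_coord.
Qed.

(** The change of variables formula as a property of one matrix, so that it can be transported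
    through matrix products. *)
Definition lint_linear_at (M : 'M[R]_n) := forall F : ('I_n -> R) -> \bar R,
  (forall w, 0 <= F w) -> measurable_fun [set: vec R 'I_n] F ->
  lint (enum 'I_n) (fun w => F (mxact M w)) =
  (`|\det M|^-1)%:E * lint (enum 'I_n) F.

Lemma lint_linear_mul M N : lint_linear_at M -> lint_linear_at N -> lint_linear_at (M *m N).
Proof.
move=> PM PN F F0 mF; under eq_lint do rewrite mxact_mul.
rewrite (PN (fun w => F (mxact M w)))//; last first.
  exact: (measurable_precomp mF (measurable_mxact M)).
by rewrite PM// muleA -EFinM det_mulmx normrM invfM mulrC.
Qed.

(** The identity with row [k] replaced: it alters one coordinate only, so it acts as a
    one-dimensional affine substitution. *)
Definition rowm (k : 'I_n) (r : 'I_n -> R) : 'M[R]_n :=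
  \matrix_(i, j) (if i == k then r j else (i == j)%:R).

Lemma det_rowm k r : \det (rowm k r) = r k.
Proof.
rewrite (expand_det_row _ k) (bigD1 k)//= big1 ?addr0.
  have -> : cofactor (rowm k r) k k = cofactor 1%:M k k.
    rewrite /cofactor; congr (_ * \det _)%R; apply/matrixP => i j; rewrite !mxE.
    by rewrite eq_sym (negbTE (neq_lift _ _)).
  have := congr1 (fun A : 'M[R]_n => A k k) (@adj1 R n).
  by rewrite !mxE !eqxx => ->; rewrite mulr1.
move=> j jk; have -> : cofactor (rowm k r) k j = cofactor 1%:M k j.
  rewrite /cofactor; congr (_ * \det _)%R; apply/matrixP => i l; rewrite !mxE.
  by rewrite eq_sym (negbTE (neq_lift _ _)).
have := congr1 (fun A : 'M[R]_n => A j k) (@adj1 R n).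
by rewrite !mxE (negbTE jk) => ->; rewrite mulr0.
Qed.

Lemma lint_linear_rowm k r : r k != 0%R -> lint_linear_at (rowm k r).
Proof.
move=> rk F F0 mF; rewrite det_rowm.
have kin : k \in enum 'I_n by rewrite mem_enum.
have ps : perm_eq (enum 'I_n) (k :: rem k (enum 'I_n)) by exact: perm_to_rem.
rewrite (lint_perm (enum_uniq _) ps)//; last first.
  exact: (measurable_precomp mF (measurable_mxact _)).
rewrite (lint_perm (F := F) (enum_uniq _) ps)//.
have m2 := measurable_upd2 k mF.
rewrite !lint_cons//; last exact: (measurable_precomp mF (measurable_mxact _)).
rewrite -lint_Zl//; last 2 first.
- by move=> w; apply: integral_ge0.
- apply: (measurable_integral (X := vec R _) (F := fun (w : vec R _) x => F (upd w k x))) => //.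
  apply: (measurable_precomp (f := fun z : vec R 'I_n * R => upd z.1 k z.2 : vec R 'I_n) mF).
  exact: measurable_upd.
apply: eq_lint => w.
rewrite -(integral_affine (\sum_(j | j != k) r j * w j)%R (F := fun x => F (upd w k x)))//.
  apply: eq_integral => x _; congr F; apply/funext => i; rewrite /mxact.
  rewrite {2}/upd; case: eqP => [->|/eqP ik].
    rewrite (bigD1 k)//= !mxE eqxx updE; congr (_ + _)%R.
    by apply: eq_bigr => j jk; rewrite !mxE eqxx upd_neq.
  rewrite (bigD1 i)//= mxE (negbTE ik) eqxx mul1r upd_neq// big1 ?addr0// => j ji.
  by rewrite mxE (negbTE ik) eq_sym (negbTE ji) mul0r.
apply: (measurable_precomp (f := fun x => upd w k x : vec R 'I_n) mF).
exact: measurable_upd.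
Qed.

Lemma lint_linear_1 : lint_linear_at 1%:M.
Proof.
move=> F F0 mF; rewrite det1 normr1 invr1 mul1e; apply: eq_lint => w; congr F.
apply/funext => i; rewrite /mxact (bigD1 i)//= mxE eqxx mul1r big1 ?addr0// => j ji.
by rewrite mxE eq_sym (negbTE ji) mul0r.
Qed.

(** [M] is built from the identity one row at a time, in the order given by [rk], each new row being
    a left factor [rowm]. The identity and the reversal as [rk] give upper and lower triangular
    matrices. *)
Lemma lint_linear_triangular (rk : 'I_n -> 'I_n) (M : 'M[R]_n) : involutive rk ->
  (forall i j, (rk j < rk i)%N -> M i j = 0%R) -> (forall i, M i i != 0%R) -> lint_linear_at M.
Proof.
move=> rkK tM dM.
pose T k : 'M[R]_n := \matrix_(i, j) (if (rk i < k)%N then M i j else (i == j)%:R).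
have -> : M = T n by apply/matrixP => i j; rewrite mxE ltn_ord.
elim: {-2}n (leqnn n) => [|k IH] kn.
  rewrite (_ : T 0%N = 1%:M); first exact: lint_linear_1.
  by apply/matrixP => i j; rewrite !mxE.
pose i0 := rk (Ordinal kn).
have rki0 : rk i0 = k :> nat by rewrite /i0 rkK.
have -> : T k.+1 = rowm i0 (M i0) *m T k.
  apply/matrixP => i j; rewrite !mxE.
  have [->|ii0] := eqVneq i i0.
    rewrite rki0 ltnSn (bigD1 j)//= !mxE eqxx.
    case: ltnP => [jk|jk].
      rewrite [M i0 j]tM ?rki0// mul0r add0r big1// => l lj.
      rewrite !mxE eqxx; case: ltnP => lk; first by rewrite tM ?rki0// mul0r.
      by rewrite (negbTE lj) mulr0.
    rewrite eqxx mulr1 big1 ?addr0// => l lj; rewrite !mxE eqxx.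
    case: ltnP => lk; first by rewrite tM ?rki0// mul0r.
    by rewrite (negbTE lj) mulr0.
  rewrite (bigD1 i)//= !mxE (negbTE ii0) eqxx mul1r big1 ?addr0.
    rewrite ltnS leq_eqVlt; case: eqP => //= rik.
    by move/eqP: ii0; case; apply: (can_inj rkK); apply/val_inj; rewrite /= rki0.
  by move=> l li; rewrite !mxE (negbTE ii0) eq_sym (negbTE li) mul0r.
apply: lint_linear_mul; first exact: lint_linear_rowm.
exact: IH (ltnW kn).
Qed.

Lemma lint_linear_perm (s : 'S_n) : lint_linear_at (perm_mx s).
Proof.
move=> F F0 mF; rewrite det_perm normrX normrN1 expr1n invr1 mul1e.
transitivity (lint (enum 'I_n) (fun w => F (w \o s))).
  apply: eq_lint => w; congr F; apply/funext => i; rewrite /mxact /=.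
  under eq_bigr do rewrite !mxE.
  rewrite (bigD1 (s i))//= big1 ?addr0; first by rewrite eqxx mul1r.
  by move=> j ji; rewrite eq_sym (negbTE ji) mul0r.
rewrite -[RHS](lint_map (f := s) (enum 'I_n) F (@perm_inj _ s)).
apply: lint_perm => //; first exact: enum_uniq.
  apply: uniq_perm; first exact: enum_uniq.
    by rewrite map_inj_uniq ?enum_uniq//; exact: perm_inj.
  move=> i; rewrite mem_enum; apply/esym/mapP; exists ((s^-1)%g i); first by rewrite mem_enum.
  by rewrite permKV.
apply: (measurable_precomp (f := fun w : vec R 'I_n => w \o s : vec R 'I_n) mF).
apply: measurable_vec => i; exact: measurable_coord.
Qed.


Lemma lint_linear_upper (M : 'M[R]_n) : (forall i j : 'I_n, (j < i)%N -> M i j = 0%R) ->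
  (forall i, M i i != 0%R) -> lint_linear_at M.
Proof. by move=> tM dM; apply: (lint_linear_triangular (rk := id)). Qed.

Lemma lint_linear_lower (M : 'M[R]_n) : (forall i j : 'I_n, (i < j)%N -> M i j = 0%R) ->
  (forall i, M i i != 0%R) -> lint_linear_at M.
Proof.
move=> tM dM; apply: (lint_linear_triangular (rk := @rev_ord n)) => //.
  exact: rev_ordK.
move=> i j; rewrite /= ltn_sub2lE ?ltn_ord// ltnS; exact: tM.
Qed.

End linear_change.

Section linear_change_theorem.
Context {R : realType}.
Local Open Scope ereal_scope.

(** The LUP decomposition splits an invertible matrix into a permutation and two triangular factors
    with nonzero diagonals. *)
Lemma lint_linear n (M : 'M[R]_n) (F : ('I_n -> R) -> \bar R) : (\det M != 0)%R ->
  (forall w, 0 <= F w) -> measurable_fun [set: vec R 'I_n] F ->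
  lint (enum 'I_n) (fun w => F (mxact M w)) =
  (`|\det M|^-1)%:E * lint (enum 'I_n) F.
Proof.
case: n => [|n] in M F *.
  move=> _ F0 mF; rewrite det_mx00 normr1 invr1 mul1e.
  by apply: eq_lint => w; congr F; apply/funext => -[].
have := cormen_lup_correct M; have := cormen_lup_perm M; have := cormen_lup_detL M.
have := @cormen_lup_lower _ _ M; have := @cormen_lup_upper _ _ M.
case: cormen_lup => [[P L] U] /= tU tL dL /is_perm_mxP[s ->] PM.
have {PM} -> : M = perm_mx s^-1%g *m (L *m U).
  transitivity (perm_mx s^-1%g *m (perm_mx s *m M)); last by congr (_ *m _); exact: PM.
  by rewrite mulmxA -perm_mxM mulVg perm_mx1 mul1mx.
rewrite !det_mulmx dL mul1r mulf_eq0 negb_or => /andP[_ dU]; rewrite -[\det U]mul1r -dL -!det_mulmx.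
move: F; rewrite -/(lint_linear_at _).
apply: lint_linear_mul; first exact: lint_linear_perm.
apply: lint_linear_mul.
  apply: lint_linear_lower => [i j ij|i]; first by rewrite tL 1?ltnW// -val_eqE ltn_eqF.
  by rewrite tL// eqxx oner_neq0.
apply: lint_linear_upper => // i; apply: contra_neq dU => Uii.
rewrite -det_tr det_trig; last by apply/is_trig_mxP => k l kl; rewrite mxE tU.
by rewrite (bigD1 i)//= mxE Uii mul0r.
Qed.

End linear_change_theorem.

(** * The Gamma function and the slope integral *)

Section derivatives.
Context {R : realType}.

Lemma is_derive_expRN (x : R) : is_derive x (1:R)%R (fun t : R => - expR (- t) : R)%R (expR (- x)).
Proof.
have h0 : is_derive x (1:R)%R (-%R : R -> R) (-1)%R by exact: is_deriveN.
have h1 := @is_derive1_comp R expR (-%R) x _ _ (is_derive_expR (- x)) h0.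
have := is_deriveN h1.
by rewrite /GRing.scale /= mulrN1 opprK.
Qed.
Lemma is_derive_gauss (x : R) : is_derive x (1:R)%R (fun t : R => - expR (- t ^+ 2 / 2) : R)%R (x * expR (- x ^+ 2 / 2)).
Proof.
have h0 : is_derive x (1:R)%R ((fun t : R => t ^+ 2) : R -> R) (2 * x)%R.
  have := @is_deriveX _ _ id 2%N x (1:R) (1:R) (is_derive_id x (1:R)).
  by rewrite /GRing.scale /= mulr1 expr1.
have h2 : is_derive x (1:R)%R ((fun t : R => - t ^+ 2 / 2) : R -> R) (- x)%R.
  have h := is_deriveZ (- 2^-1 : R) h0.
  rewrite (_ : (fun t : R => - t ^+ 2 / 2)%R = (- 2^-1 : R) \*: (fun t : R => t ^+ 2)); last first.
    by apply/funext => t; rewrite /= /GRing.scale /=; field.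
  apply: is_derive_eq; rewrite /GRing.scale /=; by field.
have h1 := @is_derive1_comp R expR _ x _ _ (is_derive_expR _) h2.
have := is_deriveN h1.
by rewrite /GRing.scale /= mulrN opprK mulrC.
Qed.

Lemma is_derive_derivable (f : R -> R) (x df : R) : is_derive x (1:R)%R f df -> derivable f x 1.
Proof. by case. Qed.

Lemma is_derive_continuous (f : R -> R) (x df : R) : is_derive x (1:R)%R f df ->
  f y @[y --> x] --> f x.
Proof.
move=> /is_derive_derivable h.
by apply: differentiable_continuous; apply/derivable1_diffP.
Qed.

Lemma is_derive_derive1 (f : R -> R) (x df : R) : is_derive x (1:R)%R f df -> (f^`())%classic x = df.
Proof. by move=> h; rewrite derive1E; exact: derive_val. Qed.

Lemma continuous_expRN : continuous (fun x : R => expR (- x) : R).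
Proof.
move=> x; apply: (@continuous_comp _ _ _ (fun x : R => - x : R)%R expR); [exact: continuousN|exact: continuous_expR].
Qed.

Lemma continuous_xgauss : continuous (fun x : R => x * expR (- x ^+ 2 / 2) : R).
Proof.
move=> x; apply: cvgM; first exact: cvg_id.
apply: (@continuous_comp _ _ _ (fun x : R => - x ^+ 2 / 2 : R)%R expR); last exact: continuous_expR.
apply: cvgM; last exact: cvg_cst.
by apply: (@cvgN _ R^o); exact: exprn_continuous.
Qed.

End derivatives.

Section half_line.
Context {R : realType}.
Local Open Scope ereal_scope.

Lemma integral_indicE (D : set R) (b : R -> bool) (f : R -> \bar R) :
  (forall x, D x <-> b x) ->
  \int[mu]_(x in D) f x = \int[mu]_x ((b x)%:R%:E * f x).
Proof.
move=> Db; rewrite integral_mkcond; apply: eq_integral => x _; rewrite patchE.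
have -> : (x \in D) = b x by apply/idP/idP => [/set_mem/Db//|bx]; apply/mem_set/Db.
by case: (b x); rewrite ?mul1e ?mul0e.
Qed.

Lemma integral_expR_tail (u : R) :
  \int[mu]_(t in `]u, +oo[) (expR (- t))%:E = (expR (- u))%:E.
Proof.
rewrite integral_itv_obnd_cbnd; last first.
  apply/measurable_EFinP; apply: measurable_funTS.
  by apply: measurableT_comp => //; exact: measurableT_comp.
have dF (x : R) := is_derive_expRN x.
rewrite (@ge0_continuous_FTC2y _ _ (fun t => - expR (- t))%R _ 0).
- by rewrite EFinN oppeK add0e.
- by move=> x _; exact: expR_ge0.
- by apply: continuous_subspaceT; exact: continuous_expRN.
- by rewrite -oppr0; apply: cvgN; exact: cvgr_expR.
- by move=> x _; exact: (is_derive_derivable (dF x)).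
- by apply: cvg_at_right_filter; exact: (is_derive_continuous (dF u)).
- by move=> x _; exact: (is_derive_derive1 (dF x)).
Qed.

Lemma integral_gauss_tail (u : R) : (0 <= u)%R ->
  \int[mu]_(t in `]u, +oo[) (t * expR (- t ^+ 2 / 2))%:E = (expR (- u ^+ 2 / 2))%:E.
Proof.
move=> u0; rewrite integral_itv_obnd_cbnd; last first.
  apply/measurable_EFinP; apply: measurable_funTS; apply: measurable_funM => //.
  apply: measurableT_comp => //; apply: measurable_funM => //.
  by apply: measurableT_comp => //; exact: measurable_funX.
have dF (x : R) := is_derive_gauss x.
rewrite (@ge0_continuous_FTC2y _ _ (fun t => - expR (- t ^+ 2 / 2))%R _ 0).
- by rewrite EFinN oppeK add0e.
- by move=> x ux; rewrite mulr_ge0// ?expR_ge0// (le_trans u0).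
- by apply: continuous_subspaceT; exact: continuous_xgauss.
- rewrite -oppr0; apply: cvgN.
  rewrite (_ : (fun x => expR (- x ^+ 2 / 2)) = (fun z => expR (- z)) \o (fun z => 2^-1 * z ^+ 2))%R; last first.
    by apply: eq_fun => x; rewrite mulNr mulrC.
  apply: (@cvg_comp _ _ _ _ _ _ (pinfty_nbhs R)); last exact: cvgr_expR.
  apply: gt0_cvgMry; first by [].
  exact: cvgr_expr2.
- by move=> x _; exact: (is_derive_derivable (dF x)).
- by apply: cvg_at_right_filter; exact: (is_derive_continuous (dF u)).
- by move=> x _; exact: (is_derive_derive1 (dF x)).
Qed.

(** For [a < 1] the integrand is unbounded at [0], so the fundamental theorem is applied on
    [[t / (n+1), t]] and monotone convergence gives the limit. *)
Lemma integral_powR0 (a t : R) : (0 < a)%R -> (0 < t)%R ->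
  \int[mu]_(u in `]0%R, t]) (a * u `^ (a - 1))%:E = (t `^ a)%:E.
Proof.
move=> a0 t0.
pose e (n : nat) : R := (t / n.+1%:R)%R.
have e0 n : (0 < e n)%R by rewrite divr_gt0.
have et n : (e n <= t)%R by rewrite ler_pdivrMr// ler_peMr ?ler1n// ltW.
have mf : measurable_fun [set: R] (fun u => (a * u `^ (a - 1))%:E).
  apply/measurable_EFinP; apply: measurable_funM => //; exact: measurable_powR.
have IE n : \int[mu]_(u in `[e n, t]) (a * u `^ (a - 1))%:E = (t `^ a - e n `^ a)%:E.
  have := et n; rewrite le_eqVlt => /orP[/eqP ->|ent].
    by rewrite subrr set_itv1 integral_set1.
  have dP (x : R) : (0 < x)%R -> is_derive x (1%R : R) (@powR R ^~ a) (a * x `^ (a - 1))%R by exact: is_derive1_powR.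
  rewrite (@continuous_FTC2 _ _ (@powR R ^~ a)) ?EFinB//.
  - apply: continuous_in_subspaceT => x; rewrite inE /= in_itv /= => /andP[ex _].
    have x0 := lt_le_trans (e0 n) ex.
    have : (fun u : R => a * u `^ (a - 1))%R u @[u --> x] --> (a * x `^ (a - 1))%R; last by [].
    apply: cvgM; first exact: cvg_cst.
    exact: (is_derive_continuous (@is_derive1_powR R (a - 1)%R x x0)).
  - split.
    + move=> x; rewrite in_itv /= => /andP[ex _]; exact: (is_derive_derivable (dP x (lt_trans (e0 n) ex))).
    + by apply: cvg_at_right_filter; exact: (is_derive_continuous (dP _ (e0 n))).
    + by apply: cvg_at_left_filter; exact: (is_derive_continuous (dP _ t0)).
  - move=> x; rewrite in_itv /= => /andP[ex _]; have x0 := lt_trans (e0 n) ex.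
    exact: (is_derive_derive1 (dP x x0)).
have U : \bigcup_i `[e i, t]%classic = `]0%R, t]%classic.
  apply/seteqP; split => x /=.
    by move=> [n _ /=]; rewrite !in_itv /= => /andP[ex ->]; rewrite (lt_le_trans (e0 n) ex).
  rewrite in_itv /= => /andP[x0 xt]; exists (Num.bound (t / x)) => //=.
  rewrite in_itv /= xt andbT ler_pdivrMr// -ler_pdivrMl// mulrC.
  have := archi_boundP (ltW (divr_gt0 t0 x0)) => /ltW /le_trans; apply.
  by rewrite ler_nat.
rewrite -U.
have c : (fun i => \int[mu]_(u in `[e i, t]) (a * u `^ (a - 1))%:E) @ \oo -->
         \int[mu]_(u in \bigcup_i `[e i, t]%classic) (a * u `^ (a - 1))%:E.
  apply: ge0_nondecreasing_set_cvg_integral => //.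
  - move=> i j ij; apply/subsetPset => x /=; rewrite !in_itv /= => /andP[ex ->]; rewrite andbT.
    apply: le_trans ex; rewrite /e ler_pM2l// lef_pV2 ?posrE// ler_nat ltnS; exact: ij.
  - by move=> i; exact: measurable_funTS.
  - move=> i x /=; rewrite in_itv /= => /andP[ex _].
    by rewrite lee_fin mulr_ge0 ?powR_ge0// ltW.
apply: cvg_unique c _ => //.
rewrite /= (_ : (fun i => _) = (fun i => (t `^ a - e i `^ a)%:E)); last exact/funext.
apply: cvg_EFin; first by near=> n.
rewrite /comp /=; rewrite -[X in _ --> X]subr0; apply: cvgB; first exact: cvg_cst.
apply: (@cvg_comp _ _ _ e (fun x => x `^ a)%R); last exact: (powR_cvg0 a0).
have ce : e @ \oo --> (0%R : R).
  rewrite -[X in _ --> X](mulr0 t); apply: cvgM; first exact: cvg_cst.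
  exact: cvg_harmonic.
move=> A [eps /= eps0 hA]; move/cvgrPdist_lt : ce => /(_ eps eps0)[N _ hN].
by exists N => // n /hN /= h; apply: hA.
Unshelve. all: by end_near. Qed.


(* Tonelli on the region 0 < u < t. *)
Lemma integral_wedge_swap (f g : R -> R) :
  (forall x, 0 < x -> 0 <= f x)%R -> (forall x, 0 < x -> 0 <= g x)%R ->
  measurable_fun [set: R] f -> measurable_fun [set: R] g ->
  \int[mu]_(t in `]0%R, +oo[) ((f t)%:E * \int[mu]_(u in `]0%R, t]) (g u)%:E) =
  \int[mu]_(u in `]0%R, +oo[) ((g u)%:E * \int[mu]_(t in `]u, +oo[) (f t)%:E).
Proof.
move=> f0 g0 mf mg.
have ipos (x : R) : `]0%R, +oo[%classic x <-> (0 < x)%R by rewrite /= in_itv /= andbT.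
have iwed (t x : R) : `]0%R, t]%classic x <-> (0 < x <= t)%R by rewrite /= in_itv.
have itail (u x : R) : `]u, +oo[%classic x <-> (u < x)%R by rewrite /= in_itv /= andbT.
rewrite !(integral_indicE _ ipos).
pose h (t u : R) : \bar R := ((0 < u)%R && (u < t)%R)%:R%:E * (f t * g u)%R%:E.
have h0 t u : 0 <= h t u.
  rewrite /h; case: (ltP 0%R u) => u0 /=; last by rewrite mul0e.
  case: (ltP u t) => ut; last by rewrite mul0e.
  by rewrite mul1e lee_fin mulr_ge0 ?f0 ?g0// (lt_trans u0).
have mh : measurable_fun [set: R * R] (fun z => h z.1 z.2).
  apply: emeasurable_funM.
    apply: measurable_boolE; apply: measurable_and; apply: measurable_fun_ltr => //.
  apply/measurable_EFinP; apply: measurable_funM.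
    exact: (measurableT_comp mf).
  exact: (measurableT_comp mg).
transitivity (\int[mu]_t \int[mu]_u h t u); last first.
  rewrite integral_swap//; apply: eq_integral => u _.
  have [u0|u0] := ltP 0%R u; last first.
    by rewrite mul0e; apply: integral0_eq => t _; rewrite /h ltNge u0 mul0e.
  rewrite mul1e (integral_indicE _ (itail u)) -ge0_integralZl//=.
  - apply: eq_integral => t _; rewrite /h u0 /=; case: (ltP u t) => ut; last by rewrite !mul0e mule0.
    by rewrite !mul1e -EFinM mulrC.
  - apply: emeasurable_funM; last exact/measurable_EFinP.
    by apply: measurable_boolE; exact: measurable_fun_ltr.
  - move=> t _; case: (ltP u t) => ut; last by rewrite mul0e.
    by rewrite mul1e lee_fin f0// (lt_trans u0).
  - by rewrite lee_fin g0.
apply: eq_integral => t _.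
have [t0|t0] := ltP 0%R t; last first.
  rewrite mul0e; apply/esym/integral0_eq => u _; rewrite /h.
  case: (ltP 0%R u) => //= u0; last by rewrite mul0e.
  by rewrite ltNge (le_trans t0 (ltW u0)) mul0e.
rewrite mul1e -integral_itv_bndo_bndc; last exact/measurable_EFinP/measurable_funTS.
have iw (x : R) : `]0%R, t[%classic x <-> (0 < x < t)%R by rewrite /= in_itv.
rewrite (integral_indicE _ iw) -ge0_integralZl//=.
- apply: eq_integral => u _; rewrite /h; case: (_ && _); last by rewrite !mul0e mule0.
  by rewrite !mul1e -EFinM.
- apply: emeasurable_funM; last exact/measurable_EFinP.
  by apply: measurable_boolE; apply: measurable_and; exact: measurable_fun_ltr.
- move=> u _; case: (boolP (_ && _)) => [/andP[u0 ut]|]; last by rewrite mul0e.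
  by rewrite mul1e lee_fin g0.
- by rewrite lee_fin f0.
Qed.

(** The integral behind [Gamma] before it is made real by [fine]; its finiteness at the values [d/2]
    comes out of [cauchy_integralE]. *)
Definition eGamma (x : R) : \bar R :=
  \int[mu]_(t in `]0%R, +oo[) (t `^ (x - 1) * expR (- t))%:E.

(** Integration by parts in Tonelli form: [t^a] is the integral of [a * u^(a-1)] over []0, t]], and
    exchanging the integrals leaves the exponential tail. *)
Lemma eGammaD1 (a : R) : (0 < a)%R -> eGamma (a + 1) = a%:E * eGamma a.
Proof.
move=> a0.
transitivity (\int[mu]_(t in `]0%R, +oo[) ((expR (- t))%:E * \int[mu]_(u in `]0%R, t]) (a * u `^ (a - 1))%:E)).
  apply: eq_integral => t; rewrite inE /= in_itv /= andbT => t0.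
  by rewrite integral_powR0// -EFinM addrK mulrC.
rewrite (@integral_wedge_swap (fun t => expR (- t))%R (fun u => a * u `^ (a - 1))%R).
- rewrite /eGamma -ge0_integralZl//.
  + by apply: eq_integral => u _; rewrite integral_expR_tail -!EFinM mulrA.
  + apply/measurable_EFinP; apply: measurable_funTS; apply: measurable_funM.
      exact: measurable_powR.
    by apply: measurableT_comp => //; exact: measurableT_comp.
  + by move=> x _; rewrite lee_fin mulr_ge0 ?powR_ge0 ?expR_ge0.
  + by rewrite lee_fin ltW.
- by move=> x _; exact: expR_ge0.
- by move=> x _; rewrite mulr_ge0 ?powR_ge0// ltW.
- by apply: measurableT_comp => //; exact: measurableT_comp.
- by apply: measurable_funM => //; exact: measurable_powR.
Qed.

Lemma eGamma1 : eGamma 1 = 1.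
Proof.
transitivity (\int[mu]_(t in `]0%R, +oo[) (expR (- t))%:E : \bar R); last first.
  by rewrite integral_expR_tail oppr0 expR0.
apply: eq_integral => t; rewrite inE /= in_itv /= andbT => t0.
by rewrite subrr powRr0 mul1r.
Qed.

Lemma eGamma_nat (n : nat) : eGamma n.+1%:R = (n`!%:R)%:E.
Proof.
elim: n => [|n IH]; first by rewrite eGamma1.
by rewrite -natr1 eGammaD1// IH -EFinM -natrM.
Qed.

End half_line.

Local Notation phi := (normal_pdf 0 1).

(** * One-dimensional Gaussian integrals *)

Section gauss1.
Context {R : realType}.
Local Notation mu := (@lebesgue_measure R).
Local Open Scope ereal_scope.

Lemma normal_pdf0E (s x : R) : (0 < s)%R ->
  normal_pdf 0 s x = ((Num.sqrt (2 * pi) * s)^-1 * expR (- x ^+ 2 / (2 * s ^+ 2)))%R.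
Proof.
move=> s0; rewrite normal_pdfE ?gt_eqF// /normal_peak /normal_fun subr0; congr (_^-1 * expR (_ / _))%R.
  rewrite -mulrnAr mulr_natl sqrtrM ?sqr_ge0// sqrtr_sqr gtr0_norm// mulrC.
  by congr (Num.sqrt _ * _)%R.
by rewrite mulr_natl.
Qed.

Lemma phiE (x : R) : phi x = ((Num.sqrt (2 * pi))^-1 * expR (- x ^+ 2 / 2))%R.
Proof. by rewrite normal_pdf0E// expr1n !mulr1. Qed.

Lemma phi_ge0 (x : R) : (0 <= phi x)%R. Proof. exact: normal_pdf_ge0. Qed.

Lemma phiN (x : R) : phi (- x) = phi x :> R.
Proof. by rewrite !phiE sqrrN. Qed.

Lemma measurable_phi d (X : measurableType d) (f : X -> R) :
  measurable_fun [set: X] f -> measurable_fun [set: X] (fun x => phi (f x)).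
Proof. by move=> mf; apply: (measurable_precomp (g := phi : R -> R)) => //; exact: measurable_normal_pdf. Qed.

(** One factor [t] is the length of []0, t]]; after the exchange, the tail integral of
    [t * exp(-t^2/2)] beyond [u] is [exp(-u^2/2)], so the second moment equals the total mass.
    Symmetry restricts both integrals to the half line. *)
Lemma phi_second_moment : \int[mu]_x (x ^+ 2 * phi x : R)%:E = 1.
Proof.
have c0 : (0 <= (Num.sqrt (2 * pi))^-1 :> R)%R by rewrite invr_ge0 sqrtr_ge0.
have cphi : continuous (phi : R -> R) by apply: continuous_normal_pdf; exact: oner_neq0.
rewrite ge0_symfun_integralT; first last.
- by move=> x; rewrite /= sqrrN phiN.
- move=> x; apply: cvgM; [exact: exprn_continuous|exact: cphi].
- by move=> x; rewrite mulr_ge0 ?sqr_ge0 ?phi_ge0.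
rewrite -[RHS](integral_normal_pdf 0 1).
rewrite [RHS]ge0_symfun_integralT; first last.
- by move=> x; rewrite /= phiN.
- exact: cphi.
- by move=> x; exact: phi_ge0.
congr (_ * _).
have mp : measurable_fun [set: R] (phi : R -> R) by exact: measurable_normal_pdf.
have open0 (f : R -> R) : measurable_fun [set: R] f ->
    \int[mu]_(x in [set x : R | (0 <= x)%R]) (f x)%:E = \int[mu]_(x in `]0%R, +oo[) (f x)%:E.
  move=> mf; rewrite integral_itv_obnd_cbnd; last exact/measurable_funTS/measurable_EFinP.
  by congr (integral _ _ _); apply/seteqP; split => y /=; rewrite in_itv/= andbT.
rewrite !open0//; last by apply: measurable_funM => //; exact: measurable_funX.
have mt : measurable_fun [set: R] (fun t : R => t * expR (- t ^+ 2 / 2))%R.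
  by apply: continuous_measurable_fun; exact: continuous_xgauss.
have H := @integral_wedge_swap R (fun t => t * expR (- t ^+ 2 / 2))%R (fun=> 1%R).
have me : measurable_fun [set: R] (fun t : R => expR (- t ^+ 2 / 2))%R.
  apply: measurableT_comp => //; apply: measurable_funM => //.
  by apply: measurableT_comp => //; exact: measurable_funX.
transitivity ((Num.sqrt (2 * pi))^-1%:E * \int[mu]_(t in `]0%R, +oo[) (t * (t * expR (- t ^+ 2 / 2)))%:E).
  rewrite -ge0_integralZl_EFin//.
  - by apply: eq_integral => t _; rewrite -EFinM phiE; congr EFin; ring.
  - move=> x; rewrite /= in_itv /= andbT => x0.
    by rewrite lee_fin !mulr_ge0 ?expR_ge0// ltW.
  - by apply/measurable_EFinP/measurable_funTS; apply: measurable_funM.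
transitivity ((Num.sqrt (2 * pi))^-1%:E * \int[mu]_(t in `]0%R, +oo[) (expR (- t ^+ 2 / 2))%:E); last first.
  rewrite -ge0_integralZl_EFin//.
  - by apply: eq_integral => t _; rewrite -EFinM phiE.
  - by apply/measurable_EFinP/measurable_funTS.
congr (_ * _).
transitivity (\int[mu]_(u in `]0%R, +oo[) (1 * \int[mu]_(t in `]u, +oo[) (t * expR (- t ^+ 2 / 2))%:E)); last first.
  apply: eq_integral => t; rewrite inE /= in_itv /= andbT => t0.
  by rewrite mul1e integral_gauss_tail ?ltW.
rewrite -H//; last by move=> x x0; rewrite mulr_ge0 ?expR_ge0 // ltW.
apply: eq_integral => t; rewrite inE /= in_itv /= andbT => t0.
by rewrite integral_cst//= lebesgue_measure_itv /= lte_fin t0 mul1e oppr0 adde0 -!EFinM mulrC.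
Qed.

(** The cross term is cancelled by adding the integral to its image under [x -> -x], so that only
    nonnegative integrands occur. *)
Lemma gauss_quad (a b : R) : \int[mu]_x (phi x * (a + b * x) ^+ 2)%:E = (a ^+ 2 + b ^+ 2)%:E.
Proof.
have mp : measurable_fun [set: R] (phi : R -> R) by exact: measurable_normal_pdf.
have mq (c : R) : measurable_fun [set: R] (fun x => phi x * (a + c * x) ^+ 2)%R.
  apply: measurable_funM => //; apply: measurable_funX => //.
  by apply: measurable_funD => //; exact: measurable_funM.
have mqE (c : R) : measurable_fun [set: R] (fun x => (phi x * (a + c * x) ^+ 2)%:E).
  exact/measurable_EFinP.
have q0 (c x : R) : (0 <= phi x * (a + c * x) ^+ 2)%R by rewrite mulr_ge0 ?phi_ge0 ?sqr_ge0.
set X := \int[mu]_x _.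
have XN : X = \int[mu]_x (phi x * (a + - b * x) ^+ 2)%:E.
  have := @integral_affine R (-1)%R 0%R (fun x => (phi x * (a + b * x) ^+ 2)%:E).
  rewrite normrN1 invr1 mul1e /X => <-//.
  - by apply: eq_integral => x _; rewrite addr0 mulN1r phiN mulrN mulNr.
  - by move=> x; rewrite lee_fin q0.
have : X + X = (2 * (a ^+ 2 + b ^+ 2))%:E.
  rewrite {2}XN /X -ge0_integralD//; first last.
  - exact: mqE.
  - by move=> x _; rewrite lee_fin q0.
  - exact: mqE.
  - by move=> x _; rewrite lee_fin q0.
  transitivity (\int[mu]_x ((2 * a ^+ 2)%:E * (phi x)%:E + (2 * b ^+ 2)%:E * (x ^+ 2 * phi x)%:E)).
    by apply: eq_integral => x _; rewrite -!EFinM -!EFinD; congr EFin; ring.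
  have a0 : (0 <= 2 * a ^+ 2)%R by rewrite mulr_ge0 ?sqr_ge0.
  have b0 : (0 <= 2 * b ^+ 2)%R by rewrite mulr_ge0 ?sqr_ge0.
  have mx : measurable_fun [set: R] (fun x => (x ^+ 2 * phi x)%:E).
    by apply/measurable_EFinP; apply: measurable_funM => //; exact: measurable_funX.
  have x0 (x : R) : 0 <= (x ^+ 2 * phi x)%:E by rewrite lee_fin mulr_ge0 ?sqr_ge0 ?phi_ge0.
  rewrite ge0_integralD//; first last.
  - exact: measurable_funeM.
  - by move=> x _; apply: mule_ge0.
  - by apply: measurable_funeM; exact/measurable_EFinP.
  - by move=> x _; apply: mule_ge0 => //; rewrite lee_fin phi_ge0.
  rewrite !ge0_integralZl_EFin//; try exact/measurable_EFinP; try by move=> x _; rewrite lee_fin phi_ge0.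
  by rewrite integral_normal_pdf phi_second_moment !mule1 -EFinD mulrDr.
case: X {XN} => [r| |]//=; rewrite -EFinD => -[] h.
by congr EFin; lra.
Qed.

Lemma phi_convolution (k : nat) (y : R) :
  \int[mu]_x (phi (x - y) * normal_pdf 0 (Num.sqrt k.+1%:R) x)%:E =
  (normal_pdf 0 (Num.sqrt k.+2%:R) y)%:E.
Proof.
have K0 : (0 < k.+1%:R :> R)%R by rewrite ltr0n.
have K1 : (0 < k.+2%:R :> R)%R by rewrite ltr0n.
have KE : (k.+2%:R = k.+1%:R + 1 :> R)%R by rewrite -natr1.
pose K : R := k.+1%:R.
(* Mean and standard deviation of the Gaussian in [x] obtained by completing the square. *)
pose m : R := (K * y / (K + 1))%R; pose s : R := Num.sqrt (K / (K + 1))%R.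
have s0 : (0 < s)%R by rewrite sqrtr_gt0 divr_gt0// -KE.
transitivity (\int[mu]_x ((normal_pdf 0 (Num.sqrt k.+2%:R) y)%:E * (normal_pdf m s x)%:E)); last first.
  rewrite ge0_integralZl_EFin ?integral_normal_pdf ?mule1//.
  - by move=> x _; rewrite lee_fin normal_pdf_ge0.
  - by apply/measurable_EFinP; exact: measurable_normal_pdf.
  - by rewrite normal_pdf_ge0.
apply: eq_integral => x _; rewrite -EFinM; congr EFin.
have -> : normal_pdf m s x = normal_pdf 0 s (x - m).
  by rewrite !normal_pdfE ?gt_eqF// /normal_fun subr0.
have S0 : (0 < Num.sqrt k.+1%:R :> R)%R by rewrite sqrtr_gt0.
have S1 : (0 < Num.sqrt k.+2%:R :> R)%R by rewrite sqrtr_gt0.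
rewrite phiE (normal_pdf0E _ S0) (normal_pdf0E _ S1) (normal_pdf0E _ s0).
have -> : (s ^+ 2 = K / (K + 1))%R by rewrite /s sqr_sqrtr// divr_ge0// -?KE// ltW.
rewrite !sqr_sqrtr ?(ltW K0) ?(ltW K1)//.
have P0 : (0 < Num.sqrt (2 * pi) :> R)%R by rewrite sqrtr_gt0 mulr_gt0 ?pi_gt0.
rewrite mulrACA [RHS]mulrACA -!expRD; congr (_ * expR _)%R.
  rewrite -!invfM; congr (_^-1)%R.
  have -> : (Num.sqrt k.+1%:R = Num.sqrt k.+2%:R * s)%R.
    rewrite /s -sqrtrM ?ltW//; congr Num.sqrt; rewrite -KE -/K; field.
    by rewrite gt_eqF.
  ring.
rewrite /m -/K KE -/K; field.
by apply/andP; split; rewrite gt_eqF//; have := ler0n R k; lra.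
Qed.

Lemma integral_gauss_scaled (c : R) : (0 < c)%R ->
  \int[mu]_x (expR (- (c * x ^+ 2)))%:E = (Num.sqrt pi / Num.sqrt c)%:E.
Proof.
move=> c0; pose s : R := Num.sqrt (2 * c)^-1.
have s0 : (0 < s)%R by rewrite sqrtr_gt0 invr_gt0 mulr_gt0.
have P0 : (0 < Num.sqrt (2 * pi) :> R)%R by rewrite sqrtr_gt0 mulr_gt0 ?pi_gt0.
have k0 : (0 <= Num.sqrt (2 * pi) * s)%R by rewrite mulr_ge0 // ltW.
transitivity (\int[mu]_x ((Num.sqrt (2 * pi) * s)%:E * (normal_pdf 0 s x)%:E)).
  apply: eq_integral => x _; rewrite -EFinM; congr EFin; rewrite normal_pdf0E//.
  rewrite [RHS]mulrA divff ?mul1r ?gt_eqF ?mulr_gt0//; congr expR.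
  rewrite sqr_sqrtr ?invr_ge0 ?mulr_ge0 ?ltW//; field.
  by rewrite gt_eqF.
rewrite ge0_integralZl_EFin//; first last.
- by apply/measurable_EFinP; exact: measurable_normal_pdf.
- by move=> x _; rewrite lee_fin normal_pdf_ge0.
rewrite integral_normal_pdf mule1; congr EFin.
rewrite -sqrtrM ?mulr_ge0 ?pi_ge0//.
apply: (mulIf (x := Num.sqrt c)); first by rewrite gt_eqF// sqrtr_gt0.
rewrite -sqrtrM ?mulfVK ?gt_eqF ?sqrtr_gt0//; last by rewrite mulr_ge0 ?mulr_ge0 ?pi_ge0// invr_ge0 mulr_ge0// ltW.
by congr Num.sqrt; field; rewrite gt_eqF.
Qed.

End gauss1.

(** * Iterated Gaussian integrals *)

Section gint_theory.
Context {R : realType}.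
Local Open Scope ereal_scope.
Local Notation mu := (@lebesgue_measure R).

Definition gw (I : eqType) (s : seq I) (w : I -> R) : \bar R := (\prod_(i <- s) phi (w i))%:E.

Lemma gw_ge0 (I : eqType) (s : seq I) (w : I -> R) : 0 <= gw s w.
Proof. by rewrite lee_fin prodr_ge0// => i _; exact: phi_ge0. Qed.

Lemma measurable_gw (I : eqType) (s : seq I) d (X : measurableType d) (f : X -> vec R I) :
  measurable_fun [set: X] f -> measurable_fun [set: X] (fun x => gw s (f x)).
Proof.
move=> mf; apply/measurable_EFinP; apply: measurable_prodr => i _.
by apply: measurable_phi; exact: measurable_coord_comp.
Qed.

Lemma measurable_gw0 (I : eqType) (s : seq I) : measurable_fun [set: vec R I] (gw s).
Proof. exact: (measurable_gw s (f := @id (vec R I))). Qed.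

Lemma gint_lint (I : eqType) (s : seq I) (F : (I -> R) -> \bar R) : uniq s ->
  (forall w, 0 <= F w) -> measurable_fun [set: vec R I] F ->
  gint s F = lint s (fun w => gw s w * F w).
Proof.
elim: s F => [|i s IH] F.
  by move=> _ _ _; rewrite /= /gw big_nil mul1e.
move=> /= /andP[is_ us] F0 mF; apply: eq_integral => x _.
rewrite IH//; last exact: measurable_updx.
rewrite -lint_Zl//.
- apply: eq_lint => w; rewrite /gw big_cons updE EFinM muleA; congr (_ * _ * _).
  congr EFin; apply: eq_big_seq => j js; rewrite upd_neq//.
  by apply: contraNneq is_ => <-.
- by rewrite lee_fin phi_ge0.
- by move=> w; apply: mule_ge0 => //; exact: gw_ge0.
- by apply: emeasurable_funM; [exact: measurable_gw0|exact: measurable_updx].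
Qed.

Lemma gint_ge0 (I : eqType) (s : seq I) (F : (I -> R) -> \bar R) :
  (forall w, 0 <= F w) -> 0 <= gint s F.
Proof.
elim: s F => [|i s IH] F F0 //=.
by apply: integral_ge0 => x _; apply: mule_ge0; [rewrite lee_fin phi_ge0|exact: IH].
Qed.

Lemma eq_gint (I : eqType) (s : seq I) (F G : (I -> R) -> \bar R) :
  F =1 G -> gint s F = gint s G.
Proof. by move=> /funext ->. Qed.

Lemma eq_gint_supp (I : eqType) (s : seq I) (F G : (I -> R) -> \bar R) :
  (forall w, (forall i, i \notin s -> w i = 0%R) -> F w = G w) -> gint s F = gint s G.
Proof.
elim: s F G => [|i s IH] F G FG /=; first exact: FG.
apply: eq_integral => x _; congr (_ * _); apply: IH => w w0; apply: FG => j.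
rewrite inE negb_or => /andP[ji js]; rewrite upd_neq//; exact: w0.
Qed.

Lemma le_gint (I : eqType) (s : seq I) (F G : (I -> R) -> \bar R) :
  (forall w, 0 <= F w) -> (forall w, F w <= G w) -> gint s F <= gint s G.
Proof.
elim: s F G => [|i s IH] F G F0 FG //=.
apply: le_integral0 => x.
  by apply: mule_ge0; [rewrite lee_fin phi_ge0|exact: gint_ge0].
by apply: lee_pmul => //; [rewrite lee_fin phi_ge0|exact: gint_ge0|exact: IH].
Qed.

Lemma gint_cst (I : eqType) (s : seq I) (c : \bar R) : 0 <= c -> gint s (fun=> c) = c.
Proof.
move=> c0; elim: s => [//|i s IH] /=; rewrite IH.
under eq_integral do rewrite muleC.
rewrite ge0_integralZl//.
- by rewrite integral_normal_pdf mule1.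
- by apply/measurable_EFinP; exact: measurable_normal_pdf.
- by move=> x _; rewrite lee_fin normal_pdf_ge0.
Qed.

Lemma gint_Zl (I : eqType) (s : seq I) (c : \bar R) (F : (I -> R) -> \bar R) : uniq s ->
  0 <= c -> (forall w, 0 <= F w) -> measurable_fun [set: vec R I] F ->
  gint s (fun w => c * F w) = c * gint s F.
Proof.
move=> us c0 F0 mF; rewrite !gint_lint//.
- rewrite -lint_Zl//.
  + by apply: eq_lint => w; rewrite muleCA.
  + by move=> w; rewrite mule_ge0// gw_ge0.
  + by apply: emeasurable_funM => //; exact: measurable_gw0.
- by move=> w; rewrite mule_ge0.
- exact: measurable_funeM.
Qed.

Lemma gint_sum (I : eqType) (s : seq I) (K : Type) (r : seq K) (P : pred K)
    (F : K -> (I -> R) -> \bar R) : uniq s ->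
  (forall k w, 0 <= F k w) -> (forall k, measurable_fun [set: vec R I] (F k)) ->
  gint s (fun w => \sum_(k <- r | P k) F k w) = \sum_(k <- r | P k) gint s (F k).
Proof.
move=> us F0 mF; rewrite gint_lint//.
- rewrite (eq_bigr (fun k => lint s (fun w => gw s w * F k w))); last first.
    by move=> k _; rewrite gint_lint.
  rewrite -lint_sum//.
  + apply: eq_lint => w; rewrite ge0_sume_distrr//.
  + by move=> k w; rewrite mule_ge0// gw_ge0.
  + by move=> k; apply: emeasurable_funM => //; exact: measurable_gw0.
- by move=> w; apply: sume_ge0.
- rewrite (_ : (fun w : I -> R => _) = (fun w : vec R I => \sum_(j <- r) (if P j then F j w else 0))).
    by apply: emeasurable_sum => j; case: (P j).
  by apply/funext => w; rewrite big_mkcond.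
Qed.

Lemma gint_map (I J : eqType) (f : J -> I) (s : seq J) (G : (J -> R) -> \bar R) :
  injective f -> gint (map f s) (fun w => G (w \o f)) = gint s G.
Proof.
move=> injf; elim: s G => [|j s IH] G /=; first by [].
apply: eq_integral => x _; congr (_ * _); rewrite -[RHS]IH; apply: eq_gint => w; congr G.
by apply/funext => k; rewrite /upd /= inj_eq.
Qed.

Lemma measurable_mrg (I : eqType) (s : seq I) d (X : measurableType d) (f g : X -> vec R I) :
  measurable_fun [set: X] f -> measurable_fun [set: X] g ->
  measurable_fun [set: X] (fun x => mrg s (f x) (g x) : vec R I).
Proof.
move=> mf mg; apply: measurable_vec => i; rewrite /mrg.
by case: (i \in s); exact: measurable_coord_comp.
Qed.

Lemma gint_cat (I : eqType) (s t : seq I) (F : (I -> R) -> \bar R) : 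
  gint (s ++ t) F = gint s (fun w => gint t (fun v => F (mrg s w v))).
Proof.
elim: s F => [|i s IH] F /=; first by [].
apply: eq_integral => x _; congr (_ * _); rewrite IH; apply: eq_gint => w; apply: eq_gint => v.
congr F; apply/funext => j; rewrite /mrg /upd inE.
by case: eqP.
Qed.

Lemma gint_perm (I : eqType) (s t : seq I) (F : (I -> R) -> \bar R) :
  uniq s -> perm_eq s t ->
  (forall w, 0 <= F w) -> measurable_fun [set: vec R I] F -> gint s F = gint t F.
Proof.
move=> us st F0 mF; have ut : uniq t by rewrite -(perm_uniq st).
rewrite !gint_lint// (lint_perm us st).
- by apply: eq_lint => w; rewrite /gw (perm_big _ st).
- by move=> w; rewrite mule_ge0// gw_ge0.
- by apply: emeasurable_funM => //; exact: measurable_gw0.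
Qed.

Lemma measurable_gint (I : eqType) (s : seq I) d (X : measurableType d)
    (F : X -> (I -> R) -> \bar R) :
  (forall x w, 0 <= F x w) ->
  measurable_fun [set: X * vec R I] (fun z => F z.1 z.2) ->
  measurable_fun [set: X] (fun x => gint s (F x)).
Proof.
elim: s d X F => [|i s IH] d X F F0 mF /=.
  apply: (measurable_precomp (f := fun x : X => (x, (fun=> 0%R) : vec R I)) mF).
  exact: measurable_fun_pair.
apply: (measurable_integral (F := fun x y => (phi y)%:E * gint s (fun w => F x (upd w i y)))).
  by move=> x y; apply: mule_ge0; [rewrite lee_fin phi_ge0|apply: gint_ge0].
apply: emeasurable_funM; first by apply/measurable_EFinP; exact: measurable_phi.
apply: (IH _ (X * R)%type (fun z w => F z.1 (upd w i z.2))) => //.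
apply: (measurable_precomp
  (f := fun z : (X * R) * vec R I => (z.1.1, upd z.2 i z.1.2 : vec R I)) mF).
apply: measurable_fun_pair => /=.
  exact: (measurableT_comp measurable_fst measurable_fst).
apply: measurable_upd => //.
exact: (measurableT_comp measurable_snd measurable_fst).
Qed.

(** The inner integral no longer depends on the coordinates in [t], so the outer integral over them
    contributes mass one. *)
Lemma gint_tower (I : eqType) (s t : seq I) (F : (I -> R) -> \bar R) :
  uniq s -> uniq t -> {subset t <= s} ->
  (forall w, 0 <= F w) -> measurable_fun [set: vec R I] F ->
  gint s F = gint s (fun w => gint t (fun v => F (mrg t v w))).
Proof.
move=> us ut ts F0 mF.
pose u := [seq i <- s | i \notin t].
have st : perm_eq s (u ++ t).
  apply: uniq_perm => //.
    rewrite cat_uniq filter_uniq//= ut andbT; apply/hasPn => i it.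
    by rewrite /= mem_filter it.
  move=> i; rewrite mem_cat mem_filter; case: (boolP (i \in t)) => [/ts ->|_] //=.
  by rewrite orbF.
have mT : measurable_fun [set: vec R I] (fun w : vec R I => gint t (fun v => F (mrg t v w))).
  apply: (measurable_gint (X := vec R I) _ (F := fun w v => F (mrg t v w))) => //.
  apply: (measurable_precomp (f := fun z : vec R I * vec R I => mrg t z.2 z.1 : vec R I) mF).
  exact: measurable_mrg.
rewrite (gint_perm us st)// (gint_perm us st)//; last by move=> w; exact: gint_ge0.
rewrite !gint_cat; apply: eq_gint => w.
rewrite -[LHS](gint_cst t (c := gint t (fun v => F (mrg u w v)))); last exact: gint_ge0.
apply: eq_gint_supp => v v0; apply: eq_gint_supp => x x0; congr F.
apply/funext => i; rewrite /mrg.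
have iu : (i \in u) = (i \in s) && (i \notin t) by rewrite mem_filter andbC.
case: (boolP (i \in t)) => it; first by rewrite iu it andbF.
by rewrite iu it andbT; case: ifPn => // _; rewrite v0// x0.
Qed.

End gint_theory.

(** * The slope integral and its value *)

Section gamma_constant.
Context {R : realType}.
Local Open Scope ereal_scope.
Local Notation mu := (@lebesgue_measure R).

Lemma lint_prod (I : eqType) (s : seq I) (f : I -> R -> R) : uniq s ->
  (forall i x, 0 <= f i x)%R -> (forall i, measurable_fun [set: R] (f i)) ->
  lint s (fun w => (\prod_(i <- s) f i (w i))%:E) = \prod_(i <- s) \int[mu]_x (f i x)%:E.
Proof.
move=> + f0 mf; have mfE i : measurable_fun [set: R] (fun x => (f i x)%:E) by exact/measurable_EFinP.
elim: s => [|i s IH].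
  by move=> _; rewrite /= !big_nil.
move=> /= /andP[is_ us]; rewrite big_cons -IH//.
have m1 : measurable_fun [set: vec R I] (fun w : vec R I => (\prod_(i <- s) f i (w i))%:E).
  apply/measurable_EFinP; apply: measurable_prodr => j _.
  by apply: (measurable_precomp (mf j)); exact: measurable_coord.
have p0 (w : I -> R) : 0 <= (\prod_(i <- s) f i (w i))%:E.
  by rewrite lee_fin prodr_ge0.
rewrite muleC -ge0_integralZl//; first last.
- exact: lint_ge0.
- by move=> x _; rewrite lee_fin.
- exact: mfE.
apply: eq_integral => x _; rewrite muleC -lint_Zl//; last by rewrite lee_fin.
apply: eq_lint => w; rewrite big_cons updE EFinM; congr (_ * _%:E).
apply: eq_big_seq => j js; rewrite upd_neq//.
by apply: contraNneq is_ => <-.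
Qed.

(** The length of [(1, -b)], a normal vector to the graph of an affine function of slope [b]. *)
Definition sigma (I : finType) (b : I -> R) : R := Num.sqrt (1 + \sum_i b i ^+ 2)%R.

Lemma sigma_gt0 (I : finType) (b : I -> R) : (0 < sigma b)%R.
Proof. by rewrite sqrtr_gt0 ltr_pwDl// sumr_ge0// => i _; rewrite sqr_ge0. Qed.

Lemma sigma2 (I : finType) (b : I -> R) : (sigma b ^+ 2 = 1 + \sum_i b i ^+ 2)%R.
Proof. by rewrite sqr_sqrtr// addr_ge0// sumr_ge0// => i _; rewrite sqr_ge0. Qed.

Lemma measurable_sqrt d (X : measurableType d) (f : X -> R) :
  measurable_fun [set: X] f -> measurable_fun [set: X] (fun x => Num.sqrt (f x)).
Proof.
move=> mf; apply: (measurable_precomp (g := @Num.sqrt R)) => //.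
by apply: continuous_measurable_fun; exact: sqrt_continuous.
Qed.

Lemma measurable_sigma (I : finType) d (X : measurableType d) (f : X -> vec R I) :
  measurable_fun [set: X] f -> measurable_fun [set: X] (fun x => sigma (f x)).
Proof.
move=> mf; apply: measurable_sqrt.
apply: measurable_funD => //; apply: measurable_sumr => i _; apply: measurable_funX.
exact: measurable_coord_comp.
Qed.

Lemma measurable_sigmaVX (I : finType) (k : nat) :
  measurable_fun [set: vec R I] (fun b : vec R I => (sigma b ^- k)%R).
Proof.
rewrite (_ : (fun _ => _) = (fun b => sigma b `^ (- k%:R))%R).
  apply: (measurable_precomp (g := @powR R ^~ (- k%:R)%R)); first exact: measurable_powR.
  exact: (measurable_sigma (f := @id (vec R I))).
by apply/funext => b; rewrite powR_invn// ltW// sigma_gt0.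
Qed.

(** Up to scaling and normalization the integrand is a multivariate Student density with two degrees
    of freedom. *)
Definition cauchy_integral (d : nat) : \bar R :=
  lint (enum 'I_d) (fun b => (sigma b ^- d.+2)%:E).

Lemma eGamma_ge0 (x : R) : 0 <= eGamma x.
Proof. by apply: integral_ge0 => t _; rewrite lee_fin mulr_ge0 ?powR_ge0 ?expR_ge0. Qed.

Lemma powR_half (t : R) (d : nat) : (0 <= t)%R -> (t `^ (d%:R / 2) = Num.sqrt t ^+ d)%R.
Proof. by move=> t0; rewrite mulrC powRrM powR12_sqrt// powR_mulrn// sqrtr_ge0. Qed.

(** [Gamma(d/2 + 1) * sigma^-(d+2)] is the integral over [t > 0] of [t^(d/2) * exp(-t * sigma^2)],
    by scaling [t]. With [b] integrated first, the Gaussian integrals give [(pi/t)^(d/2)] and only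
    [exp(-t)] remains. *)
Lemma cauchy_integralE (d : nat) :
  cauchy_integral d * eGamma (d%:R / 2 + 1) = (Num.sqrt pi ^+ d)%:E.
Proof.
have pp : (0 < pi :> R)%R by exact: pi_gt0.
pose g (t : R) (b : 'I_d -> R) : \bar R :=
  ((0 < t)%R%:R * (Num.sqrt t ^+ d * expR (- (t * sigma b ^+ 2))))%:E.
have g0 t b : 0 <= g t b.
  by rewrite lee_fin !mulr_ge0 ?exprn_ge0 ?sqrtr_ge0 ?expR_ge0.
have mg : measurable_fun [set: R * vec R 'I_d] (fun z => g z.1 z.2).
  apply/measurable_EFinP; apply: measurable_funM.
    by apply: measurable_boolR; exact: measurable_fun_ltr.
  apply: measurable_funM.
    by apply: measurable_funX; exact: measurable_sqrt.
  apply: (measurable_precomp (g := @expR R)) => //.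
  apply: (measurable_precomp (g := @GRing.opp R)) => //; apply: measurable_funM => //.
  by apply: measurable_funX; exact: measurable_sigma.
have ms : measurable_fun [set: vec R 'I_d] (fun b : vec R 'I_d => (sigma b ^- d.+2)%:E).
  by apply/measurable_EFinP; exact: measurable_sigmaVX.
rewrite muleC /cauchy_integral -lint_Zl//; first last.
- by move=> b; rewrite lee_fin invr_ge0 exprn_ge0// ltW// sigma_gt0.
- exact: eGamma_ge0.
have ipos (x : R) : `]0%R, +oo[%classic x <-> (0 < x)%R by rewrite /= in_itv /= andbT.
transitivity (lint (enum 'I_d) (fun b => \int[mu]_t g t b)).
  apply: eq_lint => b; have s0 := sigma_gt0 b.
  rewrite /eGamma (integral_indicE _ ipos) addrK.
  pose F (t : R) : \bar R := ((0 < t)%R%:R * (t `^ (d%:R / 2) * expR (- t)))%:E.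
  transitivity (\int[mu]_t F t * (sigma b ^- d.+2)%:E); first by congr (_ * _); apply: eq_integral => t _; rewrite -EFinM.
  have F0 t : 0 <= F t by rewrite lee_fin !mulr_ge0 ?powR_ge0 ?expR_ge0.
  have mF : measurable_fun [set: R] F.
    apply/measurable_EFinP; apply: measurable_funM.
      by apply: measurable_boolR; exact: measurable_fun_ltr.
    apply: measurable_funM; first exact: measurable_powR.
    by apply: (measurable_precomp (g := @expR R)).
  have s20 : (sigma b ^+ 2 != 0)%R by rewrite expf_neq0// gt_eqF.
  have := integral_affine 0 s20 F0 mF.
  rewrite ger0_norm ?sqr_ge0// => h.
  have -> : (sigma b ^- d.+2)%:E = (sigma b ^- d)%:E * (sigma b ^- 2)%:E.
    by rewrite -EFinM -invfM -exprD addn2.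
  rewrite muleC -muleA -h -ge0_integralZl_EFin//; first last.
  - by rewrite invr_ge0 exprn_ge0// ltW.
  - apply: (measurable_precomp mF); exact: measurable_affine.
  apply: eq_integral => t _; rewrite addr0 /F /g -EFinM; congr EFin.
  rewrite pmulr_rgt0 ?exprn_gt0//; case: (ltP 0%R t) => t0; last by rewrite !mul0r mulr0.
  rewrite !mul1r powR_half ?mulr_ge0 ?sqr_ge0 ?ltW// sqrtrM ?sqr_ge0// sqrtr_sqr gtr0_norm//.
  rewrite exprMn mulrA mulrA mulVf ?mul1r ?expf_neq0 ?gt_eqF//.
  by rewrite [(t * _)%R]mulrC.
rewrite -lint_integral//.
transitivity (\int[mu]_t ((Num.sqrt pi ^+ d)%:E * ((0 < t)%R%:R%:E * (expR (- t))%:E))); last first.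
  rewrite ge0_integralZl_EFin ?exprn_ge0//.
  - by rewrite -(integral_indicE _ ipos) integral_expR_tail oppr0 expR0 mule1.
  - apply: emeasurable_funM; first by apply: measurable_boolE; exact: measurable_fun_ltr.
    by apply/measurable_EFinP; apply: (measurable_precomp (g := @expR R)).
apply: eq_integral => t _.
rewrite /g; case: (ltP 0%R t) => t0 /=; last first.
  rewrite mul0e mule0 -[RHS](lint0 (enum 'I_d)); apply: eq_lint => b; by rewrite mul0r.
transitivity ((Num.sqrt t ^+ d * expR (- t))%:E * lint (enum 'I_d) (fun b => (\prod_(i <- enum 'I_d) expR (- (t * b i ^+ 2)))%:E)).
  rewrite -lint_Zl//.
  - apply: eq_lint => b; rewrite mul1r -EFinM -mulrA; congr (_ * _)%:E.
    rewrite sigma2 mulrDr mulr1 opprD expRD; congr (_ * _)%R.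
    rewrite mulr_sumr -sumrN expR_sum big_enum //=.
  - by move=> w; rewrite lee_fin prodr_ge0// => i _; exact: expR_ge0.
  - apply/measurable_EFinP; apply: measurable_prodr => i _.
    apply: (measurable_precomp (g := @expR R)) => //.
    apply: (measurable_precomp (g := @GRing.opp R)) => //; apply: measurable_funM => //.
    by apply: measurable_funX; exact: measurable_coord.
rewrite (lint_prod (f := fun _ x => expR (- (t * x ^+ 2)))) ?enum_uniq//; last first.
  move=> i; apply: (measurable_precomp (g := @expR R)) => //.
  by apply: (measurable_precomp (g := @GRing.opp R)) => //; apply: measurable_funM.
rewrite big_const_seq count_predT size_enum_ord integral_gauss_scaled//.
have -> k : iter k (mule (Num.sqrt pi / Num.sqrt t)%:E) 1 = ((Num.sqrt pi / Num.sqrt t) ^+ k)%:E.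
  by elim: k => [//|k IH]; rewrite iterS IH -EFinM exprS.
rewrite mul1e -!EFinM; congr EFin.
rewrite mulrAC -exprMn; congr (_ ^+ _ * _)%R.
by rewrite mulrCA divff ?mulr1// gt_eqF// sqrtr_gt0.
Qed.

(** In [[0, +oo]] a product is positive and finite only if both factors are; this turns identities
    for [eGamma] into statements about the real number [Gamma]. *)
Lemma mule_fin_pos (x y : \bar R) (r : R) : 0 <= x -> 0 <= y -> (0 < r)%R ->
  x * y = r%:E -> exists a b : R, [/\ x = a%:E, y = b%:E, (0 < a)%R & (0 < b)%R].
Proof.
case: x => [a| |]//; case: y => [b| |]//=.
- rewrite !lee_fin => a0 b0 r0 [] abr; exists a, b; split => //.
    by rewrite lt_neqAle a0 andbT; apply: contraTneq r0 => e; rewrite -abr -e mul0r ltxx.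
  by rewrite lt_neqAle b0 andbT; apply: contraTneq r0 => e; rewrite -abr -e mulr0 ltxx.
- rewrite lee_fin le_eqVlt => /orP[/eqP <-|a0] _ r0; first by rewrite mul0e => -[] e; rewrite -e ltxx in r0.
  by rewrite gt0_muley.
- rewrite lee_fin => _; rewrite le_eqVlt => /orP[/eqP <-|b0] r0; first by rewrite mule0 => -[] e; rewrite -e ltxx in r0.
  by rewrite gt0_mulye.
Qed.

Lemma cauchy_integral_Gamma (d : nat) : (0 < d)%N -> exists2 c : R,
  cauchy_integral d = c%:E & [/\ (0 < c)%R, (0 < Gamma (d%:R / 2) :> R)%R &
    (c * (d%:R / 2 * Gamma (d%:R / 2)) = Num.sqrt pi ^+ d)%R].
Proof.
move=> d0; have pd : (0 < Num.sqrt pi ^+ d :> R)%R by rewrite exprn_gt0// sqrtr_gt0 pi_gt0.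
have c0 : 0 <= cauchy_integral d.
  by apply: lint_ge0 => b; rewrite lee_fin invr_ge0 exprn_ge0// ltW// sigma_gt0.
have cE := cauchy_integralE d.
have [c [g [cE' gE cp gp]]] := mule_fin_pos c0 (eGamma_ge0 _) pd cE.
exists c => //; rewrite gE in cE.
have d20 : (0 < d%:R / 2 :> R)%R by rewrite divr_gt0// ltr0n.
(* [Gamma(d/2 + 1) = (d/2) * Gamma(d/2)], so finiteness and positivity pass down to [d/2]. *)
have := eGammaD1 d20; rewrite {1}gE => /esym dE.
have [a [b [_ bE _ bp]]] := mule_fin_pos (ltW d20 : 0 <= (d%:R / 2)%:E) (eGamma_ge0 _) gp dE.
have GE : Gamma (d%:R / 2) = b by rewrite -[RHS]/(fine b%:E) -bE.
rewrite GE; split => //.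
by move: dE cE; rewrite bE -EFinM cE' => -[->]; rewrite -EFinM => -[].
Qed.

End gamma_constant.

(** * Persistence of Gaussian walks *)

Section maximum_decomposition.
Context {R : realType}.
Local Open Scope ereal_scope.
Local Notation mu := (@lebesgue_measure R).

Definition shift_on (I : eqType) (s : seq I) (w : I -> R) (x : R) : I -> R :=
  fun j => if j \in s then (w j + x)%R else w j.

Lemma measurable_shift_on (I : eqType) (s : seq I) d (X : measurableType d)
    (f : X -> vec R I) (g : X -> R) :
  measurable_fun [set: X] f -> measurable_fun [set: X] g ->
  measurable_fun [set: X] (fun x => shift_on s (f x) (g x) : vec R I).
Proof.
move=> mf mg; apply: measurable_vec => i; rewrite /shift_on.
case: (i \in s); last exact: measurable_coord_comp.
by apply: measurable_funD => //; exact: measurable_coord_comp.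
Qed.

(* Translating all coordinates by the value of the coordinate [i]. *)
Lemma lint_pin (I : eqType) (s : seq I) (i : I) (C D : (I -> R) -> \bar R) :
  uniq s -> i \in s ->
  (forall w, 0 <= C w) -> measurable_fun [set: vec R I] C ->
  (forall w, 0 <= D w) -> measurable_fun [set: vec R I] D ->
  (forall w x, C (shift_on s w x) = C w) ->
  lint s (fun w => C w * D w) =
  lint (rem i s) (fun w => C w * \int[mu]_x D (shift_on s w x)).
Proof.
move=> us is_ C0 mC D0 mD Cs.
have CD0 w : 0 <= C w * D w by exact: mule_ge0.
have mCD : measurable_fun [set: vec R I] (fun w => C w * D w) by exact: emeasurable_funM.
rewrite (lint_perm us (perm_to_rem is_))//.
have msh : measurable_fun [set: R * vec R I] (fun z : R * vec R I => shift_on s z.2 z.1 : vec R I).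
  exact: measurable_shift_on.
transitivity (\int[mu]_x lint (rem i s) (fun w => C w * D (shift_on s w x))).
  apply: eq_integral => x _.
  change (lint (rem i s) (fun w => C (upd w i x) * D (upd w i x)) =
    lint (rem i s) (fun w => C w * D (shift_on s w x))).
  rewrite -(lint_shift (rem i s) (fun=> x) (F := fun w => C (upd w i x) * D (upd w i x)))//; last first.
    exact: (measurable_updx i x mCD).
  apply: eq_lint_supp => w w0.
  have -> : upd (fun j => if j \in rem i s then w j + x else w j)%R i x = shift_on s w x.
    apply/funext => j; rewrite /upd /shift_on mem_rem_uniq// inE.
    case: eqP => [->|_]; last by [].
    by rewrite is_ w0 ?add0r// mem_rem_uniq// inE eqxx.
  by rewrite Cs.
rewrite lint_integral.
- apply: eq_lint => w; rewrite ge0_integralZl//.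
  apply: (measurable_precomp (f := fun x : R => shift_on s w x : vec R I) mD).
  exact: measurable_shift_on.
- by move=> x w; exact: mule_ge0.
- apply: emeasurable_funM; first exact: (measurable_precomp mC).
  exact: (measurable_precomp mD).
Qed.

Definition is_max (I : eqType) (s : seq I) (w : I -> R) (i : I) : bool :=
  all (fun j => w j <= w i)%R s.

Lemma exists_max (I : eqType) (s : seq I) (w : I -> R) : s != [::] ->
  exists2 i, i \in s & is_max s w i.
Proof.
elim: s => [//|i s IH] _; case: (altP (s =P [::])) => [->|/IH[j js mj]].
  by exists i; rewrite /is_max /= ?mem_head ?lexx.
have [ij|ji] := leP (w i) (w j).
  by exists j; rewrite ?in_cons ?js ?orbT//= /is_max /= ij.
exists i; rewrite ?mem_head//= /is_max /= lexx /=.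
by apply/allP => k /(allP mj) kj; apply: le_trans (ltW ji).
Qed.

Lemma sum_is_max (I : eqType) (s : seq I) (w : I -> R) : uniq s -> s != [::] ->
  {in s &, injective w} -> (\sum_(i <- s) (is_max s w i)%:R = 1 :> R)%R.
Proof.
move=> us s0 injw; have [i is_ mi] := exists_max w s0.
rewrite (bigD1_seq i)//= mi big_seq_cond big1 ?addr0// => j /andP[js ji].
case: (boolP (is_max s w j)) => // mj.
suff : i = j by move=> e; rewrite e eqxx in ji.
by apply: injw => //; apply/eqP; rewrite eq_le (allP mj)// (allP mi).
Qed.

Lemma measurable_is_max (I : eqType) (s : seq I) (i : I) :
  measurable_fun [set: vec R I] (fun w : vec R I => is_max s w i).
Proof.
apply: measurable_all => j; apply: measurable_fun_ler; exact: measurable_coord.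
Qed.

(** The function [C] weighted by the sum of the [phi (w i)] over the maximisers [i] is integrated
    over all coordinates in two ways. Pinning [i0] leaves the number of maximisers, almost
    everywhere one; pinning the maximiser itself leaves the paths below it. The density [phi]
    distributes the level of the maximum with total mass one. *)
Lemma lint_max_decomposition (I : eqType) (s : seq I) (i0 : I) (C : (I -> R) -> \bar R) :
  uniq s -> i0 \in s ->
  (forall w, 0 <= C w) -> measurable_fun [set: vec R I] C ->
  (forall w x, C (shift_on s w x) = C w) ->
  lint (rem i0 s) C =
  \sum_(i <- s) lint (rem i s) (fun w => C w * (all (fun j => w j <= 0)%R s)%:R%:E).
Proof.
move=> us i0s C0 mC Cs.
have s0 : s != [::] by case: s i0s {us Cs}.
pose D i (w : I -> R) : \bar R := (phi (w i) * (is_max s w i)%:R)%:E.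
have D0 i w : 0 <= D i w by rewrite lee_fin mulr_ge0 ?phi_ge0.
have mD i : measurable_fun [set: vec R I] (D i).
  apply/measurable_EFinP; apply: measurable_funM.
    by apply: measurable_phi; exact: measurable_coord.
  by apply: measurable_boolR; exact: measurable_is_max.
have ID i w : i \in s -> \int[mu]_x D i (shift_on s w x) = (is_max s w i)%:R%:E.
  move=> is_; transitivity (\int[mu]_x ((is_max s w i)%:R%:E * (phi (x + w i))%:E)).
    apply: eq_integral => x _; rewrite /D -EFinM mulrC {2}/shift_on is_ [(x + _)%R]addrC.
    congr (_%:R * _)%:E; rewrite /is_max; congr (nat_of_bool _).
    by apply: eq_in_all => j js; rewrite /shift_on js is_ lerD2r.
  rewrite ge0_integralZl_EFin//.
  - rewrite (integral_shift (w i) (F := fun x => (phi x)%:E)).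
    + by rewrite integral_normal_pdf mule1.
    + by move=> x; rewrite lee_fin phi_ge0.
    + by apply/measurable_EFinP; exact: measurable_normal_pdf.
  - by move=> x _; rewrite lee_fin phi_ge0.
  - by apply/measurable_EFinP; apply: measurable_phi; exact: measurable_funD.
have mCD i : measurable_fun [set: vec R I] (fun w => C w * D i w) by exact: emeasurable_funM.
have mDD : measurable_fun [set: vec R I] (fun w => \sum_(i <- s) D i w) by exact: emeasurable_sum.
transitivity (lint s (fun w => C w * \sum_(i <- s) D i w)); last first.
  transitivity (lint s (fun w => \sum_(i <- s) (C w * D i w))).
    by apply: eq_lint => w; rewrite ge0_sume_distrr.
  rewrite lint_sum//; last by move=> i w; exact: mule_ge0.
  apply: eq_big_seq => i is_; rewrite (lint_pin us is_ C0 mC (D0 i) (mD i) Cs).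
  apply: eq_lint_supp => w w0; rewrite ID//; congr (_ * (nat_of_bool _)%:R%:E).
  by apply: eq_in_all => j js; rewrite [w i]w0// mem_rem_uniq// inE eqxx.
rewrite (lint_pin us i0s C0 mC _ mDD Cs); last by move=> w; exact: sume_ge0.
(* One index of each pair is taken in [rem i0 s], so that its coordinate is a variable of
   integration. *)
pose tie (w : I -> R) := has (fun i => has (fun j => (i != j) && (w i == w j)) (rem i0 s)) s.
apply/esym; apply: (lint_sandwich (N := tie)) => //.
- by move=> w; rewrite mule_ge0//; apply: integral_ge0 => x _; exact: sume_ge0.
- apply: measurable_boolE.
  rewrite (_ : tie = (fun w : vec R I => ~~ all (fun i => all (fun j => ~~ ((i != j) && (w i == w j))) (rem i0 s)) s)).
    apply: measurable_neg; apply: measurable_all => i; apply: measurable_all => j.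
    apply: measurable_neg; apply: measurable_and => //.
    by apply: measurable_fun_eqr; exact: measurable_coord.
  apply/funext => w; rewrite -has_predC; apply: eq_has => i /=.
  by rewrite -has_predC; apply: eq_has => j /=; rewrite negbK.
- apply/eqP; rewrite eq_le; apply/andP; split; last by apply: lint_ge0 => w; rewrite lee_fin.
  have mt i j : measurable_fun [set: vec R I] (fun w : vec R I => ((i != j) && (w i == w j))%:R%:E : \bar R).
    apply: measurable_boolE; apply: measurable_and => //.
    by apply: measurable_fun_eqr; exact: measurable_coord.
  apply: (@le_trans _ _ (lint (rem i0 s) (fun w => \sum_(i <- s) \sum_(j <- rem i0 s) ((i != j) && (w i == w j))%:R%:E))).
    apply: le_lint => w; first by rewrite lee_fin.
    case: (boolP (tie w)) => [/hasP[i is_ /hasP[j js h]]|_]; last first.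
      by apply: sume_ge0 => i _; apply: sume_ge0 => j _; rewrite lee_fin.
    rewrite (bigD1_seq i)//= (bigD1_seq j) ?rem_uniq//= h -[leLHS]adde0 -addeA leeD//.
    rewrite adde_ge0//; apply: sume_ge0 => k _; first by rewrite lee_fin.
    by apply: sume_ge0 => l _; rewrite lee_fin.
  rewrite lint_sum//; last 2 first.
  - by move=> i w; apply: sume_ge0 => j _; rewrite lee_fin.
  - by move=> i; apply: emeasurable_sum.
  rewrite big1// => i _; rewrite lint_sum//.
  rewrite big_seq big1// => j js.
  have [ij|ij] := eqVneq i j; first by rewrite -[RHS](lint0 (rem i0 s)); apply: eq_lint.
  transitivity (lint (rem i0 s) (fun w => (1 * w j + - w i == 0)%R%:R%:E : \bar R)).
    by apply: eq_lint => w; rewrite mul1r subr_eq0 eq_sym.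
  apply: lint_null_graph => //; first exact: rem_uniq.
    by apply: measurableT_comp => //; exact: measurable_coord.
  by move=> w x; rewrite upd_neq.
- move=> w nt.
  have injw : {in s &, injective w}.
    move=> i j is_ js wij; apply/eqP; apply: contraNT nt => ij.
    have [i0i|ni] := eqVneq i i0; last first.
      apply/hasP; exists j => //; apply/hasP; exists i; last by rewrite eq_sym ij wij eqxx.
      by rewrite mem_rem_uniq// inE ni.
    apply/hasP; exists i => //; apply/hasP; exists j; last by rewrite ij wij eqxx.
    by rewrite mem_rem_uniq// inE js andbT -i0i eq_sym.
  rewrite ge0_integral_sum//; last first.
    move=> i; apply: (measurable_precomp (f := fun x : R => shift_on s w x : vec R I) (mD i)).
    exact: measurable_shift_on.
  rewrite (eq_big_seq (fun i => (is_max s w i)%:R%:E)); last by move=> i is_; exact: ID.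
  by rewrite sumEFin sum_is_max// mule1.
Qed.

End maximum_decomposition.

(** * Gaussian walks with pinned positions *)

Section pinned_walk.
Context {R : realType}.
Local Open Scope ereal_scope.
Local Notation mu := (@lebesgue_measure R).

(* Mass of the Gaussian walk started at [y] whose positions stay in [c], with
   the positions marked [true] pinned to [r] (a density in those positions). *)
Fixpoint walkV (c : R -> bool) (r : R) (b : seq bool) (y : R) : \bar R :=
  match b with
  | [::] => 1
  | p :: b' => if p then (phi (r - y))%:E * walkV c r b' r
               else \int[mu]_x ((phi (x - y) * (c x)%:R)%:E * walkV c r b' x)
  end.

Lemma walkV_ge0 c r b y : 0 <= walkV c r b y.
Proof.
elim: b y => [|[] b IH] y //=; first by rewrite mule_ge0// lee_fin phi_ge0.
by apply: integral_ge0 => x _; rewrite mule_ge0// lee_fin mulr_ge0 ?phi_ge0.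
Qed.

Lemma measurable_walkV b d (Z : measurableType d) (c : Z -> R -> bool) (r y : Z -> R) :
  measurable_fun [set: Z * R] (fun p => c p.1 p.2) ->
  measurable_fun [set: Z] r -> measurable_fun [set: Z] y ->
  measurable_fun [set: Z] (fun z => walkV (c z) (r z) b (y z)).
Proof.
elim: b d Z c r y => [|[] b IH] d Z c r y mc mr my; first exact: measurable_cst.
- apply: emeasurable_funM; last exact: IH.
  by apply/measurable_EFinP; apply: measurable_phi; exact: measurable_funB.
- apply: (measurable_integral (F := fun z x => (phi (x - y z) * (c z x)%:R)%:E * walkV (c z) (r z) b x)).
    by move=> z x; rewrite mule_ge0 ?walkV_ge0// lee_fin mulr_ge0 ?phi_ge0.
  apply: emeasurable_funM.
    apply/measurable_EFinP; apply: measurable_funM; last exact: measurable_boolR.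
    apply: measurable_phi; apply: measurable_funB => //.
    exact: (measurable_precomp my).
  apply: (IH _ (Z * R)%type (fun z => c z.1) (fun z => r z.1) snd) => //.
    apply: (measurable_precomp (f := fun p : (Z * R) * R => (p.1.1, p.2)) mc).
    apply: measurable_fun_pair => //.
    exact: (measurableT_comp measurable_fst measurable_fst).
  exact: (measurable_precomp mr).
Qed.

Lemma measurable_walkV1 (c : R -> bool) r b : measurable_fun [set: R] c ->
  measurable_fun [set: R] (walkV c r b).
Proof.
move=> mc; apply: (measurable_walkV b (Z := R) (c := fun _ => c) (r := fun=> r) (y := id)) => //.
exact: (measurable_precomp mc).
Qed.

Definition wpos (b : seq bool) (r : R) (u : nat -> R) (j : nat) : R :=
  if nth false b j then r else u j.

Definition wprev (b : seq bool) (r y : R) (u : nat -> R) (j : nat) : R :=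
  if j is j'.+1 then wpos b r u j' else y.

Lemma measurable_wpos b r j : measurable_fun [set: vec R nat] (fun u : vec R nat => wpos b r u j).
Proof. by rewrite /wpos; case: nth => //; exact: measurable_coord. Qed.

Lemma measurable_wprev b r y j : measurable_fun [set: vec R nat] (fun u : vec R nat => wprev b r y u j).
Proof. by case: j => [|j] //=; exact: measurable_wpos. Qed.

(** The integrand of which [walkV] is the iterated integral over the free positions. Indices start
    at [0], so [u j] is the position after [j+1] steps. *)
Definition walkW (c : R -> bool) (r : R) (b : seq bool) (y : R) (u : nat -> R) : R :=
  (\prod_(j <- iota 0 (size b)) (phi (wpos b r u j - wprev b r y u j) * (c (wpos b r u j))%:R))%R.

Lemma walkW_ge0 c r b y u : (0 <= walkW c r b y u)%R.
Proof. by rewrite prodr_ge0// => j _; rewrite mulr_ge0 ?phi_ge0. Qed.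

Lemma measurable_walkW (c : R -> bool) r b y : measurable_fun [set: R] c ->
  measurable_fun [set: vec R nat] (fun u : vec R nat => walkW c r b y u).
Proof.
move=> mc; apply: measurable_prodr => j _; apply: measurable_funM.
  apply: measurable_phi; apply: measurable_funB; [exact: measurable_wpos|exact: measurable_wprev].
by apply: measurable_boolR; apply: (measurable_precomp mc); exact: measurable_wpos.
Qed.

Definition unpinned (b : seq bool) := [seq j <- iota 0 (size b) | ~~ nth false b j].

Lemma unpinned_cons p b :
  unpinned (p :: b) = if p then map S (unpinned b) else 0%N :: map S (unpinned b).
Proof.
rewrite /unpinned /= (iotaDl 1 0) filter_map.
by case: p.
Qed.

Lemma walkW_cons (c : R -> bool) r p b y u : c r ->
  walkW c r (p :: b) y u = (phi ((if p then r else u 0%N) - y) * (if p then true else c (u 0%N))%:R *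
    walkW c r b (if p then r else u 0%N) (u \o S))%R.
Proof.
move=> cr; rewrite /walkW /= (iotaDl 1 0) big_cons big_map; congr (_ * _)%R.
  by rewrite /wpos /=; case: p => //=; rewrite cr.
by apply: eq_bigr => -[|j] _; rewrite /wpos /=; case: p.
Qed.

Lemma lint_walkW (c : R -> bool) (r : R) b y : measurable_fun [set: R] c -> c r ->
  lint (unpinned b) (fun u => (walkW c r b y u)%:E) = walkV c r b y.
Proof.
move=> mc cr; elim: b y => [|p b IH] y.
  by rewrite /= /walkW big_nil.
have SI : injective S by move=> i j [].
(* Stated with a test on the sign of [k], so that it can be used for rewriting before [0 <= k] is
   discharged. *)
have main z k : lint [seq i.+1 | i <- unpinned b] (fun w => (k * walkW c r b z (w \o S))%:E) = 
    if (0 <= k)%R then k%:E * walkV c r b z else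
    lint [seq i.+1 | i <- unpinned b] (fun w => (k * walkW c r b z (w \o S))%:E).
  case: ifPn => // k0.
  rewrite (lint_map _ (fun w => (k * walkW c r b z w)%:E))// -IH -lint_Zl//.
  - by move=> w; rewrite lee_fin walkW_ge0.
  - by apply/measurable_EFinP; exact: measurable_walkW.
rewrite unpinned_cons; case: p => /=.
  under eq_lint do rewrite walkW_cons//= mulr1.
  by rewrite main phi_ge0.
apply: eq_integral => x _.
transitivity (lint [seq i.+1 | i <- unpinned b] (fun w => ((phi (x - y) * (c x)%:R) * walkW c r b x (w \o S))%:E)).
  by apply: eq_lint => w; rewrite walkW_cons//= updE.
by rewrite main mulr_ge0 ?phi_ge0.
Qed.

(** Markov property at the first pinned position. *)
Lemma walkV_cat (c : R -> bool) r k t y : measurable_fun [set: R] c ->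
  walkV c r (nseq k false ++ true :: t) y =
  walkV c r (rcons (nseq k false) true) y * walkV c r t r.
Proof.
move=> mc; elim: k y => [|k IH] y /=; first by rewrite mule1.
under eq_integral do rewrite IH muleA muleC.
rewrite ge0_integralZl//.
- by rewrite muleC.
- apply: emeasurable_funM; last exact: measurable_walkV1.
  apply/measurable_EFinP; apply: measurable_funM; last exact: measurable_boolR.
  by apply: measurable_phi; exact: measurable_funB.
- by move=> x _; rewrite mule_ge0 ?walkV_ge0// lee_fin mulr_ge0 ?phi_ge0.
- exact: walkV_ge0.
Qed.

Lemma iotaS0 k : iota 0 k.+1 = 0%N :: map S (iota 0 k).
Proof. by rewrite /= (iotaDl 1 0). Qed.

(** Positions are traded for independent steps, the form in which [pers_p] and [pers_q] are
    defined. *)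
Lemma walkV_gint (c : R -> bool) r k t y : measurable_fun [set: R] c ->
  walkV c r (nseq k false ++ t) y =
  gint (iota 0 k) (fun w => (\prod_(j <- iota 0 k) (c (y + \sum_(i <- iota 0 j.+1) w i))%:R)%:E *
    walkV c r t (y + \sum_(i <- iota 0 k) w i)).
Proof.
move=> mc; elim: k y => [|k IH] y.
  by rewrite /= !big_nil mul1e addr0.
have SI : injective S by move=> i j [].
rewrite [nseq k.+1 false]/= cat_cons [LHS]/=.
rewrite -(integral_shift y (F := fun x => (phi (x - y) * (c x)%:R)%:E * walkV c r (nseq k false ++ t) x)); first last.
- apply: emeasurable_funM; last exact: measurable_walkV1.
  apply/measurable_EFinP; apply: measurable_funM; last exact: measurable_boolR.
  by apply: measurable_phi; exact: measurable_funB.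
- by move=> x; rewrite mule_ge0 ?walkV_ge0// lee_fin mulr_ge0 ?phi_ge0.
rewrite iotaS0 [RHS]/=; apply: eq_integral => x _.
rewrite addrK EFinM -muleA; congr (_ * _).
rewrite IH -gint_Zl//; first last.
- apply: emeasurable_funM.
    apply/measurable_EFinP; apply: measurable_prodr => j _; apply: measurable_boolR.
    apply: (measurable_precomp mc); apply: measurable_funD => //.
    by apply: measurable_sumr => i _; exact: measurable_coord.
  apply: (measurable_precomp (measurable_walkV1 r t mc)); apply: measurable_funD => //.
  by apply: measurable_sumr => i _; exact: measurable_coord.
- by move=> w; rewrite mule_ge0 ?walkV_ge0// lee_fin prodr_ge0.
- exact: iota_uniq.
rewrite -[LHS](gint_map (f := S) (iota 0 k) _ SI); apply: eq_gint => w.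
have sumE j : (y + \sum_(i <- iota 0 j.+1) upd w 0%N x i = x + y + \sum_(i <- iota 0 j) w i.+1)%R.
  rewrite iotaS0 big_cons updE big_map addrA [(y + x)%R]addrC; congr (_ + _)%R.
rewrite muleA -EFinM; congr (_%:E * walkV c r t _).
  under [RHS]eq_bigr => j _ do rewrite -[0%N :: iota 1 j]/(iota 0 j.+1) sumE.
  by rewrite big_cons big_map big_nil addr0.
by rewrite -[0%N :: _]iotaS0 sumE.
Qed.

Definition below (r x : R) : bool := (x <= r)%R.

Lemma measurable_below (r : R) : measurable_fun [set: R] (below r).
Proof. exact: measurable_fun_ler. Qed.

Lemma walkV_translate (a r y : R) b :
  walkV (below (r + a)) (r + a) b (y + a) = walkV (below r) r b y.
Proof.
elim: b y => [//|[] b IH] y /=.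
  by rewrite IH; congr ((phi _)%:E * _); ring.
rewrite -(integral_shift a (F := fun x => (phi (x - (y + a)) * (below (r + a) x)%:R)%:E * walkV (below (r + a)) (r + a) b x)).
- apply: eq_integral => x _; rewrite IH; congr ((phi _ * (nat_of_bool _)%:R)%:E * _); first by ring.
  by rewrite /below lerD2r.
- by move=> x; rewrite mule_ge0 ?walkV_ge0// lee_fin mulr_ge0 ?phi_ge0.
- apply: emeasurable_funM; last by apply: measurable_walkV1; exact: measurable_below.
  apply/measurable_EFinP; apply: measurable_funM.
    by apply: measurable_phi; exact: measurable_funB.
  by apply: measurable_boolR; exact: measurable_below.
Qed.

Lemma walkV_free_total r k y : walkV xpredT r (nseq k false) y = 1.
Proof.
elim: k y => [//|k IH] y /=.
under eq_integral do rewrite IH mule1 mulr1.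
rewrite -(integral_normal_pdf 0 1) (integral_shift (- y)%R (F := fun x => (phi x)%:E))//.
  by move=> x; rewrite lee_fin phi_ge0.
by apply/measurable_EFinP; exact: measurable_normal_pdf.
Qed.

Lemma walkV_free_bridge r k y :
  walkV xpredT r (rcons (nseq k false) true) y = (normal_pdf 0 (Num.sqrt k.+1%:R) (r - y))%:E.
Proof.
elim: k y => [|k IH] y; first by rewrite /= mule1 sqrtr1.
rewrite -phi_convolution /=.
under eq_integral do rewrite IH mulr1.
pose F x := (phi (x - (r - y)) * normal_pdf 0 (Num.sqrt k.+1%:R) x)%:E : \bar R.
(* The reflection [x -> r - x] brings the integral into the form of [phi_convolution]. *)
have h := @integral_affine R (-1)%R r F; rewrite normrN1 invr1 mul1e in h.
transitivity (\int[mu]_x F (-1 * x + r)%R); last apply: h => //.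
- apply: eq_integral => x _; rewrite /F -EFinM; congr EFin; rewrite -phiN.
  by congr (phi _ * normal_pdf _ _ _)%R; ring.
- by move=> x; rewrite lee_fin mulr_ge0 ?normal_pdf_ge0.
- apply/measurable_EFinP; apply: measurable_funM; last exact: measurable_normal_pdf.
  by apply: measurable_phi; exact: measurable_funB.
Qed.

End pinned_walk.

Section persistence.
Context {R : realType}.
Local Open Scope ereal_scope.
Local Notation mu := (@lebesgue_measure R).

(** The expectation is at most one, so [fine] loses nothing. *)
Lemma pers_pE (n : nat) (r : R) :
  (pers_p n r)%:E = walkV (below r) r (nseq n false) 0%R.
Proof.
have mb := measurable_below r.
have E : gauss_exp (fun w : 'I_n -> R =>
    ((\1_[set w' : 'I_n -> R | forall k, psum w' k <= r] w) : R)%:E)%R = walkV (below r) r (nseq n false) 0%R.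
  rewrite -[nseq n false]cats0 walkV_gint// /gauss_exp.
  rewrite -[iota 0 n]val_enum_ord -[LHS](gint_map (f := val) (enum 'I_n) _ val_inj).
  apply: eq_gint => w; rewrite mule1 indicE big_map.
  have psumE (k : 'I_n) : psum (w \o val) k = (0 + \sum_(i <- iota 0 k.+1) w i)%R.
    rewrite add0r /psum -[iota 0 k.+1]/(index_iota 0 k.+1) big_mkord.
    rewrite (big_ord_widen n (fun i => w i)) //.
  case: (boolP (w \o val \in _)) => [/set_mem /= h|/negP h].
    rewrite big1// => k _; have := h k; rewrite psumE /below => ->//.
  case: (boolP [forall k : 'I_n, below r (0 + \sum_(i <- iota 0 k.+1) w i)%R]) => [/forallP hk|].
    exfalso; apply: h; apply/mem_set => /= k; rewrite psumE; exact: hk.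
  rewrite negb_forall => /existsP[k hk]; rewrite (bigD1_seq k) ?enum_uniq ?mem_enum//=.
  by rewrite (negbTE hk) mul0r.
rewrite /pers_p E fineK//; apply/fin_numPlt; rewrite (lt_le_trans _ (walkV_ge0 _ _ _ _)) ?ltNyr//=.
rewrite -E; apply: (@le_lt_trans _ _ (gauss_exp (fun=> 1 : \bar R))).
  by apply: le_gint => w; rewrite lee_fin indicE; case: (_ \in _).
by rewrite /gauss_exp gint_cst// ltry.
Qed.

(** Multiplication by the density of the endpoint removes the conditioning. The integrand is bounded
    by the peak of [phi], so [fine] loses nothing. *)
Lemma pers_qE (n : nat) (r : R) : 
  (pers_q n.+1 r * normal_pdf 0 (Num.sqrt n.+1%:R) r)%:E =
  walkV (below r) r (rcons (nseq n false) true) 0%R.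
Proof.
have mb := measurable_below r.
have E : gauss_exp (fun w : 'I_n -> R =>
    ((\1_[set w' : 'I_n -> R | forall k, psum w' k <= r] w) * normal_pdf 0 1 (r - \sum_i w i))%:E)%R = walkV (below r) r (rcons (nseq n false) true) 0%R.
  rewrite -cats1 walkV_gint// /gauss_exp.
  rewrite -[iota 0 n]val_enum_ord -[LHS](gint_map (f := val) (enum 'I_n) _ val_inj).
  apply: eq_gint => w; rewrite [walkV _ _ [:: true] _]/= mule1 indicE !big_map EFinM.
  congr (_%:E * (phi (r - _))%:E); last by rewrite add0r -enumT big_enum.
  have psumE (k : 'I_n) : psum (w \o val) k = (0 + \sum_(i <- iota 0 k.+1) w i)%R.
    rewrite add0r /psum -[iota 0 k.+1]/(index_iota 0 k.+1) big_mkord.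
    rewrite (big_ord_widen n (fun i => w i)) //.
  case: (boolP (w \o val \in _)) => [/set_mem /= h|/negP h].
    rewrite big1// => k _; have := h k; rewrite psumE /below => ->//.
  case: (boolP [forall k : 'I_n, below r (0 + \sum_(i <- iota 0 k.+1) w i)%R]) => [/forallP hk|].
    exfalso; apply: h; apply/mem_set => /= k; rewrite psumE; exact: hk.
  rewrite negb_forall => /existsP[k hk]; rewrite (bigD1_seq k) -?enumT ?enum_uniq ?mem_enum//=.
  by rewrite (negbTE hk) mul0r.
rewrite /pers_q E divfK; last first.
  rewrite normal_pdf0E ?sqrtr_gt0// mulf_neq0 ?gt_eqF ?expR_gt0//.
  by rewrite invr_gt0 mulr_gt0 ?sqrtr_gt0 ?mulr_gt0 ?pi_gt0.
rewrite fineK//; apply/fin_numPlt; rewrite (lt_le_trans _ (walkV_ge0 _ _ _ _)) ?ltNyr//=.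
rewrite -E; apply: (@le_lt_trans _ _ (gauss_exp (fun=> (normal_peak 1)%:E : \bar R))).
  apply: le_gint => w.
    by rewrite lee_fin mulr_ge0 ?phi_ge0// indicE.
  have : (0 <= phi (r - \sum_i w i) <= normal_peak 1)%R.
    by rewrite phi_ge0 normal_pdf_ub// oner_neq0.
  rewrite lee_fin indicE => /andP[p0 p1].
  by case: (_ \in _); rewrite ?mul1r ?mul0r// normal_peak_ge0.
by rewrite /gauss_exp gint_cst ?ltry// lee_fin normal_peak_ge0.
Qed.

End persistence.

(** * Bridges and the Sparre Andersen formula *)

Section bridge_and_sparre_andersen.
Context {R : realType}.
Local Open Scope ereal_scope.
Local Notation mu := (@lebesgue_measure R).

Definition nonpos (s : seq nat) (w : nat -> R) : bool := all (fun j => w j <= 0)%R s.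

Lemma measurable_nonpos s : measurable_fun [set: vec R nat] (fun w : vec R nat => nonpos s w).
Proof.
by apply: measurable_all => j; apply: measurable_fun_ler => //; exact: measurable_coord.
Qed.

Lemma prod_boolR (K : Type) (s : seq K) (b : K -> bool) :
  (\prod_(j <- s) (b j)%:R = (all b s)%:R :> R)%R.
Proof.
elim: s => [|j s IH]; first by rewrite big_nil.
by rewrite big_cons IH /=; case: (b j); rewrite ?mul1r ?mul0r.
Qed.

Lemma unpinned_free n : unpinned (nseq n false) = iota 0 n.
Proof.
rewrite /unpinned size_nseq; apply/all_filterP/allP => j _.
by rewrite nth_nseq if_same.
Qed.

Lemma unpinned_bridge n : unpinned (rcons (nseq n false) true) = iota 0 n.
Proof.
rewrite /unpinned size_rcons size_nseq -addn1 iotaD filter_cat /= add0n.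
rewrite nth_rcons size_nseq ltnn eqxx /= cats0.
apply/all_filterP/allP => j; rewrite mem_iota /= add0n => jn.
by rewrite nth_rcons size_nseq jn nth_nseq jn.
Qed.

Lemma walkW_free (c : R -> bool) r n y u : walkW c r (nseq n false) y u =
  (\prod_(j <- iota 0 n) phi (u j - (if j is j'.+1 then u j' else y)) * (all (fun j => c (u j)) (iota 0 n))%:R)%R.
Proof.
rewrite /walkW size_nseq -prod_boolR -big_split /=; apply: eq_bigr => -[|j] _;
by rewrite /wpos /= /wpos !nth_nseq !if_same.
Qed.

Lemma perm_rem (T : eqType) (x : T) (s t : seq T) : uniq t -> perm_eq s t ->
  perm_eq (rem x s) (rem x t).
Proof.
move=> ut st; have us : uniq s by rewrite (perm_uniq st).
apply: uniq_perm; rewrite ?rem_uniq// => j.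
by rewrite !mem_rem_uniq// !inE (perm_mem st).
Qed.

Lemma sume_const_seq (T : Type) (s : seq T) (x : \bar R) : 0 <= x ->
  \sum_(i <- s) x = (size s)%:R%:E * x.
Proof.
move=> x0; elim: s => [|i s IH]; first by rewrite big_nil mul0e.
by rewrite big_cons IH /= -natr1 EFinD ge0_muleDl ?lee_fin// mul1e addeC.
Qed.

Section bridge.
Variable k : nat.
Let K := k.+1.
Let s := iota 0 K.

(** Density of a closed walk indexed by the integers modulo [K], invariant under rotation and
    translation; at [w k = 0] it is the density of a bridge of [K] steps from [0] to [0]. *)
Definition cyclicW (w : nat -> R) : \bar R :=
  (\prod_(j <- s) phi (w (j.+1 %% K)%N - w j))%:E.

Lemma cyclicW_ge0 w : 0 <= cyclicW w.
Proof. by rewrite lee_fin prodr_ge0// => j _; exact: phi_ge0. Qed.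

Lemma measurable_cyclicW : measurable_fun [set: vec R nat] cyclicW.
Proof.
apply/measurable_EFinP; apply: measurable_prodr => j _; apply: measurable_phi.
by apply: measurable_funB; exact: measurable_coord.
Qed.

Let us : uniq s. Proof. exact: iota_uniq. Qed.

Let memK j : (j \in s) = (j < K)%N.
Proof. by rewrite mem_iota leq0n add0n. Qed.

Let rot (a j : nat) : nat := if (j < K)%N then ((j + a) %% K)%N else j.

Let rotlt a j : (j < K)%N -> (rot a j < K)%N.
Proof. by rewrite /rot => ->; rewrite ltn_mod. Qed.

Let rot_inj a : injective (rot a).
Proof.
move=> i j; case: (ltnP i K) => iK; case: (ltnP j K) => jK.
- rewrite /rot iK jK => /eqP; rewrite eqn_modDr !modn_small// => /eqP //.
- have jf : (j < K)%N = false by rewrite ltnNge jK.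
  by move=> e; have := rotlt a iK; rewrite e /rot jf jf.
- have jf : (i < K)%N = false by rewrite ltnNge iK.
  by move=> e; have := rotlt a jK; rewrite -e /rot jf jf.
- by rewrite /rot (ltnNge i) (ltnNge j) iK jK.
Qed.

Let perm_rot a : perm_eq (map (rot a) s) s.
Proof.
have um : uniq (map (rot a) s) by rewrite map_inj_uniq//; exact: rot_inj.
apply: uniq_perm => //; apply: (uniq_min_size um _ _).2; last by rewrite size_map.
by move=> _ /mapP[j + ->]; rewrite !memK; exact: rotlt.
Qed.

Let rotS a j : (j < K)%N -> rot a (j.+1 %% K)%N = ((rot a j).+1 %% K)%N.
Proof.
by move=> jK; rewrite /rot jK ltn_mod /= -addn1 modnDml -[X in _ = (X %% _)%N]addn1 modnDml addnAC.
Qed.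

Let cyclicW_rot a w : cyclicW (w \o rot a) = cyclicW w.
Proof.
rewrite /cyclicW -[in RHS](perm_big _ (perm_rot a)) big_map; congr EFin.
apply: eq_big_seq => j; rewrite /s mem_iota /= add0n => jK.
by rewrite rotS.
Qed.

Let nonpos_rot a w : nonpos s (w \o rot a) = nonpos s w.
Proof. by rewrite /nonpos -[RHS](perm_all _ (perm_rot a)) all_map. Qed.

Let cycF w := cyclicW w * (nonpos s w)%:R%:E.

Let cycF_rot a w : cycF (w \o rot a) = cycF w.
Proof. by rewrite /cycF cyclicW_rot nonpos_rot. Qed.

Let lint_rot i : i \in s -> lint (rem i s) cycF = lint (rem k s) cycF.
Proof.
rewrite memK => iK.
have rk : rot i.+1 k = i.
  by rewrite /rot ltnSn addnS -addSn modnDl modn_small.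
rewrite -[RHS](lint_map (f := rot i.+1) (rem k s) cycF (@rot_inj i.+1)) (eq_lint _ (cycF_rot i.+1)).
apply: lint_perm.
- by rewrite rem_uniq.
- have -> : map (rot i.+1) (rem k s) = rem i (map (rot i.+1) s).
    rewrite -{2}rk; elim: (s) => [//|j t IH] /=; rewrite (inj_eq (@rot_inj i.+1)).
    by case: eqP => //= _; rewrite IH.
  by rewrite perm_sym; exact: (perm_rem i us (perm_rot i.+1)).
- by move=> w; rewrite mule_ge0 ?cyclicW_ge0.
- apply: emeasurable_funM; first exact: measurable_cyclicW.
  by apply: measurable_boolE; exact: measurable_nonpos.
Qed.

Let remk : rem k s = iota 0 k.
Proof.
rewrite /s /K -addn1 iotaD /= add0n.
rewrite rem_filter ?filter_cat /=.
  rewrite eqxx /= cats0; apply/all_filterP/allP => j; rewrite mem_iota /= add0n => jk.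
  by rewrite ltn_eqF.
by have := iota_uniq 0 (k + 1); rewrite iotaD.
Qed.

Let cyclicW_walkW (c : R -> bool) w : (forall i, i \notin iota 0 k -> w i = 0%R) ->
  c 0%R ->
  (walkW c 0%R (rcons (nseq k false) true) 0%R w)%:E =
  cyclicW w * (all (fun j => c (w j)) s)%:R%:E.
Proof.
move=> w0 c0.
have wk : w k = 0%R by rewrite w0// mem_iota /= add0n ltnn.
have wp j : (j < K)%N -> wpos (rcons (nseq k false) true) 0 w j = w j.
  rewrite ltnS leq_eqVlt /wpos nth_rcons size_nseq => /orP[/eqP ->|jk].
    by rewrite ltnn eqxx wk.
  by rewrite jk nth_nseq jk.
rewrite /cyclicW -EFinM; congr EFin.
(* Rotation by [k], which is [-1] modulo [K], turns the increment out of [j] into the increment into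
   [j]. *)
rewrite -prod_boolR -[X in (X * _)%R](perm_big _ (perm_rot k)) big_map.
rewrite /walkW size_rcons size_nseq -/K -/s big_split; congr (_ * _)%R; last first.
  by apply: eq_big_seq => j; rewrite memK => jK; rewrite wp.
apply: eq_big_seq => j; rewrite memK => jK.
have -> : ((rot k j).+1 %% K)%N = j.
  by rewrite /rot jK -addn1 modnDml -addnA addn1 modnDr modn_small.
suff -> : wprev (rcons (nseq k false) true) 0 0 w j = w (rot k j) by rewrite wp.
case: j jK => [|j] jK /=; first by rewrite /rot /= add0n modn_small ?wk.
by rewrite wp ?(ltnW jK)// /rot jK addSnnS modnDr modn_small// ltnW.
Qed.

(** By rotation each of the [K] positions is equally likely to carry the maximum, and a bridge whose
    maximum is at the pinned end is one that stays nonpositive. *)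
Lemma walkV_bridge : walkV (below 0) 0%R (rcons (nseq k false) true) 0%R =
  (K%:R^-1 * normal_pdf 0 (Num.sqrt K%:R) 0 : R)%:E.
Proof.
have ks : k \in s by rewrite memK.
have sh w x : cyclicW (shift_on s w x) = cyclicW w.
  rewrite /cyclicW; congr EFin; apply: eq_big_seq => j js; congr phi.
  rewrite /shift_on js ifT; first by ring.
  by rewrite memK ltn_mod.
have := lint_max_decomposition us ks cyclicW_ge0 measurable_cyclicW sh.
rewrite (eq_big_seq (fun=> walkV (below 0) 0%R (rcons (nseq k false) true) 0%R)); last first.
  move=> i is_; rewrite -/cycF [LHS]lint_rot// remk -lint_walkW; last 2 first.
  - exact: measurable_below.
  - by rewrite /below lexx.
  rewrite unpinned_bridge; apply: eq_lint_supp => w w0.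
  by rewrite cyclicW_walkW// /below lexx.
rewrite remk.
have -> : lint (iota 0 k) cyclicW = (normal_pdf 0 (Num.sqrt K%:R) 0)%:E.
  rewrite -[X in normal_pdf _ _ X](subrr (0 : R)%R) -walkV_free_bridge -lint_walkW//.
  rewrite unpinned_bridge; apply: eq_lint_supp => w w0.
  by rewrite cyclicW_walkW// all_predT mule1.
rewrite sume_const_seq ?walkV_ge0// size_iota.
move=> /esym; set X := walkV _ _ _ _; have : 0 <= X by exact: walkV_ge0.
case: X => [x| |]// x0.
  by rewrite -EFinM => -[<-]; rewrite mulrA mulVf ?mul1r// pnatr_eq0.
by rewrite gt0_muley// lte_fin ltr0n.
Qed.

End bridge.

Section sparre_andersen.
Variable n : nat.
Let s := iota 0 n.+1.

Definition stepsW (r : seq nat) (w : nat -> R) : R := (\prod_(j <- r) phi (w j.+1 - w j))%R.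

Lemma stepsW_ge0 r w : (0 <= stepsW r w)%R.
Proof. by rewrite prodr_ge0// => j _; exact: phi_ge0. Qed.

Lemma measurable_stepsW r : measurable_fun [set: vec R nat] (stepsW r).
Proof.
apply: measurable_prodr => j _; apply: measurable_phi.
by apply: measurable_funB; exact: measurable_coord.
Qed.

Let us : uniq s. Proof. exact: iota_uniq. Qed.

Let mems j : (j \in s) = (j <= n)%N.
Proof. by rewrite mem_iota leq0n add0n ltnS. Qed.

Let free_right (c : R -> bool) i k : measurable_fun [set: R] c -> c 0%R ->
  lint (iota i.+1 k) (fun v => (stepsW (iota i k) v * (all (fun j => c (v j)) (iota i.+1 k))%:R)%:E) =
  walkV c 0%R (nseq k false) 0%R.
Proof.
move=> mc c0; rewrite -lint_walkW// unpinned_free.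
have inj : injective (addn i.+1) by exact: addnI.
rewrite -[in iota i.+1 k](addn0 i.+1) iotaDl -[RHS](lint_map (iota 0 k) _ inj).
apply: eq_lint_supp => w w0; congr EFin; rewrite walkW_free; congr (_ * _)%R.
  rewrite /stepsW -[X in iota X k](addn0 i) iotaDl big_map; apply: eq_bigr => -[|j] _ /=.
    rewrite !addn0 (w0 i)//; apply/mapP => -[j _ ij].
    lia.
  by congr (phi (w _ - w _)); lia.
by rewrite all_map.
Qed.

(** Time reversal: read backwards from position [i], the initial stretch is a walk started at
    [0]. *)
Let free_left i :
  lint (iota 0 i) (fun v => (stepsW (iota 0 i) v * (nonpos (iota 0 i) v)%:R)%:E) =
  walkV (below 0) 0%R (nseq i false) 0%R.
Proof.
have mb : measurable_fun [set: R] (below (0 : R)) by exact: measurable_below.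
rewrite -lint_walkW//; last by rewrite /below lexx.
rewrite unpinned_free.
pose rv j := (if j < i then i.-1 - j else j)%N.
have rvlt j : (j < i)%N -> (rv j < i)%N.
  move=> ji; rewrite /rv ji; lia.
have rvK : involutive rv.
  move=> j; rewrite {2}/rv; case: (ltnP j i) => ji; rewrite /rv; last by rewrite ltnNge ji.
  rewrite (_ : (i.-1 - j < i)%N); lia.
have rvi : injective rv := inv_inj rvK.
have prv : perm_eq (map rv (iota 0 i)) (iota 0 i).
  have um : uniq (map rv (iota 0 i)) by rewrite map_inj_uniq ?iota_uniq.
  apply: uniq_perm => //; first exact: iota_uniq.
  apply: (uniq_min_size um _ _).2; last by rewrite size_map.
  by move=> _ /mapP[j + ->]; rewrite !mem_iota /= !add0n; exact: rvlt.
rewrite -[RHS](lint_map (f := rv) (iota 0 i) _ rvi).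
rewrite -(lint_perm _ prv); first last.
- apply/measurable_EFinP; apply: measurable_funM; first exact: measurable_stepsW.
  by apply: measurable_boolR; exact: measurable_nonpos.
- by move=> w; rewrite lee_fin mulr_ge0 ?stepsW_ge0.
- by rewrite map_inj_uniq ?iota_uniq.
apply: eq_lint_supp => w w0.
have wi : w i = 0%R.
  by apply: w0; rewrite (perm_mem prv) mem_iota /= add0n ltnn.
congr EFin; rewrite walkW_free; congr (_ * _)%R.
  rewrite /stepsW -[LHS](perm_big _ prv) big_map; apply: eq_big_seq => j.
  rewrite mem_iota /= add0n => ji.
  rewrite /comp -phiN opprB; congr (phi _); congr (_ - _)%R.
  case: j ji => [|j] ji.
    by rewrite /rv ji subn0 prednK.
  rewrite /rv ji (ltnW ji); congr (w _).
  lia.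
by rewrite /nonpos -(perm_all _ prv) all_map.
Qed.

(** A free walk is cut at its maximum: the stretch before it, reversed, and the stretch after it are
    independent walks that stay nonpositive. *)
Lemma walkV_convolution :
  \sum_(i <- s) (walkV (below 0%R) 0%R (nseq i false) 0%R *
                 walkV (below 0%R) 0%R (nseq (n - i)%N false) 0%R) = 1 :> \bar R.
Proof.
pose C (w : nat -> R) : \bar R := (stepsW (iota 0 n) w)%:E.
have C0 w : 0 <= C w by rewrite lee_fin stepsW_ge0.
have mC : measurable_fun [set: vec R nat] C by apply/measurable_EFinP; exact: measurable_stepsW.
have sh w x : C (shift_on s w x) = C w.
  congr EFin; apply: eq_big_seq => j; rewrite mem_iota /= add0n => jn.
  by rewrite /shift_on !mems jn (ltnW jn); congr phi; ring.
have s0 : 0%N \in s by rewrite mems.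
have := lint_max_decomposition us s0 C0 mC sh.
have -> : lint (rem 0%N s) C = 1.
  rewrite /s iotaS0 /= -[[seq i.+1 | i <- iota 0 n]](iotaDl 1 0) addn0.
  rewrite -[RHS](walkV_free_total (0 : R) n 0) -(free_right 0)//.
  by apply: eq_lint => w; rewrite all_predT mulr1.
move=> ->; apply: eq_big_seq => i; rewrite mems => ni.
pose L := iota 0 i; pose Q := iota i.+1 (n - i).
have sE : iota 0 n.+1 = L ++ i :: Q.
  by rewrite -[n.+1](subnKC (leqW ni)) iotaD add0n subSn.
have nE : iota 0 n = L ++ iota i (n - i) by rewrite -{1}(subnKC ni) iotaD.
have iL : i \notin L by rewrite mem_iota /= add0n ltnn.
have iQ : i \notin Q by rewrite mem_iota ltnn.
have -> : rem i s = L ++ Q.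
  rewrite /s sE rem_filter; last by rewrite -sE iota_uniq.
  rewrite filter_cat /= eqxx /=; congr (_ ++ _); apply/all_filterP/allP => j jL /=.
    by apply: contraNneq iL => <-.
  by apply: contraNneq iQ => <-.
rewrite lint_cat -/(below _).
have mb := @measurable_below R 0.
have b0 : below (0 : R) 0 by rewrite /below lexx.
pose FR (v : nat -> R) : \bar R := (stepsW (iota i (n - i)) v * (nonpos Q v)%:R)%:E.
pose FL (v : nat -> R) : \bar R := (stepsW L v * (nonpos L v)%:R)%:E.
have FR0 v : 0 <= FR v by rewrite lee_fin mulr_ge0 ?stepsW_ge0.
have FL0 v : 0 <= FL v by rewrite lee_fin mulr_ge0 ?stepsW_ge0.
have mFR : measurable_fun [set: vec R nat] FR.
  apply/measurable_EFinP; apply: measurable_funM; first exact: measurable_stepsW.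
  by apply: measurable_boolR; exact: measurable_nonpos.
have mFL : measurable_fun [set: vec R nat] FL.
  apply/measurable_EFinP; apply: measurable_funM; first exact: measurable_stepsW.
  by apply: measurable_boolR; exact: measurable_nonpos.
rewrite -(free_right i (n - i) mb b0) -(free_left i).
rewrite -[X in X * _ = _]/(lint L FL) -[X in _ * X = _]/(lint Q FR).
rewrite muleC -lint_Zl//; last exact: lint_ge0.
apply: eq_lint_supp => w w0; rewrite muleC -lint_Zl//.
apply: eq_lint_supp => v v0.
have vi : v i = 0%R by exact: v0.
have wi : w i = 0%R by exact: w0.
have mL j : (j < i)%N -> mrg L w v j = w j by move=> ji; rewrite /mrg mem_iota /= add0n ji.
have mQ j : (i <= j)%N -> mrg L w v j = v j by move=> ij; rewrite /mrg mem_iota /= add0n ltnNge ij.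
rewrite /C /s sE nE all_cat /= mQ// vi lexx /= /FL /FR -!EFinM; congr EFin.
rewrite {3}/stepsW big_cat /=.
have -> : all (fun j => mrg L w v j <= 0)%R L = nonpos L w.
  by apply: eq_in_all => j; rewrite mem_iota /= add0n => ji; rewrite mL.
have -> : all (fun j => mrg L w v j <= 0)%R Q = nonpos Q v.
  by apply: eq_in_all => j; rewrite mem_iota => /andP[ij _]; rewrite mQ// ltnW.
rewrite -mulnb natrM.
have -> : (\prod_(j <- L) phi (mrg L w v j.+1 - mrg L w v j) = stepsW L w)%R.
  apply: eq_big_seq => j; rewrite mem_iota /= add0n => ji; rewrite (mL j)//.
  have [ji1|ji1] := ltnP j.+1 i; first by rewrite mL.
  have -> : j.+1 = i by apply/eqP; rewrite eqn_leq ji1 ji.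
  by rewrite mQ// vi wi.
have -> : (\prod_(j <- iota i (n - i)) phi (mrg L w v j.+1 - mrg L w v j) = stepsW (iota i (n - i)) v)%R.
  by apply: eq_big_seq => j; rewrite mem_iota => /andP[ij _]; rewrite !mQ// ltnW.
by rewrite mulrACA.
Qed.

End sparre_andersen.

End bridge_and_sparre_andersen.

(** * The ratio of double factorials *)

Section double_factorial_ratio.
Context {R : realType}.

Lemma dfactS k : dfact k.+2 = (k.+2 * dfact k)%N.
Proof. by []. Qed.

Lemma dfact_gt0 k : (0 < dfact k)%N.
Proof.
suff : (0 < dfact k)%N && (0 < dfact k.+1)%N by case/andP.
elim: k => [//|k /andP[k0 k1]]; by rewrite k1 dfactS muln_gt0 k0.
Qed.

Lemma dratio0 : dratio R 0 = 1.
Proof. by rewrite /dratio /= divr1. Qed.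

(** The recurrence of the coefficients of [(1 - x)^(-1/2)]. *)
Lemma dratioS k : (2 * k.+1%:R) * dratio R k.+1 = (2 * k%:R + 1) * dratio R k :> R.
Proof.
rewrite /dratio.
have -> : (2 * k.+1 - 1 = (2 * k).+1)%N by rewrite mulnS.
have -> : dfact (2 * k).+1 = ((2 * k).+1 * dfact (2 * k - 1))%N.
  case: k => [//|k]; have -> : (2 * k.+1 = (2 * k).+2)%N by rewrite mulnS.
  by rewrite dfactS subn1.
have -> : (2 * k.+1 = (2 * k).+2)%N by rewrite mulnS.
rewrite dfactS !natrM.
have d0 : ((dfact (2 * k))%:R != 0 :> R) by rewrite pnatr_eq0 -lt0n dfact_gt0.
have -> : ((2 * k).+2%:R = 2 * k.+1%:R :> R) by rewrite -natrM mulnS.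
have -> : ((2 * k).+1%:R = 2 * k%:R + 1 :> R) by rewrite -natr1 natrM.
have k1 : (k.+1%:R != 0 :> R) by rewrite pnatr_eq0.
move: k1 d0; set a := _ k.+1; set b := dfact _ => k1 d0.
have -> : (2 * k%:R + 1) * (dfact (2 * k - 1))%:R / (2 * a * b%:R) =
  (2 * a)^-1 * ((2 * k%:R + 1) * (dfact (2 * k - 1))%:R / b%:R) by rewrite invfM; ring.
by rewrite mulVKf ?mulf_neq0 ?pnatr_eq0// mulrA.
Qed.

(** The square of [(1 - x)^(-1/2)] is the geometric series. By the symmetry [i -> n - i] the sum
    weighted by [2 i] is [n] times the plain sum, and with this weight the recurrence leads from
    [n+1] back to [n]. *)
Lemma dratio_convolution n : \sum_(i < n.+1) dratio R i * dratio R (n - i) = 1.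
Proof.
pose a := dratio R; pose T n := \sum_(i < n.+1) a i * a (n - i)%N.
have half m : 2 * \sum_(i < m.+1) i%:R * (a i * a (m - i)%N) = m%:R * T m.
  rewrite mulr2n mulrDl mul1r {2}(reindex_inj rev_ord_inj) /= -big_split /= /T mulr_sumr.
  apply: eq_bigr => i _; rewrite subSS subKn; last by rewrite -ltnS.
  have im : (i <= m)%N by rewrite -ltnS.
  rewrite (natrB _ im); set x := a i; set y := a _; set u := i%:R; set v := m%:R; ring.
rewrite -[LHS]/(T n); elim: n => [|n IH]; first by rewrite /T big_ord1 /a dratio0 mulr1.
apply: (mulfI (x := n.+1%:R)); first by rewrite pnatr_eq0.
rewrite -half big_ord_recl mul0r add0r mulr_sumr.
transitivity (\sum_(i < n.+1) (2 * (i%:R * (a i * a (n - i)%N)) + a i * a (n - i)%N)).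
  apply: eq_bigr => i _; rewrite lift0 subSS.
  transitivity ((2 * i.+1%:R * a i.+1) * a (n - i)%N); first by ring.
  by rewrite /a dratioS; ring.
by rewrite big_split /= -mulr_sumr half -/(T n) IH -natr1; ring.
Qed.

(** Two sequences that start at [1] and satisfy the same convolution identity agree: the two extreme
    terms isolate twice the new value, and the others are known by induction. *)
Lemma walkV_sparre_andersen n :
  walkV (below 0) 0 (nseq n false) 0 = (dratio R n)%:E.
Proof.
rewrite -pers_pE; congr EFin.
have conv m : \sum_(i < m.+1) pers_p i (0:R) * pers_p (m - i) 0 = 1.
  apply: EFin_inj; rewrite -[RHS](walkV_convolution m) -sumEFin.
  rewrite -[iota 0 m.+1]/(index_iota 0 m.+1) big_mkord.
  by apply: eq_bigr => i _; rewrite -!pers_pE EFinM.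
have p0 : pers_p 0 (0 : R) = 1.
  by apply: EFin_inj; rewrite pers_pE.
elim/ltn_ind: n => -[|n] IH; first by rewrite p0 dratio0.
have := conv n.+1; rewrite -[RHS](dratio_convolution n.+1).
rewrite big_ord_recl big_ord_recr [in RHS]big_ord_recl [in RHS]big_ord_recr /=.
rewrite !subn0 /bump /= !add1n !subnn p0 dratio0.
rewrite (eq_bigr (fun i : 'I_n => dratio R i.+1 * dratio R (n - i))).
  rewrite [X in _ = _ + (X + _) -> _](eq_bigr (fun i : 'I_n => dratio R i.+1 * dratio R (n - i))); last first.
    by move=> i _; rewrite add1n subSS.
  set x := \sum_(_ < _) _; move: x => x.
  lra.
move=> i _; rewrite add1n subSS !IH//.
  by rewrite ltnS leq_subr.
by rewrite !ltnS.
Qed.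

End double_factorial_ratio.

(** * Triangulation of a hull by the upper faces of a lifting *)

Section upper_simplices.
Context {R : realType} (d : nat) (J : finType) (P : J -> 'I_d -> R).

(** Homogeneous coordinates [(1, x)]: affine combinations become products with row vectors, and
    affine spans become row spaces. *)
Definition extrow (x : 'I_d -> R) : 'rV[R]_d.+1 :=
  \row_k (if unlift ord0 k is Some c then x c else 1).

Let mulmxE' a b c (M : 'M[R]_(a, b)) (N : 'M[R]_(b, c)) i j :
  (M *m N) i j = \sum_k M i k * N k j.
Proof. by rewrite mxE. Qed.

Lemma extrow0 x : extrow x 0 ord0 = 1.
Proof. by rewrite mxE unlift_none. Qed.

Lemma extrowS x c : extrow x 0 (lift ord0 c) = x c.
Proof. by rewrite mxE liftK. Qed.

Lemma extrowP x (v : 'rV[R]_d.+1) :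
  v 0 ord0 = 1 -> (forall c, v 0 (lift ord0 c) = x c) -> extrow x = v.
Proof.
move=> v0 vS; apply/rowP => k; case: (unliftP ord0 k) => [c ->|->].
  by rewrite extrowS vS.
by rewrite extrow0 v0.
Qed.

Definition ptmx k (f : 'I_k -> J) : 'M[R]_(k, d.+1) := \matrix_i extrow (P (f i)).

Lemma row_ptmx k (f : 'I_k -> J) i : row i (ptmx f) = extrow (P (f i)).
Proof. exact: rowK. Qed.

Lemma ptmx0 k (f : 'I_k -> J) i : ptmx f i ord0 = 1.
Proof. by rewrite mxE extrow0. Qed.

Definition bary (f : 'I_d.+1 -> J) x : 'rV[R]_d.+1 := extrow x *m invmx (ptmx f).

(** A degenerate simplex counts as empty, in agreement with its zero volume. *)
Definition in_simplex (f : 'I_d.+1 -> J) x :=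
  (ptmx f \in unitmx) && [forall i, 0 <= bary f x 0 i].

Definition interp (H : J -> R) (f : 'I_d.+1 -> J) x : R :=
  \sum_i bary f x 0 i * H (f i).

(** The lifted simplex lies in the upper boundary of the hull of the lifted points. *)
Definition upper (H : J -> R) (f : 'I_d.+1 -> J) :=
  [forall j, H j <= interp H f (P j)].

Lemma bary_mul f x : ptmx f \in unitmx -> bary f x *m ptmx f = extrow x.
Proof. by move=> fu; rewrite /bary mulmxKV. Qed.

Lemma bary_uniq f x v : ptmx f \in unitmx -> v *m ptmx f = extrow x -> bary f x = v.
Proof. by move=> fu vx; rewrite /bary -vx mulmxK. Qed.

Lemma sum_bary f x : ptmx f \in unitmx -> \sum_i bary f x 0 i = 1.
Proof.
move=> fu; rewrite -(extrow0 x) -(bary_mul x fu) mxE.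
by apply: eq_bigr => i _; rewrite ptmx0 mulr1.
Qed.

Lemma bary_vertex f i : ptmx f \in unitmx -> bary f (P (f i)) = delta_mx 0 i.
Proof. by move=> fu; apply: bary_uniq => //; rewrite -rowE row_ptmx. Qed.

Lemma ptmx_inj f : ptmx f \in unitmx -> injective f.
Proof.
move=> fu i j fij; have := bary_vertex i fu; rewrite fij bary_vertex// => /matrixP/(_ 0 j).
by rewrite !mxE !eqxx /=; case: eqP => // ij /eqP; rewrite oner_eq0.
Qed.

Lemma interp_bary H f g x : ptmx f \in unitmx -> ptmx g \in unitmx ->
  interp H g x = \sum_i bary f x 0 i * interp H g (P (f i)).
Proof.
move=> fu gu; rewrite /interp.
under [RHS]eq_bigr do rewrite mulr_sumr.
rewrite exchange_big /=; apply: eq_bigr => k _.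
have -> : bary g x = bary f x *m (\matrix_i bary g (P (f i))).
  apply: bary_uniq => //; rewrite -mulmxA.
  suff -> : (\matrix_i bary g (P (f i))) *m ptmx g = ptmx f by rewrite bary_mul.
  by apply/row_matrixP => i; rewrite row_mul rowK bary_mul// row_ptmx.
by rewrite mulmxE' mulr_suml; apply: eq_bigr => i _; rewrite [X in _ * X * _]mxE mulrA.
Qed.

Lemma in_simplex_hull f x : in_simplex f x -> hull P x.
Proof.
move=> /andP[fu /forallP b0]; exists (fun j => \sum_(i | f i == j) bary f x 0 i).
split; first by move=> j; rewrite sumr_ge0.
split.
  by rewrite -(sum_bary x fu) [RHS](partition_big f predT).
move=> c; rewrite -extrowS -(bary_mul x fu) mxE [LHS](partition_big f predT)//=.
apply: eq_bigr => j _; rewrite mulr_suml; apply: eq_bigr => i /eqP <-.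
by congr (_ * _); rewrite mxE extrowS.
Qed.

(** Such an [x] avoids the affine span of every set of points that does not span the space, hence
    lies in the interior of every simplex that contains it. *)
Definition in_general_position (x : 'I_d -> R) :=
  forall B : {set J}, (extrow x <= ptmx (@enum_val _ (mem B)))%MS ->
    row_full (ptmx (@enum_val _ (mem B))).

Lemma ptmx_sub k l (f : 'I_k -> J) (g : 'I_l -> J) :
  (forall i, exists i', f i = g i') -> (ptmx f <= ptmx g)%MS.
Proof.
move=> fg; apply/row_subP => i; have [i' fgi] := fg i.
by rewrite row_ptmx fgi -row_ptmx row_sub.
Qed.

Lemma general_position_fun x k (f : 'I_k -> J) : in_general_position x ->
  (extrow x <= ptmx f)%MS -> row_full (ptmx f).
Proof.
move=> gx xf; pose B := [set f i | i : 'I_k]%SET.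
have fB : (ptmx f <= ptmx (@enum_val _ (mem B)))%MS.
  apply: ptmx_sub => i; have iB : f i \in B by exact: imset_f.
  by exists (enum_rank_in iB (f i)); rewrite enum_rankK_in.
have Bf : (ptmx (@enum_val _ (mem B)) <= ptmx f)%MS.
  apply: ptmx_sub => i; have /imsetP[i' _ ->] := enum_valP i.
  by exists i'.
have := gx B (submx_trans xf fB); rewrite -!sub1mx => /submx_trans; exact.
Qed.

(** If a coordinate vanished, [x] would lie in the span of only [d] points. *)
Lemma bary_gt0 f x i : in_general_position x -> in_simplex f x -> 0 < bary f x 0 i.
Proof.
move=> gx /andP[fu /forallP b0]; rewrite lt_neqAle b0 andbT eq_sym.
apply/eqP => bi0; have : (extrow x <= ptmx (f \o lift i))%MS.
  rewrite -(bary_mul x fu) mulmx_sum_row summx_sub// => k _.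
  case: (unliftP i k) => [k' ->|->]; last by rewrite bi0 scale0r sub0mx.
  by apply: scalemx_sub; rewrite row_ptmx -[P _]/(P ((f \o lift i) k')) -row_ptmx row_sub.
move=> /(general_position_fun gx); rewrite /row_full => /eqP rk.
by have := rank_leq_row (ptmx (f \o lift i)); rewrite rk ltnn.
Qed.

(* The simplex method: the pivot enters the vertex [j] violating the upper
   condition, and the ratio test chooses the vertex [k] that leaves. *)
Lemma simplex_exchange H f x j : in_general_position x -> in_simplex f x ->
  interp H f (P j) < H j ->
  exists2 g, in_simplex g x & interp H f x < interp H g x.
Proof.
move=> gx fx Hj; have /andP[fu _] := fx.
pose lam i := bary f x 0 i; pose c i := bary f (P j) 0 i.
have lam0 i : 0 < lam i by exact: bary_gt0.
have [k0 ck0] : exists k, 0 < c k.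
  apply/existsP; apply: contraT => /existsPn cn.
  have := sum_bary (P j) fu; move=> /eqP; rewrite eq_le => /andP[_].
  rewrite leNgt (le_lt_trans _ ltr01)// sumr_le0// => i _.
  by rewrite leNgt cn.
have [k ck kmin] := @arg_minP _ _ _ k0 (fun k => 0 < c k) (fun k => lam k / c k) ck0.
pose t := lam k / c k.
have t0 : 0 < t by rewrite divr_gt0.
pose g i := if i == k then j else f i.
pose lam' : 'rV[R]_d.+1 := \row_i (if i == k then t else lam i - t * c i).
have gE : ptmx g = rowm k c *m ptmx f.
  apply/row_matrixP => i; rewrite row_mul row_ptmx /g.
  have [ik|ik] := eqVneq i k.
    suff -> : row i (rowm k c) = bary f (P j) by rewrite bary_mul.
    by apply/rowP => i'; rewrite [LHS]mxE [LHS]mxE ik eqxx.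
  suff -> : row i (rowm k c) = delta_mx 0 i by rewrite -rowE row_ptmx.
  by apply/rowP => i'; rewrite !mxE (negbTE ik) eqxx eq_sym.
have gu : ptmx g \in unitmx.
  by rewrite gE unitmx_mul fu andbT unitmxE det_rowm unitfE gt_eqF.
have bg : bary g x = lam'.
  apply: bary_uniq => //; rewrite gE mulmxA -(bary_mul x fu); congr (_ *m _).
  apply/rowP => i; rewrite [LHS]mulmxE' (bigD1 k)//= [X in X * _ + _]mxE [X in _ * X + _]mxE eqxx.
  have [->|ik] := eqVneq i k.
    rewrite big1 ?addr0 => [|i' i'k]; first by rewrite /t divfK ?gt_eqF.
    by rewrite !mxE (negbTE i'k) mulr0.
  rewrite (bigD1 i)//= big1 ?addr0 => [|i' /andP[i'k i'i]].
    rewrite [X in _ + X * _]mxE [X in _ + _ * X]mxE (negbTE ik) eqxx mulr1.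
    by rewrite addrC subrK.
  by rewrite !mxE (negbTE i'k) (negbTE i'i) mulr0.
exists g.
  rewrite /in_simplex gu; apply/forallP => i; rewrite bg mxE.
  case: eqP => _; first exact: ltW.
  rewrite subr_ge0; have [ci|ci] := ltP 0 (c i).
    by rewrite -ler_pdivlMr//; exact: kmin.
  by apply: le_trans (ltW (lam0 i)); rewrite pmulr_rle0.
suff -> : interp H g x = interp H f x + t * (H j - interp H f (P j)).
  by rewrite ltrDl mulr_gt0// subr_gt0.
rewrite /interp bg (bigD1 k)//= mxE eqxx /g eqxx.
transitivity (t * H j + \sum_i (lam i - t * c i) * H (f i)).
  congr (_ + _); rewrite [RHS](bigD1 k)//= /t divfK ?gt_eqF// subrr mul0r add0r.
  by apply: eq_bigr => i ik; rewrite mxE (negbTE ik).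
rewrite mulrBr mulr_sumr [RHS]addrCA; congr (_ + _); rewrite -sumrB.
by apply: eq_bigr => i _; rewrite mulrBl mulrA.
Qed.

(** Among the finitely many simplices containing [x], one whose lifting is highest above [x] is
    upper, since otherwise an exchange would raise it further. *)
Lemma exists_upper H f x : in_general_position x -> in_simplex f x ->
  exists2 g, in_simplex g x & upper H g.
Proof.
move=> gx fx.
have fx' : in_simplex (finfun f) x.
  suff -> : in_simplex (finfun f) x = in_simplex f x by [].
  have fE : ptmx (finfun f) = ptmx f by apply/row_matrixP => i; rewrite !row_ptmx ffunE.
  by rewrite /in_simplex /bary fE.
have [g gs gmax] := @arg_maxP _ _ _ (finfun f)
  (fun f : {ffun 'I_d.+1 -> J} => in_simplex f x) (fun f => interp H f x) fx'.
exists g => //; apply/forallP => j; rewrite leNgt; apply/negP => Hj.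
have [h hs] := simplex_exchange gx gs Hj.
have hE : ptmx (finfun h) = ptmx h by apply/row_matrixP => i; rewrite !row_ptmx ffunE.
rewrite ltNge => /negP; apply.
have -> : interp H h x = interp H (finfun h) x.
  by rewrite /interp /bary hE; apply: eq_bigr => i _; rewrite ffunE.
by apply: gmax; rewrite /in_simplex /bary hE.
Qed.

(** Two upper simplices over [x] have the same height above [x]; a vanishing sum of nonnegative
    terms with positive weights then forces equality at every vertex. *)
Lemma upper_equal H f g x i : in_general_position x -> in_simplex f x -> in_simplex g x ->
  upper H f -> upper H g -> H (f i) = interp H g (P (f i)).
Proof.
move=> gx fx gx' /forallP uf /forallP ug.
have /andP[fu _] := fx; have /andP[gu _] := gx'.
have le_interp (f' g' : 'I_d.+1 -> J) : in_simplex f' x -> ptmx g' \in unitmx ->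
    (forall j, H j <= interp H g' (P j)) -> interp H f' x <= interp H g' x.
  move=> /andP[fu' /forallP b0] gu' u; rewrite (interp_bary _ _ fu' gu').
  by apply: ler_sum => k _; rewrite ler_wpM2l.
have eqx : \sum_i bary f x 0 i * (interp H g (P (f i)) - H (f i)) = 0.
  under eq_bigr do rewrite mulrBr.
  rewrite sumrB -interp_bary// -[X in _ - X]/(interp H f x); apply/eqP.
  by rewrite subr_eq0 eq_le !le_interp.
have := psumr_eq0P _ eqx => /(_ _ i isT) h.
have /eqP : bary f x 0 i * (interp H g (P (f i)) - H (f i)) = 0.
  apply: h => k _; rewrite mulr_ge0 ?subr_ge0 ?ug//.
  by rewrite ltW// bary_gt0.
by rewrite mulf_eq0 gt_eqF ?bary_gt0//= subr_eq0 => /eqP.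
Qed.

Definition comb (lam : J -> R) : 'rV[R]_d.+1 := \sum_j lam j *: extrow (P j).

Lemma comb_ptmx k (f : 'I_k -> J) lam : injective f ->
  (forall j, lam j != 0 -> exists i, j = f i) ->
  comb lam = (\row_i lam (f i)) *m ptmx f.
Proof.
move=> fI lf; rewrite mulmx_sum_row /comb (bigID (mem [set f i | i in 'I_k]%SET)) /=.
rewrite [X in _ + X]big1 => [|j jf]; last first.
  apply/eqP; rewrite scaler_eq0; apply/orP; left; apply: contraR jf => /lf[i ->].
  exact: imset_f.
rewrite addr0 big_imset /=; last by move=> i j _ _; exact: fI.
by apply: eq_bigr => i _; rewrite row_ptmx mxE.
Qed.

Lemma hullP x : hull P x <-> exists2 lam : J -> R, (forall j, 0 <= lam j) & comb lam = extrow x.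
Proof.
have combE lam k : comb lam 0 k = \sum_j lam j * extrow (P j) 0 k.
  by rewrite summxE; apply: eq_bigr => j _; rewrite [LHS]mxE.
split=> [[lam [l0 [l1 lx]]]|[lam l0 lx]]; exists lam => //.
  apply/esym/extrowP; first by rewrite combE -l1; apply: eq_bigr => j _; rewrite extrow0 mulr1.
  by move=> c; rewrite combE lx; apply: eq_bigr => j _; rewrite extrowS.
split=> //; split.
  by rewrite -(extrow0 x) -lx combE; apply: eq_bigr => j _; rewrite extrow0 mulr1.
by move=> c; rewrite -extrowS -lx combE; apply: eq_bigr => j _; rewrite extrowS.
Qed.

Lemma comb_subZ lam t m : comb (fun j => lam j - t * m j) = comb lam - t *: comb m.
Proof.
rewrite /comb scaler_sumr -sumrB; apply: eq_bigr => j _.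
by rewrite scalerBl scalerA.
Qed.

(** The weights move along the affine dependence [m] until the first of them reaches zero. Some
    [m k] is positive because the entries of [m] sum to zero. *)
Lemma shrink_support lam m : (forall j, 0 <= lam j) -> (forall j, m j != 0 -> lam j != 0) ->
  comb m = 0 -> (exists j, m j != 0) -> exists2 lam', (forall j, 0 <= lam' j) &
  comb lam' = comb lam /\ (#|[set j | lam' j != 0%R]%SET| < #|[set j | lam j != 0%R]%SET|)%N.
Proof.
move=> l0 ml cm [j0 mj0].
have [k0 mk0] : exists k, 0 < m k.
  apply/existsP; apply: contraT => /existsPn mn.
  have sm : \sum_j - m j = 0.
    have : comb m 0 ord0 = 0 by rewrite cm mxE.
    rewrite summxE => m0; rewrite sumrN; apply/eqP; rewrite oppr_eq0 -[X in _ == X]m0.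
    by apply/eqP/eq_bigr => j _; rewrite [RHS]mxE extrow0 mulr1.
  have := psumr_eq0P _ sm => /(_ _ j0 isT) /eqP; rewrite oppr_eq0 => h.
  move: mj0; rewrite h// => j _; by rewrite oppr_ge0 leNgt mn.
have [k mk kmin] := @arg_minP _ _ _ k0 (fun k => 0 < m k) (fun k => lam k / m k) mk0.
exists (fun j => lam j - lam k / m k * m j).
  move=> j; rewrite subr_ge0; have [mj|mj] := ltP 0 (m j).
    by rewrite -ler_pdivlMr//; exact: kmin.
  by apply: le_trans (l0 j); rewrite mulr_ge0_le0// divr_ge0// ltW.
split; first by rewrite comb_subZ cm scaler0 subr0.
apply: proper_card; apply/properP; split.
  apply/fintype.subsetP => j; rewrite !inE; apply: contraNN => /eqP lj.
  rewrite lj; have [->|/ml] := eqVneq (m j) 0; first by rewrite mulr0 subr0.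
  by rewrite lj eqxx.
exists k; first by rewrite inE ml// gt_eqF.
by rewrite inE negbK divfK ?subrr// gt_eqF.
Qed.

(** In a convex combination of minimal support the points are affinely independent, and general
    position forces their number to be [d+1]. *)
Lemma caratheodory x : in_general_position x -> hull P x -> exists f, in_simplex f x.
Proof.
move=> gx /hullP[lam1 l1 x1].
pose Q k := `[< exists2 lam : J -> R, (forall j, 0 <= lam j) &
  comb lam = extrow x /\ #|[set j | lam j != 0]%SET| = k >].
have exQ : exists k, Q k by exists #|[set j | lam1 j != 0]%SET|; apply/asboolP; exists lam1.
case: (ex_minnP exQ) => k /asboolP[lam l0 [lx lk]] kmin.
pose B := [set j | lam j != 0]%SET; pose f : 'I_#|B| -> J := @enum_val _ (mem B).
have fI : injective f by exact: enum_val_inj.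
have fB j : lam j != 0 -> exists i, j = f i.
  move=> lj; have jB : j \in B by rewrite inE.
  by exists (enum_rank_in jB j); rewrite /f enum_rankK_in.
have Bf i : lam (f i) != 0 by have := enum_valP i; rewrite inE.
have full : row_full (ptmx f).
  by apply: (general_position_fun gx); rewrite -lx (comb_ptmx fI fB) submxMl.
have Bd : (#|B| <= d.+1)%N.
  rewrite leqNgt; apply/negP => dB.
  have : kermx (ptmx f) != 0.
    rewrite -mxrank_eq0 mxrank_ker subn_eq0 -ltnNge (leq_ltn_trans _ dB)//.
    exact: rank_leq_col.
  move=> /rowV0Pn[v /sub_kermxP vf v0].
  pose m j := \sum_(i | f i == j) v 0 i.
  have mf i : m (f i) = v 0 i.
    rewrite /m (big_pred1 i)// => i' /=; exact: inj_eq.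
  have ml j : m j != 0 -> lam j != 0.
    apply: contraNN => /eqP lj; rewrite /m big_pred0// => i.
    by apply/eqP => fij; have := Bf i; rewrite fij lj eqxx.
  have m0 : comb m = 0.
    rewrite (comb_ptmx fI) => [|j /ml]; last exact: fB.
    by rewrite -[RHS]vf; congr (_ *m _); apply/rowP => i; rewrite [LHS]mxE mf.
  have mn : exists j, m j != 0.
    apply: contrapT => mz; move: v0 => /negP; apply; apply/eqP/rowP => i.
    by rewrite mxE -mf; apply/eqP; apply: contraT => h; case: mz; exists (f i).
  have [lam' l0' [lx' lt]] := shrink_support l0 ml m0 mn.
  have : (k <= #|[set j | lam' j != 0%R]%SET|)%N by apply: kmin; apply/asboolP; exists lam'; rewrite // lx'.
  by rewrite -lk leqNgt lt.
have dB : d.+1 = #|B|.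
  apply/eqP; rewrite eqn_leq Bd andbT; move: full; rewrite /row_full => /eqP <-.
  exact: rank_leq_row.
pose g i := f (cast_ord dB i).
have gI : injective g by move=> i j /fI /cast_ord_inj.
have gB j : lam j != 0 -> exists i, j = g i.
  by move=> /fB[i ->]; exists (cast_ord (esym dB) i); rewrite /g cast_ordKV.
have gu : ptmx g \in unitmx.
  rewrite -row_full_unit; apply: (general_position_fun gx).
  by rewrite -lx (comb_ptmx gI gB) submxMl.
exists g; rewrite /in_simplex gu; apply/forallP => i.
have -> : bary g x = \row_i lam (g i).
  by apply: bary_uniq => //; rewrite -lx -comb_ptmx.
by rewrite mxE.
Qed.

End upper_simplices.

(** * Simplices indexed by sets of vertices *)

Section set_enumeration.
Context {R : realType} (d : nat) (J : finType) (j0 : J) (P : J -> 'I_d -> R).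

(** Simplices are functions on ['I_d.+1] while the theorem sums over sets; this fixes one ordering
    for each set, with [j0] as the default of [nth]. *)
Definition enum_set k (A : {set J}) (i : 'I_k) : J := nth j0 (enum A) i.

Lemma enum_set_inj k (A : {set J}) : #|A| = k -> injective (@enum_set k A).
Proof.
move=> Ak i j /eqP; rewrite nth_uniq ?enum_uniq// -?cardE ?Ak//.
by move=> /eqP ij; apply: val_inj.
Qed.

Lemma mem_enum_set k (A : {set J}) i : #|A| = k -> @enum_set k A i \in A.
Proof. by move=> Ak; rewrite -mem_enum mem_nth// -cardE Ak. Qed.

Lemma enum_set_surj k (A : {set J}) a : #|A| = k -> a \in A -> exists i, a = @enum_set k A i.
Proof.
move=> Ak aA; have ai : (index a (enum A) < k)%N by rewrite -Ak cardE index_mem mem_enum.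
by exists (Ordinal ai); rewrite /enum_set /= nth_index// mem_enum.
Qed.

Lemma map_enum_set k (A : {set J}) : #|A| = k ->
  [seq enum_set A i | i <- enum 'I_k] = enum A.
Proof.
move=> Ak; apply: (@eq_from_nth _ j0); first by rewrite size_map size_enum_ord -Ak cardE.
move=> i; rewrite size_map size_enum_ord => ik.
by rewrite (nth_map (Ordinal ik)) ?size_enum_ord// /enum_set nth_enum_ord.
Qed.

Section reordering.
Variables (f g : 'I_d.+1 -> J) (s : 'S_d.+1).
Hypothesis fg : forall i, g i = f (s i).

Lemma ptmx_reorder : ptmx P g = row_perm s (ptmx P f).
Proof. by apply/row_matrixP => i; rewrite row_ptmx fg; apply/rowP => k; rewrite !mxE. Qed.

Lemma ptmx_reorder_unit : (ptmx P g \in unitmx) = (ptmx P f \in unitmx).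
Proof. by rewrite ptmx_reorder row_permE unitmx_mul unitmx_perm. Qed.

Lemma bary_reorder x i : ptmx P f \in unitmx -> bary P g x 0 i = bary P f x 0 (s i).
Proof.
move=> fu; have bE (v : 'rV[R]_d.+1) : (col_perm s v) 0 i = v 0 (s i) by rewrite mxE.
rewrite -bE; congr (fun_of_matrix _ _ _).
apply: bary_uniq; first by rewrite ptmx_reorder_unit.
rewrite ptmx_reorder row_permE col_permE -mulmxA (mulmxA (perm_mx _)) -perm_mxM.
by rewrite mulVg perm_mx1 mul1mx bary_mul.
Qed.

Lemma in_simplex_reorder x : in_simplex P g x = in_simplex P f x.
Proof.
rewrite /in_simplex ptmx_reorder_unit; case: (boolP (_ \in _)) => //= fu.
apply/forallP/forallP => h i; last by rewrite bary_reorder.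
by rewrite -(permKV s i) -bary_reorder.
Qed.

Lemma upper_reorder H : ptmx P f \in unitmx -> upper P H g = upper P H f.
Proof.
move=> fu; apply: eq_forallb => j; congr (_ <= _).
rewrite /interp [RHS](reindex_inj (@perm_inj _ s)).
by apply: eq_bigr => i _; rewrite bary_reorder// fg.
Qed.

End reordering.

Lemma reordering_exists (f : 'I_d.+1 -> J) (A := [set f i | i : 'I_d.+1]%SET) :
  injective f -> #|A| = d.+1 /\ exists s : 'S_d.+1, forall i, @enum_set d.+1 A i = f (s i).
Proof.
move=> fI; have Ad : #|A| = d.+1 by rewrite card_imset// card_ord.
split => //.
have ex (i : 'I_d.+1) : {k | enum_set A i = f k}.
  by apply: cid; have /imsetP[k _ ->] := @mem_enum_set _ _ i Ad; exists k.
pose s i := sval (ex i).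
have sE i : enum_set A i = f (s i) by exact: (svalP (ex i)).
have sI : injective s.
  by move=> i k sik; apply: (enum_set_inj Ad); rewrite !sE sik.
by exists (perm sI) => i; rewrite permE.
Qed.

(** [e j = None] marks a point whose height is not random, namely the origin; such a point is
    exempt. *)
Definition generic_heights (T : eqType) (e : J -> option T) (H : J -> R) :=
  forall (A : {set J}) j, #|A| = d.+1 -> j \notin A -> e j != None ->
    ptmx P (@enum_set d.+1 A) \in unitmx -> H j != interp P H (@enum_set d.+1 A) (P j).

(** Existence is [exists_upper]. A second upper simplex over [x] would have all its vertices on the
    lifted facet of the first, against genericity. *)
Lemma upper_simplex_count (T : eqType) (e : J -> option T) H x :
  injective e -> in_general_position P x -> generic_heights e H ->
  (`[< hull P x >])%:R = \sum_(A : {set J} | #|A| == d.+1)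
     (in_simplex P (@enum_set d.+1 A) x && upper P H (@enum_set d.+1 A))%:R :> R.
Proof.
move=> eI gx gH; case: asboolP => hx; last first.
  rewrite big1// => A _; case: andP => // -[] /in_simplex_hull //.
have [f fx] := caratheodory gx hx.
have [g gs gu] := exists_upper H gx fx.
have /andP[gU _] := gs.
have [Ad [s sE]] := reordering_exists (ptmx_inj gU).
set A := [set g i | i : 'I_d.+1]%SET in Ad sE *.
have As : in_simplex P (@enum_set d.+1 A) x by rewrite (in_simplex_reorder sE).
have Au : upper P H (@enum_set d.+1 A) by rewrite (upper_reorder sE).
rewrite (bigD1 A) ?Ad//= As Au big1 ?addr0// => B /andP[/eqP Bd BA].
case: andP => // -[Bs Bu]; exfalso.
have bad (C D : {set J}) a : #|C| = d.+1 -> #|D| = d.+1 -> a \in C -> a \notin D -> e a != None ->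
    in_simplex P (@enum_set d.+1 C) x -> in_simplex P (@enum_set d.+1 D) x ->
    upper P H (@enum_set d.+1 C) -> upper P H (@enum_set d.+1 D) -> False.
  move=> Cd Dd aC aD ea Cs Ds Cu Du; have /andP[DU _] := Ds.
  have := gH D a Dd aD ea DU; have [i ->] := enum_set_surj Cd aC.
  by rewrite -(upper_equal i gx Cs Ds Cu Du) eqxx.
have notsub (C D : {set J}) : #|C| = d.+1 -> #|D| = d.+1 -> C != D -> exists2 a, a \in C & a \notin D.
  move=> Cd Dd CD; apply/subsetPn; apply: contra CD => CD.
  by rewrite eqEcard CD Cd Dd leqnn.
(* Both sets have [d+1] elements, so each has a vertex outside the other. As [e] is injective, at
   most one of [a] and [b] has no random height, and the other one gives the contradiction. *)
have [a aB aA] := notsub _ _ Bd Ad BA.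
have [b bA bB] := notsub _ _ Ad Bd (contraNneq (fun h => introT eqP (esym h)) BA).
have [ea|ea] := eqVneq (e a) None; last exact: (bad B A a).
have [eb|eb] := eqVneq (e b) None; last exact: (bad A B b).
by move: aA; rewrite (eI a b) ?bA// ea eb.
Qed.

End set_enumeration.

(** * The volume of a simplex *)

Section simplex_volume.
Context {R : realType}.
Local Notation mu := (@lebesgue_measure R).
Local Open Scope ereal_scope.

Lemma lint_exists0 (I : eqType) (s : seq I) (K : finType) (b : K -> (I -> R) -> bool) :
  (forall k, measurable_fun [set: vec R I] (b k)) ->
  (forall k, lint s (fun w => (b k w)%:R%:E) = 0 :> \bar R) ->
  lint s (fun w => [exists k, b k w]%:R%:E) = 0 :> \bar R.
Proof.
move=> mb b0; apply/eqP; rewrite eq_le lint_ge0 ?andbT => [|w]; last by rewrite lee_fin.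
apply: (@le_trans _ _ (lint s (fun w => \sum_k (b k w)%:R%:E))); last first.
  rewrite lint_sum => [|k w|k]; last exact: measurable_boolE.
    by rewrite big1.
  by rewrite lee_fin.
apply: le_lint => [w|w]; first by rewrite lee_fin.
rewrite sumEFin lee_fin; case: existsP => [[k bk]|_]; last by rewrite sumr_ge0.
by rewrite (bigD1 k)//= bk lerDl sumr_ge0.
Qed.

Variables (d : nat) (J : finType) (P : J -> 'I_d -> R).

Lemma measurable_extrow dX (X : measurableType dX) (f : X -> vec R 'I_d) k :
  measurable_fun [set: X] f -> measurable_fun [set: X] (fun x => extrow (f x) 0%R k).
Proof.
move=> mf; rewrite (_ : (fun _ => _) = (fun x => if unlift ord0 k is Some c then f x c else 1%R)).
  by case: unlift => [c|//]; exact: measurable_coord_comp.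
by apply/funext => x; rewrite mxE.
Qed.

Lemma measurable_rowmul n (M : 'M[R]_(d.+1, n)) dX (X : measurableType dX) (f : X -> vec R 'I_d) i :
  measurable_fun [set: X] f -> measurable_fun [set: X] (fun x => (extrow (f x) *m M)%R 0%R i).
Proof.
move=> mf; rewrite (_ : (fun _ => _) = (fun x => \sum_k extrow (f x) 0 k * M k i)%R).
  apply: measurable_sumr => k _; apply: measurable_funM => //.
  exact: measurable_extrow.
by apply/funext => x; rewrite mxE.
Qed.

Lemma measurable_in_simplex (f : 'I_d.+1 -> J) dX (X : measurableType dX) (g : X -> vec R 'I_d) :
  measurable_fun [set: X] g -> measurable_fun [set: X] (fun x => in_simplex P f (g x)).
Proof.
move=> mg; apply: measurable_and => //; apply: measurable_forall => i.
by apply: measurable_fun_ler => //; exact: measurable_rowmul.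
Qed.

(* Integrating [exp (- z_0)] over the cone spanned by the simplex at height 1
   gives [|det|] in the coordinates of the spanning vectors, and [d! * volume]
   by slicing. *)
Lemma simplex_volume (f : 'I_d.+1 -> J) :
  lint (enum 'I_d) (fun x => (in_simplex P f x)%:R%:E) =
  (`|\det (ptmx P f)| / d`!%:R)%:E.
Proof.
pose M := ptmx P f.
have [M0|M0] := eqVneq (\det M) 0%R.
  rewrite -/M M0 normr0 mul0r -[RHS](lint0 (enum 'I_d)); apply: eq_lint => x.
  by rewrite /in_simplex unitmxE -/M M0 unitr0.
have Mu : M \in unitmx by rewrite unitmxE unitfE.
pose rowz (z : 'I_d.+1 -> R) : 'rV[R]_d.+1 := \row_k z k.
pose K z := [forall i, (0 <= (rowz z *m invmx M) 0%R i)%R].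
pose F (z : 'I_d.+1 -> R) : \bar R := ((K z)%:R * expR (- z ord0))%:E.
have F0 z : 0 <= F z by rewrite lee_fin mulr_ge0 ?expR_ge0.
have mK : measurable_fun [set: vec R 'I_d.+1] K.
  apply: measurable_forall => i; apply: measurable_fun_ler => //.
  rewrite (_ : (fun _ => _) = (fun z => \sum_k z k * invmx M k i)%R).
    by apply: measurable_sumr => k _; apply: measurable_funM => //; exact: measurable_coord.
  by apply/funext => z; rewrite mxE; apply: eq_bigr => k _; rewrite mxE.
have mF : measurable_fun [set: vec R 'I_d.+1] F.
  apply/measurable_EFinP; apply: measurable_funM; first exact: measurable_boolR.
  apply: measurableT_comp => //; apply: measurable_funN.
  exact: measurable_coord.
have FT : lint (enum 'I_d.+1) F = `|\det M|%:E.
  have dT : (\det M^T != 0)%R by rewrite det_tr.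
  have := lint_linear dT F0 mF.
  rewrite det_tr => e.
  (* In the coordinates of the spanning vectors the cone is the positive orthant and [z_0] is the
     sum of the coordinates, so the integral splits into [d+1] exponential integrals. *)
  have : lint (enum 'I_d.+1) (fun w => F (mxact M^T w)) = 1.
    pose g (l : R) : R := ((0 <= l)%R%:R * expR (- l))%R.
    have gi : \int[mu]_x (g x)%:E = 1.
      rewrite -[RHS]/(1%:E) -expR0 -[X in expR X]oppr0 -integral_expR_tail.
      rewrite integral_itv_obnd_cbnd; last first.
        by apply/measurable_EFinP/measurable_funTS; apply: measurableT_comp.
      rewrite [RHS](integral_indicE (b := fun x => (0 <= x)%R)) => [|x]; last first.
        by rewrite /= in_itv /= andbT.
      by apply: eq_integral => x _; rewrite -EFinM.
    transitivity (lint (enum 'I_d.+1) (fun l => (\prod_(i <- enum 'I_d.+1) g (l i))%:E)).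
      apply: eq_lint => l; congr EFin.
      have rl : rowz (mxact M^T l) = \row_k l k *m M.
        apply/rowP => k; rewrite !mxE /mxact; apply: eq_bigr => i _.
        by rewrite !mxE mulrC.
      rewrite big_split /=; congr (_ * _)%R.
        rewrite prod_boolR /K rl mulmxK//; congr (nat_of_bool _)%:R.
        apply/forallP/allP => h i; last by rewrite mxE h// mem_enum.
        by move=> _; have := h i; rewrite mxE.
      have -> : mxact M^T l ord0 = (\sum_i l i)%R.
        by apply: eq_bigr => i _; rewrite mxE ptmx0 mul1r.
      by rewrite -sumrN expR_sum big_enum.
    rewrite (@lint_prod _ _ _ (fun=> g)) ?enum_uniq//.
    - by rewrite big1.
    - by move=> i x; rewrite mulr_ge0 ?expR_ge0.
    - move=> i; apply: measurable_funM.
        by apply: measurable_boolR; apply: measurable_fun_ler.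
      by apply: measurableT_comp => //; exact: measurable_funN.
  rewrite e => /(congr1 (fun u => `|\det M|%:E * u)); rewrite mule1 muleA -EFinM.
  by rewrite mulfV ?mul1e// normr_eq0.
pose V := lint (enum 'I_d) (fun x => (in_simplex P f x)%:R%:E : \bar R).
suff FV : lint (enum 'I_d.+1) F = (d`!%:R)%:E * V.
  have fd0 : (d`!%:R != 0 :> R)%R by rewrite pnatr_eq0 -lt0n fact_gt0.
  rewrite -/V mulrC EFinM -FT FV muleA -EFinM mulVf// mul1e//.
have -> : lint (enum 'I_d.+1) F = \int[mu]_x lint [seq lift ord0 i | i <- enum 'I_d] (fun w => F (upd w ord0 x)).
  by rewrite enum_ordSl.
have mg : measurable_fun [set: R] (fun x : R => lint [seq lift ord0 i | i <- enum 'I_d] (fun w => F (upd w ord0 x))).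
  exact: measurable_lint_upd.
pose coneF x (v : 'I_d -> R) k := if unlift ord0 k is Some c then v c else x.
have gE x : lint [seq lift ord0 i | i <- enum 'I_d] (fun w => F (upd w ord0 x)) =
    lint (enum 'I_d) (fun v => F (coneF x v)).
  rewrite -(lint_map _ (fun v => F (coneF x v)) (@lift_inj _ ord0)).
  apply: eq_lint => w; congr F; apply/funext => k; rewrite /coneF.
  by case: unliftP => [c ->|->]; rewrite ?updE ?upd_neq// eq_sym neq_lift.
have K0 z : K z -> (0 <= z ord0)%R.
  move=> /forallP Kz; have : rowz z = (rowz z *m invmx M) *m M by rewrite mulmxKV.
  move=> /rowP/(_ ord0); rewrite mxE => ->; rewrite mxE sumr_ge0// => i _.
  by rewrite ptmx0 mulr1.
have conel x v : coneF x v ord0 = x by rewrite /coneF unlift_none.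
pose g x := lint [seq lift ord0 i | i <- enum 'I_d] (fun w => F (upd w ord0 x)).
transitivity (\int[mu]_(x in `[0%R, +oo[) g x).
  rewrite [RHS](integral_indicE (b := fun x => (0 <= x)%R)) => [|x]; last first.
    by rewrite /= in_itv /= andbT.
  apply: eq_integral => x _; have [x0|x0] := leP 0%R x; first by rewrite mul1e.
  rewrite mul0e gE -[RHS](lint0 (enum 'I_d)); apply: eq_lint => v.
  rewrite /F; case: (boolP (K _)) => [/K0|_]; last by rewrite mul0r.
  by rewrite conel leNgt x0.
rewrite -integral_itv_obnd_cbnd; last exact: measurable_funTS.
(* The slice of the cone at height [x] is [x] times the simplex, which contributes [x^d]. *)
transitivity (\int[mu]_(x in `]0%R, +oo[) ((x `^ (d.+1%:R - 1) * expR (- x))%:E * V)).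
  apply: eq_integral => x; rewrite inE /= in_itv /= andbT => x0.
  rewrite /g gE.
  have x1 : (x^-1 != 0)%R by rewrite invr_eq0 gt_eqF.
  have := @lint_scale _ _ (enum 'I_d) _ (fun x => (in_simplex P f x)%:R%:E : \bar R) x1.
  rewrite -/V size_enum_ord => e.
  transitivity ((expR (- x))%:E * lint (enum 'I_d) (fun w => (in_simplex P f (fun i => x^-1 * w i)%R)%:R%:E)).
    rewrite -lint_Zl//; first last.
    - by apply: measurable_boolE; apply: measurable_in_simplex; apply: measurable_vec => i;
        apply: measurable_funM => //; exact: measurable_coord.
    apply: eq_lint => v; rewrite /F conel -EFinM mulrC; congr (_ * _%:R)%:E.
    congr nat_of_bool; rewrite /in_simplex Mu /=; apply: eq_forallb => i.
    have -> : rowz (coneF x v) = x *: extrow (fun i => x^-1 * v i)%R.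
      apply/rowP => k; rewrite !mxE /coneF; case: unliftP => [c _|_]; rewrite ?mulr1//.
      by rewrite mulVKf// gt_eqF.
    by rewrite -scalemxAl mxE pmulr_rge0.
  rewrite e//; first last.
  - by apply: measurable_boolE; exact: measurable_in_simplex.
  rewrite muleA -EFinM; congr (_ %:E * _).
  rewrite mulrC; congr (_ * _)%R.
  by rewrite -natr1 addrK powR_mulrn ?ltW// ger0_norm ?invr_ge0 ?ltW// exprVn invrK.
rewrite ge0_integralZr//; first last.
- by rewrite lint_ge0// => w; rewrite lee_fin.
- by move=> x _; rewrite lee_fin mulr_ge0 ?powR_ge0 ?expR_ge0.
- apply/measurable_EFinP/measurable_funTS; apply: measurable_funM; first exact: measurable_powR.
  by apply: measurableT_comp => //; exact: measurable_funN.
by rewrite -[X in X * _]/(eGamma d.+1%:R) eGamma_nat.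
Qed.

End simplex_volume.

Lemma measurable_sume d (X : measurableType d) (R : realType) (K : Type) (r : seq K) (P : pred K)
    (f : K -> X -> \bar R) : (forall k, measurable_fun [set: X] (f k)) ->
  measurable_fun [set: X] (fun x => (\sum_(k <- r | P k) f k x)%E).
Proof.
move=> mf; rewrite (_ : (fun _ => _) = (fun x => (\sum_(k <- [seq k <- r | P k]) f k x)%E)).
  exact: emeasurable_sum.
by apply/funext => x; rewrite big_filter.
Qed.

(** * The volume of a hull as a sum over upper simplices *)

Section volume_expansion.
Context {R : realType}.
Local Notation mu := (@lebesgue_measure R).
Local Open Scope ereal_scope.
Variables (d : nat) (J : finType) (j0 : J) (P : J -> 'I_d -> R).

Lemma hyperplane_null (v : 'cV[R]_d.+1) : (exists c, v (lift ord0 c) 0%R != 0%R) ->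
  lint (enum 'I_d) (fun x => ((extrow x *m v)%R 0%R 0%R == 0%R)%:R%:E) = 0.
Proof.
move=> [c vc].
pose g (x : 'I_d -> R) := (v ord0 0 + \sum_(c' | c' != c) x c' * v (lift ord0 c') 0)%R.
have mg : measurable_fun [set: vec R 'I_d] g.
  apply: measurable_funD => //; apply: measurable_sumr => c' _.
  by apply: measurable_funM => //; exact: measurable_coord.
have gu w x : g (upd w c x) = g w.
  by congr (_ + _)%R; apply: eq_bigr => c' cc'; rewrite upd_neq.
rewrite -[RHS](lint_null_graph (mem_enum _ c) (enum_uniq _) vc mg gu).
apply: eq_lint => x; congr (nat_of_bool (_ == _))%:R%:E.
rewrite mxE big_ord_recl extrow0 mul1r (bigD1 c)//= extrowS /g addrCA mulrC.
by congr (_ + (_ + _))%R; apply: eq_bigr => c' _; rewrite extrowS.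
Qed.

(** A set of points that does not span lies in a hyperplane, given by a vector [v B] killed by its
    matrix. The empty set is kept apart: its span is zero and contains no [(1, x)]. *)
Lemma general_position_ae : exists N : ('I_d -> R) -> bool,
  [/\ measurable_fun [set: vec R 'I_d] N,
      lint (enum 'I_d) (fun x => (N x)%:R%:E) = 0 &
      forall x, ~~ N x -> in_general_position P x].
Proof.
pose bad (B : {set J}) := (B != finset.set0) && ~~ row_full (ptmx P (@enum_val _ (mem B))).
pose Q B (w : 'cV[R]_d.+1) := bad B -> ptmx P (@enum_val _ (mem B)) *m w = 0%R /\
  (exists c, w (lift ord0 c) 0%R != 0%R).
have exQ B : exists w, Q B w.
  rewrite /Q; case: (boolP (bad B)) => [|_]; last by exists 0%R.
  move=> /andP[/set0Pn[j jB]];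
  set M := ptmx P _ => Mf.
  have : cokermx M != 0%R.
    by apply: contra Mf => /eqP M0; rewrite -sub1mx submxE mul1mx M0.
  rewrite -(trmxK (cokermx M)) trmx_eq0 => /rowV0Pn[w].
  move=> /submxP[u ->] w0.
  exists (cokermx M *m u^T)%R => _; split; first by rewrite mulmxA mulmx_coker mul0mx.
  apply: contrapT => h.
  have e c : (cokermx M *m u^T)%R (lift ord0 c) 0%R = 0%R.
    by apply/eqP; apply: contraT => ec; case: h; exists c.
  (* Every row of [M] begins with [1], so a vector killed by [M] whose linear part vanishes is
     zero. *)
  have e0 : (cokermx M *m u^T)%R ord0 0%R = 0%R.
    have : (M *m (cokermx M *m u^T))%R (enum_rank_in jB j) 0%R = 0%R.
      by rewrite mulmxA mulmx_coker mul0mx mxE.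
    rewrite mxE big_ord_recl ptmx0 mul1r big1 ?addr0// => c _.
    by rewrite e mulr0.
  move: w0 => /negP; apply; rewrite -trmx_eq0 trmx_mul trmxK.
  apply/eqP/matrixP => k z; rewrite (ord1 z) [RHS]mxE.
  by case: (unliftP ord0 k) => [c ->|->].
have [v hv] := choice exQ.
exists (fun x => [exists B : {set J}, bad B && ((extrow x *m v B) 0 0 == 0)]%R).
split.
- apply: measurable_exists => B; apply: measurable_and => //.
  by apply: measurable_fun_eqr => //; exact: measurable_rowmul.
- apply: lint_exists0 => B.
    apply: measurable_and => //.
    by apply: measurable_fun_eqr => //; exact: measurable_rowmul.
  case: (boolP (bad B)) => [/hv[_ ]|_] /=; first exact: hyperplane_null.
  exact: lint0.
- move=> x /existsPn Nx B xB; apply: contraT => nf.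
  have [B0|B0] := eqVneq B finset.set0.
    move: xB => /submxP[u /rowP/(_ ord0)]; rewrite extrow0 mxE big1 => [/eqP|i _].
      by rewrite oner_eq0.
    have Bn y : y \in B -> False by rewrite B0 inE.
    by case: (Bn _ (enum_valP i)).
  have bB : bad B by rewrite /bad B0.
  have [vB _] := hv _ bB.
  move: xB => /submxP[u xu]; have := Nx B.
  by rewrite bB xu -mulmxA vB mulmx0 mxE eqxx.
Qed.

Variables (T : finType) (e : J -> option T).
Hypothesis eI : injective e.

Definition heights (h : T -> R) (j : J) : R := if e j is Some t then h t else 0%R.

Lemma measurable_heights dX (X : measurableType dX) (f : X -> vec R T) j :
  measurable_fun [set: X] f -> measurable_fun [set: X] (fun x => heights (f x) j).
Proof.
by move=> mf; rewrite /heights; case: (e j) => [t|//]; exact: measurable_coord_comp.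
Qed.

Lemma measurable_interp (f : 'I_d.+1 -> J) y dX (X : measurableType dX) (g : X -> vec R T) :
  measurable_fun [set: X] g -> measurable_fun [set: X] (fun x => interp P (heights (g x)) f y).
Proof.
move=> mg; apply: measurable_sumr => i _; apply: measurable_funM => //.
exact: measurable_heights.
Qed.

Lemma measurable_upper (f : 'I_d.+1 -> J) dX (X : measurableType dX) (g : X -> vec R T) :
  measurable_fun [set: X] g -> measurable_fun [set: X] (fun x => upper P (heights (g x)) f).
Proof.
move=> mg; apply: measurable_forall => j; apply: measurable_fun_ler.
  exact: measurable_heights.
exact: measurable_interp.
Qed.

(** The height of [j] is a variable on which the interpolation over [A] does not depend, because [j]
    is outside [A] and [e] is injective. *)
Lemma generic_heights_ae : exists N : (T -> R) -> bool,
  [/\ measurable_fun [set: vec R T] N,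
      lint (enum T) (fun h => (N h)%:R%:E) = 0 &
      forall h, ~~ N h -> generic_heights j0 P e (heights h)].
Proof.
pose fA (A : {set J}) := @enum_set _ j0 d.+1 A.
pose b (p : {set J} * J) h := [&& #|p.1| == d.+1, p.2 \notin p.1, e p.2 != None,
  ptmx P (fA p.1) \in unitmx & (heights h p.2 == interp P (heights h) (fA p.1) (P p.2))%R].
have mb p : measurable_fun [set: vec R T] (b p).
  do 4 apply: measurable_and => //.
  by apply: measurable_fun_eqr; [exact: measurable_heights|exact: measurable_interp].
exists (fun h => [exists p, b p h]); split.
- exact: measurable_exists.
- apply: lint_exists0 => // -[A j]; rewrite /b /=.
  have [|] := eqVneq #|A| d.+1 => /= Ad; last exact: lint0.
  have [|] := boolP (j \in A) => /= jA; first exact: lint0.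
  case ej : (e j) => [t|]; last exact: lint0.
  case: (_ \in _); last exact: lint0.
  pose g (h : T -> R) := (- interp P (heights h) (fA A) (P j))%R.
  have mg : measurable_fun [set: vec R T] g by apply: measurable_funN; exact: measurable_interp.
  have gu w x : g (upd w t x) = g w.
    congr (- _)%R; apply: eq_bigr => i _; congr (_ * _)%R; rewrite /heights.
    case eA : (e _) => [t'|//]; rewrite upd_neq//; apply: contraNneq jA => tt'.
    by rewrite -(eI (etrans eA (etrans (congr1 Some tt') (esym ej)))); exact: mem_enum_set.
  rewrite -[RHS](lint_null_graph (mem_enum _ t) (enum_uniq _) (oner_neq0 R) mg gu).
  by apply: eq_lint => h; rewrite mul1r subr_eq0 /heights ej.
- move=> h /existsPn Nh A j Ad jA ej fu.
  by have := Nh (A, j); rewrite /b /= Ad eqxx jA ej fu.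
Qed.

(** For almost every [x], and then almost all heights, the indicator of the hull is the number of
    upper simplices containing [x]. Averaging over the heights and integrating over [x] gives the
    formula. It holds for every [P], so no exceptional set of steps arises later. *)
Lemma vol_hull_expansion (Wt : (T -> R) -> R) :
  (forall h, 0 <= Wt h)%R -> measurable_fun [set: vec R T] Wt ->
  lint (enum T) (fun h => (Wt h)%:E) = 1 ->
  vol (hull P) = \sum_(A : {set J} | #|A| == d.+1)
    ((`|\det (ptmx P (@enum_set _ j0 d.+1 A))| / d`!%:R)%:E *
     lint (enum T) (fun h => (Wt h * (upper P (heights h) (@enum_set _ j0 d.+1 A))%:R)%:E)).
Proof.
move=> W0 mW W1; pose fA (A : {set J}) := @enum_set _ j0 d.+1 A.
pose U A := lint (enum T) (fun h => (Wt h * (upper P (heights h) (fA A))%:R)%:E).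
have U0 A : 0 <= U A by rewrite lint_ge0// => h; rewrite lee_fin mulr_ge0.
have mU A : measurable_fun [set: vec R T] (fun h => (Wt h * (upper P (heights h) (fA A))%:R)%:E).
  apply/measurable_EFinP; apply: measurable_funM => //.
  by apply: measurable_boolR; exact: measurable_upper.
have [Nx [mNx Nx0 gx]] := general_position_ae.
have [Nh [mNh Nh0 gh]] := generic_heights_ae.
have ms A : measurable_fun [set: vec R 'I_d] (fun x => (in_simplex P (fA A) x)%:R%:E : \bar R).
  by apply: measurable_boolE; exact: measurable_in_simplex.
pose G x := \sum_(A : {set J} | #|A| == d.+1) (U A * (in_simplex P (fA A) x)%:R%:E).
have G0 x : 0 <= G x by rewrite sume_ge0// => A _; rewrite mule_ge0// lee_fin.
transitivity (lint (enum 'I_d) G); last first.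
  rewrite /G lint_sum => [|A x|A]; first last.
  - exact: emeasurable_funM.
  - by rewrite mule_ge0// lee_fin.
  by apply: eq_bigr => A _; rewrite lint_Zl// simplex_volume muleC.
rewrite /vol; apply: (lint_sandwich (N := Nx)) => //.
- by apply: measurable_sume => A; exact: emeasurable_funM.
- exact: measurable_boolE.
move=> x /gx gpx.
have -> : (\1_(hull P) x : R)%R = (`[< hull P x >])%:R%R.
  by rewrite indicE; congr (nat_of_bool _)%:R; apply/idP/asboolP; rewrite inE.
set hx := `[< _ >].
transitivity (lint (enum T) (fun h => hx%:R%:E * (Wt h)%:E)).
  rewrite lint_Zl ?W1 ?mule1//; first exact/measurable_EFinP.
transitivity (lint (enum T) (fun h => \sum_(A : {set J} | #|A| == d.+1)
    (in_simplex P (fA A) x)%:R%:E * (Wt h * (upper P (heights h) (fA A))%:R)%:E)).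
  apply: (lint_sandwich (N := Nh)) => //.
  - by move=> h; rewrite mule_ge0// lee_fin.
  - by move=> h; rewrite sume_ge0// => A _; rewrite mule_ge0// lee_fin// mulr_ge0.
  - by apply: measurable_sume => A; exact: emeasurable_funM.
  - exact: measurable_boolE.
  move=> h /gh ggh.
  have := upper_simplex_count eI gpx ggh; rewrite -/hx => ->.
  rewrite -EFinM mulr_suml -sumEFin; apply: eq_bigr => A _.
  by rewrite -EFinM -mulnb natrM -mulrA [X in (_ * X)%R]mulrC.
rewrite lint_sum => [|A h|A]; first last.
- exact: emeasurable_funM.
- by rewrite mule_ge0// lee_fin// mulr_ge0.
apply: eq_bigr => A _; rewrite lint_Zl//; first by rewrite muleC.
by move=> h; rewrite lee_fin mulr_ge0.
Qed.

End volume_expansion.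

(** * The density of the lifted walks *)

Section lint_blocks.
Context {R : realType}.
Local Open Scope ereal_scope.

Lemma lint_flatten_prod (I L : eqType) (blk : L -> seq I) (F : L -> (I -> R) -> \bar R) (ls : seq L) :
  uniq ls -> (forall l k i, i \in blk l -> i \in blk k -> l = k) ->
  (forall l w, 0 <= F l w) -> (forall l, measurable_fun [set: vec R I] (F l)) ->
  (forall l w w', {in blk l, w =1 w'} -> F l w = F l w') ->
  lint (flatten [seq blk l | l <- ls]) (fun w => \prod_(l <- ls) F l w) =
  \prod_(l <- ls) lint (blk l) (F l).
Proof.
move=> uls bD F0 mF Fx; elim: ls uls => [|l ls IH] /=; first by rewrite !big_nil.
move=> /andP[lls uls]; rewrite big_cons -IH// lint_cat.
have P0 w : 0 <= \prod_(k <- ls) F k w by exact: prode_ge0.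
have mP : measurable_fun [set: vec R I] (fun w => \prod_(k <- ls) F k w).
  elim: (ls) => [|k ks IHk].
    by rewrite (_ : (fun _ => _) = cst 1)//; apply/funext => w; rewrite big_nil.
  rewrite (_ : (fun _ => _) = (fun w => F k w * \prod_(k <- ks) F k w)); last first.
    by apply/funext => w; rewrite big_cons.
  exact: emeasurable_funM.
set S := lint (flatten _) _; rewrite muleC.
have S0 : 0 <= S by exact: lint_ge0.
rewrite -(lint_Zl _ S0 (F0 l) (mF l)); apply: eq_lint => w.
rewrite muleC /S -(lint_Zl _ (F0 l w) P0 mP).
apply: eq_lint => v; rewrite big_cons; congr (_ * _).
  by apply: Fx => i il; rewrite /mrg il.
rewrite big_seq [RHS]big_seq; apply: eq_bigr => k kls.
apply: Fx => i ik; rewrite /mrg; case: ifP => // il.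
by move: lls; rewrite (bD _ _ _ il ik) kls.
Qed.

End lint_blocks.

(** * Factorization over the walks *)

Section walk_factorization.
Context {R : realType}.
Local Open Scope ereal_scope.
Variables (m : nat) (n : 'I_m -> nat).
Local Notation T := (PT n).
Local Notation pt i := (Tagged (fun l => 'I_(n l)) i).

(** One walk as a function on [nat], the index type of [walkW], with the value [0] out of range. *)
Definition wcoord (a : T -> R) (l : 'I_m) (j : nat) : R :=
  oapp (fun i : 'I_(n l) => a (pt i)) 0%R (insub j).

Definition prevpt (a : T -> R) (p : T) : R :=
  if nat_of_ord (tagged p) is j.+1 then wcoord a (tag p) j else 0%R.

Definition pinmask (B : {set T}) (l : 'I_m) : seq bool :=
  [seq pt i \in B | i <- enum 'I_(n l)].

Definition pinned (B : {set T}) (r : R) (y : T -> R) (p : T) : R :=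
  if p \in B then r else y p.

Lemma wcoordE a l (i : 'I_(n l)) : wcoord a l i = a (pt i).
Proof. by rewrite /wcoord valK. Qed.

Lemma size_pinmask B l : size (pinmask B l) = n l.
Proof. by rewrite size_map size_enum_ord. Qed.

Lemma nth_pinmask B l (i : 'I_(n l)) : nth false (pinmask B l) i = (pt i \in B).
Proof. by rewrite (nth_map i) ?size_enum_ord// nth_ord_enum. Qed.

Lemma enum_PT : perm_eq (enum {: T}) (flatten [seq [seq pt i | i <- enum 'I_(n l)] | l <- enum 'I_m]).
Proof.
apply: uniq_perm; first exact: enum_uniq.
  apply: allpairs_uniq_dep; first exact: enum_uniq.
    by move=> l _; exact: enum_uniq.
  by move=> [l i] [k j] _ _ /= e; exact: e.
move=> [l i]; rewrite mem_enum inE; apply/esym/flatten_mapP; exists l; first by rewrite mem_enum.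
by apply/mapP; exists i => //; rewrite mem_enum.
Qed.

Lemma measurable_wcoord dX (X : measurableType dX) (f : X -> vec R T) l j :
  measurable_fun [set: X] f -> measurable_fun [set: X] (fun x => wcoord (f x) l j).
Proof. by move=> mf; rewrite /wcoord; case: insub => //= i; exact: measurable_coord_comp. Qed.

Lemma measurable_prevpt dX (X : measurableType dX) (f : X -> vec R T) p :
  measurable_fun [set: X] f -> measurable_fun [set: X] (fun x => prevpt (f x) p).
Proof. by move=> mf; rewrite /prevpt; case: (nat_of_ord _) => // j; exact: measurable_wcoord. Qed.

Lemma measurable_pinned B dX (X : measurableType dX) (f : X -> vec R T) (r : X -> R) :
  measurable_fun [set: X] f -> measurable_fun [set: X] r ->
  measurable_fun [set: X] (fun x => pinned B (r x) (f x) : vec R T).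
Proof.
move=> mf mr; apply: measurable_vec => p; rewrite /pinned; case: (p \in B) => //.
exact: measurable_coord_comp.
Qed.

(** No increment joins two different walks, so the density is a product over walks, integrated over
    disjoint blocks of free coordinates. *)
Lemma lint_walks (c : R -> bool) r (B : {set T}) : measurable_fun [set: R] c -> c r ->
  lint [seq p <- enum {: T} | p \notin B] (fun y =>
    (\prod_(p : T) (phi (pinned B r y p - prevpt (pinned B r y) p) * (c (pinned B r y p))%:R))%:E) =
  \prod_(l < m) walkV c r (pinmask B l) 0%R.
Proof.
move=> mc cr.
pose blk l := [seq p <- [seq pt i | i <- enum 'I_(n l)] | p \notin B].
pose F (l : 'I_m) (y : T -> R) : \bar R := (walkW c r (pinmask B l) 0 (wcoord y l))%:E.
have mF l : measurable_fun [set: vec R T] (F l).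
  apply/measurable_EFinP.
  apply: (@measurable_precomp _ _ _ (vec R T) (vec R nat) _ (fun y => wcoord y l : vec R nat) (walkW c r (pinmask B l) 0)).
    exact: measurable_walkW.
  by apply: measurable_vec => j; exact: measurable_wcoord.
have F0 l y : 0 <= F l y by rewrite lee_fin walkW_ge0.
have wposE y l (i : 'I_(n l)) : wpos (pinmask B l) r (wcoord y l) i = pinned B r y (pt i).
  by rewrite /wpos nth_pinmask wcoordE.
have FE l y : F l y = (\prod_(i < n l) (phi (pinned B r y (pt i) - prevpt (pinned B r y) (pt i)) *
     (c (pinned B r y (pt i)))%:R))%:E.
  congr EFin; rewrite /walkW size_pinmask -{1}(subn0 (n l)) big_mkord.
  apply: eq_bigr => i _; rewrite wposE; congr (phi (_ - _) * _)%R.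
  rewrite /prevpt /wprev /=; case: i => -[//|j] jn /=.
  by rewrite -[j]/(nat_of_ord (Ordinal (ltnW jn))) wposE wcoordE.
have mpin : measurable_fun [set: vec R T] (fun y => pinned B r y : vec R T).
  exact: (@measurable_pinned B _ (vec R T) id (fun=> r)).
have mpinp p : measurable_fun [set: vec R T] (fun y => pinned B r y p).
  exact: (measurable_coord_comp p mpin).
have mcp p : measurable_fun [set: vec R T] (fun y => c (pinned B r y p)).
  exact: (measurable_precomp mc (mpinp p)).
rewrite (@lint_perm _ _ _ (flatten [seq blk l | l <- enum 'I_m])); first last.
- apply/measurable_EFinP; apply: measurable_prodr => p _; apply: measurable_funM.
    apply: measurable_phi; apply: measurable_funB => //.
    exact: (measurable_prevpt p mpin).
  by apply: measurable_boolR; exact: mcp.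
- by move=> y; rewrite lee_fin prodr_ge0// => p _; rewrite mulr_ge0 ?phi_ge0.
- rewrite (perm_trans (perm_filter _ enum_PT))// filter_flatten -map_comp.
  exact: perm_refl.
- by rewrite filter_uniq ?enum_uniq.
transitivity (lint (flatten [seq blk l | l <- enum 'I_m]) (fun y => \prod_(l <- enum 'I_m) F l y)).
  apply: eq_lint => y; rewrite big_enum /=.
  under [RHS]eq_bigr do rewrite FE.
  rewrite prodEFin; congr EFin.
  by rewrite (sig_big_dep (fun=> true) (fun _ _ => true) (fun l i => phi (pinned B r y (pt i) - prevpt (pinned B r y) (pt i)) * (c (pinned B r y (pt i)))%:R)%R) /=; apply: eq_bigr => -[].
rewrite lint_flatten_prod ?enum_uniq//; first last.
- move=> l w w' ww'; rewrite !FE; congr EFin.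
  have pin p : tag p = l -> pinned B r w p = pinned B r w' p.
    case: p => k i /= kl; subst k; rewrite /pinned; case: ifPn => // iB; apply: ww'.
    by rewrite mem_filter iB; apply/mapP; exists i => //; rewrite mem_enum.
  apply: eq_bigr => i _; rewrite !(pin (pt i))//; congr (phi (_ - _) * _)%R.
  rewrite /prevpt /=; case: (nat_of_ord i) => // j; rewrite /wcoord.
  by case: insub => //= i'; rewrite pin.
- move=> l k p; rewrite !mem_filter => /andP[_ /mapP[i _ ->]] /andP[_ /mapP[j _ e]].
  by have := congr1 tag e.
rewrite big_enum /=; apply: eq_bigr => l _.
rewrite -lint_walkW//.
pose s := [seq i <- enum 'I_(n l) | pt i \notin B].
have blkE : blk l = [seq pt i | i <- s] by rewrite /blk filter_map.
have unE : unpinned (pinmask B l) = [seq val i | i <- s].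
  rewrite /unpinned size_pinmask -val_enum_ord filter_map; congr map.
  by apply: eq_filter => i /=; rewrite nth_pinmask.
pose G (v : 'I_(n l) -> R) : \bar R := (walkW c r (pinmask B l) 0 (fun j => oapp v 0%R (insub j)))%:E.
rewrite blkE unE.
transitivity (lint s G).
  rewrite -[RHS](lint_map (f := fun i : 'I_(n l) => pt i))//.
  by move=> i j /eqP; rewrite -tag_eqE /tag_eq eqxx tagged_asE => /eqP.
rewrite -[LHS](lint_map (f := val)); last exact: val_inj.
apply: eq_lint_supp => u u0; congr EFin; congr (walkW _ _ _ _ _).
apply/funext => j; case: insubP => [i _ <- //|/= nj]; apply/esym/u0.
by apply/mapP => -[i _ ji]; move: nj; rewrite ji ltn_ord.
Qed.

End walk_factorization.

Section walk_sums.
Context {R : realType}.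
Variables (m : nat) (n : 'I_m -> nat).
Local Notation T := (PT n).
Local Notation pt i := (Tagged (fun l => 'I_(n l)) i).

Definition wsum (a : T -> R) (p : T) : R :=
  \sum_(t : T | (tag t == tag p) && ((tagged t : nat) <= tagged p)%N) a t.

Lemma eq_PT (p q : T) : tag p = tag q -> (tagged p : nat) = tagged q -> p = q.
Proof.
by case: p q => l i [k j] /= lk; subst k => /val_inj ->.
Qed.

Lemma wsum_prevpt a p : wsum a p - prevpt (wsum a) p = a p.
Proof.
rewrite /wsum (bigD1 p) ?eqxx ?leqnn//= -addrA -[RHS]addr0; congr (_ + _).
apply/eqP; rewrite subr_eq0; apply/eqP; case: p => l [[|j] jn] /=.
  rewrite /prevpt /= big_pred0// => t; apply/negbTE; rewrite negb_and negbK.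
  case: (eqVneq (tag t) l) => //= tl; case: leqP => //= t0; apply/eqP.
  by apply: eq_PT => //=; apply/eqP; rewrite -leqn0.
rewrite /prevpt /= -[X in wcoord _ _ X]/(nat_of_ord (Ordinal (ltnW jn))) wcoordE.
apply: eq_bigl => t /=; case: (eqVneq (tag t) l) => //= tl.
rewrite leq_eqVlt; have [tj|tj] /= := eqVneq.
  rewrite tj ltnn; apply/negbTE; rewrite negbK; apply/eqP; exact: eq_PT.
rewrite ltnS andb_idr// => _; apply: contraNneq tj => ->; exact: eqxx.
Qed.

Lemma prevpt_inj (a b : T -> R) : (forall p, a p - prevpt a p = b p - prevpt b p) -> a =1 b.
Proof.
move=> ab [l [i im]]; elim: i im => [|i IH] im; have := ab (pt (Ordinal im)).
  by rewrite /prevpt /= !subr0.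
have wE (c : T -> R) : wcoord c l i = c (pt (Ordinal (ltnW im))) by rewrite -wcoordE.
by rewrite /prevpt /= !wE IH => /addIr.
Qed.

Lemma wsum_diff a p : wsum (fun t => a t - prevpt a t) p = a p.
Proof. by apply: prevpt_inj => q; rewrite wsum_prevpt. Qed.

Lemma prevptD (a b : T -> R) p : prevpt (fun t => a t + b t) p = prevpt a p + prevpt b p :> R.
Proof.
rewrite /prevpt; case: (nat_of_ord _) => [|j]; first by rewrite addr0.
by rewrite /wcoord; case: insub => /=; rewrite ?addr0.
Qed.

Lemma prevptZ x (a : T -> R) p : prevpt (fun t => x * a t) p = x * prevpt a p :> R.
Proof.
rewrite /prevpt; case: (nat_of_ord _) => [|j]; first by rewrite mulr0.
by rewrite /wcoord; case: insub => /=; rewrite ?mulr0.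
Qed.

(** Joint density of the heights when they form independent Gaussian walks with the same step
    numbers as the given ones. *)
Definition step_density (h : T -> R) : R := \prod_(p : T) phi (h p - prevpt h p).

Lemma step_density_ge0 h : 0 <= step_density h.
Proof. by rewrite prodr_ge0// => p _; exact: phi_ge0. Qed.

Lemma measurable_step_density : measurable_fun [set: vec R T] step_density.
Proof.
apply: measurable_prodr => p _; apply: measurable_phi; apply: measurable_funB.
  exact: measurable_coord.
exact: (@measurable_prevpt _ _ _ _ (vec R T) id).
Qed.

Lemma lint_step_density : lint (enum {: T}) (fun h => (step_density h)%:E) = 1%E.
Proof.
have mT : measurable_fun [set: R] (fun=> true) by [].
have := @lint_walks R m n _ 0 finset.set0 mT isT.
have -> : [seq p <- enum {: T} | p \notin finset.set0] = enum {: T}.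
  by apply/all_filterP/allP => p _; rewrite inE.
have -> : (\prod_(l < m) walkV (fun=> true) 0 (pinmask (finset.set0 : {set T}) l) 0 = 1 :> \bar R)%E.
  rewrite big1// => l _; rewrite (_ : pinmask _ _ = nseq (n l) false) ?walkV_free_total//.
  apply: (@eq_from_nth _ false); rewrite size_pinmask ?size_nseq// => i il.
  by rewrite -[i]/(nat_of_ord (Ordinal il)) nth_pinmask inE nth_nseq if_same.
move=> <-; apply: eq_lint => h; congr EFin; apply: eq_bigr => p _.
have -> : pinned finset.set0 0 h = h by apply/funext => q; rewrite /pinned inE.
by rewrite mulr1.
Qed.

End walk_sums.

Section rank_one.
Context {R : comUnitRingType} (d : nat).

(** Both sides are the determinant of one block matrix, factored by eliminating either diagonal
    block. *)
Lemma det_rank_one (u : 'cV[R]_d) (v : 'rV[R]_d) : \det (1%:M - u *m v) = 1 - (v *m u) 0 0.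
Proof.
transitivity (\det (block_mx (1%:M : 'M[R]_1) v u 1%:M)).
  have -> : block_mx (1%:M : 'M[R]_1) v u 1%:M =
      block_mx 1%:M 0 u 1%:M *m block_mx 1%:M v 0 (1%:M - u *m v).
    by rewrite mulmx_block !mul1mx !mul0mx !mulmx1 ?mulmx0 !addr0 addrC subrK.
  by rewrite det_mulmx det_lblock det_ublock !det1 !mul1r.
have -> : block_mx (1%:M : 'M[R]_1) v u 1%:M =
    block_mx 1%:M v 0 1%:M *m block_mx (1%:M - v *m u) 0 u 1%:M.
  by rewrite mulmx_block !mul1mx ?mul0mx !mulmx1 ?mulmx0 ?add0r ?addr0 subrK.
by rewrite det_mulmx det_lblock det_ublock !det1 !mul1r mulr1 det_mx11 !mxE eqxx.
Qed.

End rank_one.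

(** * The linear change of the steps *)

Section gaussian_tilt.
Context {R : realType} (d : nat) (T : finType) (b : 'I_d -> R) (eta : T -> R).
Local Open Scope ereal_scope.
Local Notation s := (sigma b).

(* [L = 1 - b b^T / (s (s + 1))] is the inverse square root of [1 + b b^T]. *)
Definition tiltmx : 'M[R]_d := \matrix_(i, j) ((i == j)%:R - b i * b j / (s * (s + 1)))%R.

Lemma det_tiltmx : \det tiltmx = (s^-1)%R.
Proof.
have s0 := sigma_gt0 b; have s1 : (0 < s + 1)%R by rewrite addr_gt0.
have -> : tiltmx = (1%:M - (\col_i b i) *m (\row_j (b j / (s * (s + 1)))))%R.
  by apply/matrixP => i j; rewrite !mxE big_ord1 !mxE mulrA.
rewrite det_rank_one mxE.
have -> : (\sum_j (\row_j0 (b j0 / (s * (s + 1)))) 0 j * (\col_i b i) j 0 =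
   (s ^+ 2 - 1) / (s * (s + 1)))%R.
  rewrite sigma2 [(1 + _)%R]addrC addrK mulr_suml; apply: eq_bigr => j _.
  by rewrite !mxE mulrAC expr2.
by field; rewrite !gt_eqF.
Qed.

(** A step with density proportional to [phi(w) * phi(eta + <b, w>)] is Gaussian with mean
    [- b * eta / s^2] and covariance [(1 + b b^T)^-1]; this map produces it from a standard Gaussian
    step. *)
Definition tilt (z : T * 'I_d -> R) (p : T * 'I_d) : R :=
  (\sum_j tiltmx p.2 j * z (p.1, j) - b p.2 * eta p.1 / s ^+ 2)%R.

Lemma measurable_tilt : measurable_fun [set: vec R (T * 'I_d)%type]
  (fun z => tilt z : vec R (T * 'I_d)%type).
Proof.
apply: measurable_vec => p; apply: measurable_funB => //.
apply: measurable_sumr => j _; apply: measurable_funM => //; exact: measurable_coord.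
Qed.

Let blk (t : T) : seq (T * 'I_d) := [seq (t, c) | c <- enum 'I_d].
Let blks (ts : seq T) := flatten [seq blk t | t <- ts].
Let tilt_on (ts : seq T) z p := if p.1 \in ts then tilt z p else z p.

Let mem_blk t p : (p \in blk t) = (p.1 == t).
Proof.
apply/mapP/eqP => [[c _ -> //]|pt]; exists p.2; first by rewrite mem_enum.
by rewrite -pt; case: p {pt}.
Qed.

Let lint_tilt_on ts F : uniq ts -> (forall w, 0 <= F w) -> measurable_fun [set: vec R (T * 'I_d)%type] F ->
  lint (blks ts) (fun z => F (tilt_on ts z)) = (s ^+ size ts)%:E * lint (blks ts) F.
Proof.
have s0 := sigma_gt0 b.
elim: ts F => [|t ts IH] F /=; first by move=> _ _ _; rewrite expr0 mul1e.
move=> /andP[tts uts] F0 mF; rewrite /blks /= -/(blks ts) !lint_cat.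
pose Phi (w : T * 'I_d -> R) := lint (blks ts) (fun v => F (mrg (blk t) w v)).
have Phi0 w : 0 <= Phi w by exact: lint_ge0.
have mPhi : measurable_fun [set: vec R (T * 'I_d)%type] Phi.
  apply: measurable_lint => //; apply: (measurable_precomp mF).
  exact: measurable_mrg.
transitivity (lint (blk t) (fun w => (s ^+ size ts)%:E * Phi (tilt w))).
  apply: eq_lint => w; rewrite -IH//; first last.
    apply: (measurable_precomp mF); exact: (@measurable_mrg _ _ _ _ (vec R (T * 'I_d)%type) (fun=> tilt w) id).
  apply: eq_lint => v; congr F; apply/funext => p; rewrite /tilt_on /mrg in_cons !mem_blk.
  have [pt|pt] /= := eqVneq p.1 t.
    rewrite /tilt; congr (_ - _)%R; apply: eq_bigr => j _; congr (_ * _)%R.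
    by rewrite mem_blk /= pt eqxx.
  case: ifP => // _; rewrite /tilt; congr (_ - _)%R; apply: eq_bigr => j _; congr (_ * _)%R.
  by rewrite mem_blk /= (negbTE pt).
rewrite lint_Zl//; first last.
- exact: (measurable_precomp mPhi measurable_tilt).
- by rewrite lee_fin exprn_ge0// ltW.
rewrite exprSr EFinM -muleA; congr (_ * _).
pose G u := Phi (fun p => u p.2).
have mG : measurable_fun [set: vec R 'I_d] G.
  apply: (measurable_precomp mPhi); apply: measurable_vec => p; exact: measurable_coord.
have PhiE w : Phi w = G (w \o pair t).
  apply: eq_lint => v; congr F; apply/funext => p; rewrite /mrg mem_blk.
  by case: eqP => // pt; rewrite /comp -pt; case: p {pt}.
have inj : injective (pair t : 'I_d -> _) by move=> i j [].
transitivity (s%:E * lint (enum 'I_d) G); last first.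
  by congr (_ * _); rewrite -(lint_map _ G inj); apply: eq_lint => w; rewrite -PhiE.
pose c (i : 'I_d) := (- (b i * eta t / s ^+ 2))%R.
pose Gc u := G (fun i => u i + c i)%R.
have Gc0 u : 0 <= Gc u by exact: Phi0.
have mGc : measurable_fun [set: vec R 'I_d] Gc.
  apply: (measurable_precomp mG); apply: measurable_vec => i.
  by apply: measurable_funD => //; exact: measurable_coord.
have dL : (\det tiltmx != 0)%R by rewrite det_tiltmx invr_eq0 gt_eqF.
transitivity (lint (enum 'I_d) (fun u => Gc (mxact tiltmx u))).
  by rewrite -(lint_map _ _ inj); apply: eq_lint => w; rewrite PhiE.
rewrite lint_linear// det_tiltmx ger0_norm ?invr_ge0 ?ltW// invrK; congr (_ * _).
rewrite -[RHS](lint_shift (enum 'I_d) c)//; last by move=> u; exact: Phi0.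
by apply: eq_lint => u; congr G; apply/funext => i; rewrite mem_enum.
Qed.

(** Each step contributes the Jacobian factor [1 / \det tiltmx = s]; translations have no effect. *)
Lemma lint_tilt F : (forall w, 0 <= F w) -> measurable_fun [set: vec R (T * 'I_d)%type] F ->
  lint (enum {: T * 'I_d}) (fun z => F (tilt z)) = (s ^+ #|T|)%:E * lint (enum {: T * 'I_d}) F.
Proof.
move=> F0 mF.
have mFt : measurable_fun [set: vec R (T * 'I_d)%type] (fun z => F (tilt z)).
  exact: (measurable_precomp mF measurable_tilt).
have pe : perm_eq (enum {: T * 'I_d}) (blks (enum T)).
  apply: uniq_perm; first exact: enum_uniq.
    by apply: allpairs_uniq; [exact: enum_uniq|exact: enum_uniq|move=> [x y] [x' y'] _ _ /= ->].
  move=> p; rewrite mem_enum inE; apply/esym/flatten_mapP; exists p.1; first by rewrite mem_enum.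
  by rewrite mem_blk.
rewrite !(lint_perm (enum_uniq _) pe)// cardE -lint_tilt_on ?enum_uniq//.
by apply: eq_lint => z; congr F; apply/funext => p; rewrite /tilt_on mem_enum.
Qed.

Lemma tilt_density z t : ((\prod_c phi (tilt z (t, c))) * phi (eta t + \sum_c b c * tilt z (t, c)) =
  (\prod_c phi (z (t, c))) * phi (eta t / s))%R.
Proof.
have s0 := sigma_gt0 b; have s1 : (0 < s + 1)%R by rewrite addr_gt0.
(* [tilt] subtracts a multiple of [b] from each step: [z - x * b]. The claim becomes a rational
   identity in [q = <b, z>], [s], [eta t] and the sum of squares. *)
pose q := (\sum_c b c * z (t, c))%R; pose x := (q / (s * (s + 1)) + eta t / s ^+ 2)%R.
have tE c : tilt z (t, c) = (z (t, c) - b c * x)%R.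
  rewrite /tilt /= (eq_bigr (fun j => (c == j)%:R * z (t, j) - b c / (s * (s + 1)) * (b j * z (t, j)))%R); last first.
    by move=> j _; rewrite mxE; ring.
  rewrite sumrB -mulr_sumr -/q (bigD1 c)//= eqxx mul1r big1 ?addr0 => [|j jc].
    by rewrite /x; ring.
  by rewrite eq_sym (negbTE jc) mul0r.
have prodE (u : 'I_d -> R) : (\prod_c phi (u c) =
    (Num.sqrt (2 * pi))^-1 ^+ d * expR (- (\sum_c u c ^+ 2) / 2))%R.
  under eq_bigr do rewrite phiE.
  rewrite big_split /= prodr_const card_ord -expR_sum; congr (_ * expR _)%R.
  by rewrite -sumrN mulr_suml.
rewrite !prodE !phiE [LHS]mulrACA [RHS]mulrACA; congr (_ * _)%R.
rewrite -!expRD; congr expR.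
have -> : (\sum_c b c * tilt z (t, c) = q - (s ^+ 2 - 1) * x)%R.
  under eq_bigr do rewrite tE mulrBr.
  rewrite sumrB -/q; congr (_ - _)%R; rewrite sigma2 [(1 + _)%R]addrC addrK mulr_suml.
  by apply: eq_bigr => c _; ring.
have -> : (\sum_c tilt z (t, c) ^+ 2 = \sum_c z (t, c) ^+ 2 - 2 * x * q + (s ^+ 2 - 1) * x ^+ 2)%R.
  rewrite sigma2 [(1 + _)%R]addrC addrK mulr_suml /q mulr_sumr -sumrB -big_split /=.
  by apply: eq_bigr => c _; rewrite tE; ring.
rewrite /x; set S := (\sum_c _)%R; move: (eta t) => e.
by field; rewrite !gt_eqF.
Qed.

Lemma gauss_exp_tilt (Q : (T * 'I_d -> R) -> R) : (forall w, 0 <= Q w)%R ->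
  measurable_fun [set: vec R (T * 'I_d)%type] Q ->
  gauss_exp (fun w : T * 'I_d -> R => (Q w * \prod_t phi (eta t + \sum_c b c * w (t, c)))%:E) =
  (s ^- #|T| * \prod_t phi (eta t / s))%:E * gauss_exp (fun z : T * 'I_d -> R => (Q (tilt z))%:E).
Proof.
move=> Q0 mQ; have s0 := sigma_gt0 b.
rewrite /gauss_exp.
have mE : measurable_fun [set: vec R (T * 'I_d)%type]
    (fun w => (Q w * \prod_t phi (eta t + \sum_c b c * w (t, c)))%:E).
  apply/measurable_EFinP; apply: measurable_funM => //; apply: measurable_prodr => t _.
  apply: measurable_phi; apply: measurable_funD => //; apply: measurable_sumr => c _.
  by apply: measurable_funM => //; exact: measurable_coord.
have mQt : measurable_fun [set: vec R (T * 'I_d)%type] (fun z => (Q (tilt z))%:E).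
  by apply/measurable_EFinP; exact: (measurable_precomp mQ measurable_tilt).
have E0 w : 0 <= (Q w * \prod_t phi (eta t + \sum_c b c * w (t, c)))%:E :> \bar R.
  by rewrite lee_fin mulr_ge0// prodr_ge0// => t _; exact: phi_ge0.
rewrite gint_lint ?enum_uniq// [in RHS]gint_lint ?enum_uniq//; last first.
  by move=> z; rewrite lee_fin.
set A := lint _ _.
have sT : (0 < s ^+ #|T|)%R by rewrite exprn_gt0.
have -> : A = (s ^- #|T|)%:E * ((s ^+ #|T|)%:E * A).
  by rewrite muleA -EFinM mulVf ?mul1e// gt_eqF.
rewrite EFinM -muleA; congr (_ * _).
rewrite /A -lint_tilt; first last.
- by apply: emeasurable_funM => //; exact: measurable_gw0.
- by move=> w; rewrite mule_ge0// gw_ge0.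
rewrite -lint_Zl//; first last.
- by apply: emeasurable_funM => //; exact: measurable_gw0.
- by move=> w; rewrite mule_ge0 ?gw_ge0// lee_fin.
- by rewrite lee_fin prodr_ge0// => t _; exact: phi_ge0.
apply: eq_lint => z; rewrite /gw -!EFinM; congr EFin.
have prodE (u : T * 'I_d -> R) :
    (\prod_(p <- enum {: T * 'I_d}) phi (u p) = \prod_t \prod_c phi (u (t, c)))%R.
  by rewrite big_enum /= pair_bigA; apply: eq_bigr => -[].
rewrite !prodE.
rewrite [LHS]mulrCA [RHS]mulrA [RHS]mulrC; congr (_ * _)%R.
by rewrite mulrC -!big_split /=; apply: eq_bigr => t _; rewrite mulrC tilt_density mulrC.
Qed.

End gaussian_tilt.

Lemma measurable_fixl dX dY dZ (X : measurableType dX) (Y : measurableType dY) (Z : measurableType dZ)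
    (F : X -> Y -> Z) x : measurable_fun [set: X * Y] (fun z => F z.1 z.2) ->
  measurable_fun [set: Y] (F x).
Proof.
move=> mF; apply: (measurable_precomp (f := fun y : Y => (x, y)) mF).
exact: measurable_pair1.
Qed.

Lemma measurable_fixr dX dY dZ (X : measurableType dX) (Y : measurableType dY) (Z : measurableType dZ)
    (F : X -> Y -> Z) y : measurable_fun [set: X * Y] (fun z => F z.1 z.2) ->
  measurable_fun [set: X] (F^~ y).
Proof.
move=> mF; apply: (measurable_precomp (f := fun x : X => (x, y)) mF).
exact: measurable_pair2.
Qed.

Section gint_lint_swap.
Context {R : realType}.
Local Open Scope ereal_scope.

Lemma gint_lint_swap (I J : eqType) (s : seq I) (t : seq J) (F : (I -> R) -> (J -> R) -> \bar R) :
  uniq s -> (forall w v, 0 <= F w v) ->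
  measurable_fun [set: vec R I * vec R J] (fun z => F z.1 z.2) ->
  gint s (fun w => lint t (F w)) = lint t (fun v => gint s (F ^~ v)).
Proof.
move=> us F0 mF.
have mFw v : measurable_fun [set: vec R I] (F^~ v).
  exact: (@measurable_fixr _ _ _ (vec R I) (vec R J) _ F v mF).
have mFv w : measurable_fun [set: vec R J] (F w).
  exact: (@measurable_fixl _ _ _ (vec R I) (vec R J) _ F w mF).
rewrite gint_lint//; last 2 first.
- by move=> w; exact: lint_ge0.
- exact: measurable_lint.
transitivity (lint s (fun w => lint t (fun v => gw s w * F w v))).
  by apply: eq_lint => w; rewrite lint_Zl// gw_ge0.
rewrite lint_swap; first last.
- apply: emeasurable_funM => //; apply: measurable_gw; exact: measurable_fst.
- by move=> w v; rewrite mule_ge0// gw_ge0.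
by apply: eq_lint => v; rewrite gint_lint.
Qed.

Lemma measurable_det dX (X : measurableType dX) k (M : X -> 'M[R]_k) :
  (forall i j, measurable_fun [set: X] (fun x => M x i j)) ->
  measurable_fun [set: X] (fun x => \det (M x)).
Proof.
move=> mM; apply: measurable_sumr => s _; apply: measurable_funM => //.
by apply: measurable_prodr => i _.
Qed.

End gint_lint_swap.

(** * Trading heights for the affine function of a face *)

Section height_change.
Context {R : realType}.
Local Notation mu := (@lebesgue_measure R).
Local Open Scope ereal_scope.
Variables (m : nat) (n : 'I_m -> nat) (d : nat).
Local Notation T := (PT n).
Variables (t0 : T) (B : {set T}).

Definition free_pts : seq T := [seq p <- enum {: T} | p \notin B].

Lemma free_pts_uniq : uniq free_pts.
Proof. by rewrite filter_uniq ?enum_uniq. Qed.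

Lemma mem_free_pts p : (p \in free_pts) = (p \notin B).
Proof. by rewrite mem_filter mem_enum !inE andbT. Qed.

Lemma size_free_pts : (size free_pts + #|B|)%N = #|{: T}|.
Proof.
rewrite -(cardC B) addnC; congr (_ + _)%N; rewrite cardE; apply/perm_size/uniq_perm.
- exact: free_pts_uniq.
- exact: enum_uniq.
- by move=> p; rewrite mem_filter !mem_enum !inE andbT.
Qed.

Lemma walk_pt_wsum (w : T * 'I_d -> R) p c : walk_pt w p c = wsum (fun t => w (t, c)) p.
Proof. by []. Qed.

Lemma measurable_walk_pt dX (X : measurableType dX) (f : X -> vec R (T * 'I_d)%type) p c :
  measurable_fun [set: X] f -> measurable_fun [set: X] (fun x => walk_pt (f x) p c).
Proof. by move=> mf; apply: measurable_sumr => t _; exact: measurable_coord_comp. Qed.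

Definition increments (r : R) (y : T -> R) (p : T) : R :=
  (pinned B r y p - prevpt (pinned B r y) p)%R.

(** Heights as the linear function of slope [b] plus a residual. The residual is [r] on [B], so the
    affine function of the face is [r + <b, x>]. *)
Definition lifted (r : R) (b : 'I_d -> R) (y : T -> R) (w : T * 'I_d -> R) (p : T) : R :=
  (pinned B r y p + \sum_c b c * walk_pt w p c)%R.

Lemma step_density_lifted r b y w : (step_density (lifted r b y w) =
  \prod_t phi (increments r y t + \sum_c b c * w (t, c)))%R.
Proof.
apply: eq_bigr => p _; congr (phi _).
have lE : lifted r b y w = (fun p => pinned B r y p + wsum (fun t => \sum_c b c * w (t, c)) p)%R.
  apply/funext => q; congr (_ + _)%R; rewrite /wsum exchange_big /=.
  by apply: eq_bigr => c _; rewrite mulr_sumr.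
by rewrite lE prevptD opprD addrACA wsum_prevpt.
Qed.

Lemma walk_pt_tilt r (b : 'I_d -> R) y (z : T * 'I_d -> R) p c : p \in B ->
  (walk_pt (tilt b (increments r y) z) p c =
   \sum_j tiltmx b c j * walk_pt z p j - b c * r / sigma b ^+ 2)%R.
Proof.
move=> pB; rewrite walk_pt_wsum /wsum sumrB; congr (_ - _)%R.
  rewrite exchange_big /=; apply: eq_bigr => j _; by rewrite mulr_sumr.
rewrite /= -mulr_suml -mulr_sumr; congr (_ * _ / _)%R.
by have := wsum_diff (pinned B r y) p; rewrite /wsum => ->; rewrite /pinned pB.
Qed.

Variable k : nat.
Hypothesis Bk : #|B| = k.
Let b : 'I_k -> T := enum_set t0 B.

(** The heights over [B] are the linear image under [M] of the parameters of the face, and the other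
    heights are translated. [M], [alpha] and [beta] are left abstract in order to treat faces with
    and without the origin together. *)
Lemma lint_height_change (w : T * 'I_d -> R) (M : 'M[R]_k)
    (alpha : ('I_k -> R) -> R) (beta : ('I_k -> R) -> 'I_d -> R) (F : (T -> R) -> \bar R) :
  (forall g i, mxact M g i = alpha g + \sum_c beta g c * walk_pt w (b i) c)%R ->
  (\det M != 0)%R -> (forall h, 0 <= F h) -> measurable_fun [set: vec R T] F ->
  lint (enum {: T}) F = `|\det M|%:E *
    lint (enum 'I_k) (fun g => lint free_pts (fun y => F (lifted (alpha g) (beta g) y w))).
Proof.
move=> HM M0 F0 mF.
have mapb : [seq b i | i <- enum 'I_k] = enum B by exact: map_enum_set.
have bI : injective b by exact: enum_set_inj.
have bB i : b i \in B by exact: mem_enum_set.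
have pe : perm_eq (enum {: T}) ([seq b i | i <- enum 'I_k] ++ free_pts).
  rewrite mapb; apply: uniq_perm; first exact: enum_uniq.
    rewrite cat_uniq enum_uniq free_pts_uniq andbT; apply/hasPn => p.
    by rewrite mem_filter => /andP[pB _]; rewrite /= mem_enum.
  move=> p; rewrite mem_cat mem_free_pts [p \in enum B]mem_enum orbN; exact: mem_enum.
rewrite (lint_perm (enum_uniq _) pe)// lint_cat.
pose ins (g : 'I_k -> R) (v : T -> R) p : R := if [pick i | b i == p] is Some i then g i else v p.
pose Phi g := lint free_pts (fun v => F (ins g v)).
have mins dX (X : measurableType dX) (f : X -> vec R 'I_k) (g : X -> vec R T) :
    measurable_fun [set: X] f -> measurable_fun [set: X] g ->
    measurable_fun [set: X] (fun x => ins (f x) (g x) : vec R T).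
  move=> mf mg; apply: measurable_vec => p; rewrite /ins.
  by case: pickP => [i _|_]; exact: measurable_coord_comp.
have mPhi : measurable_fun [set: vec R 'I_k] Phi.
  apply: measurable_lint => //; apply: (measurable_precomp mF).
  by apply: mins; [exact: measurable_fst|exact: measurable_snd].
have insE g v i : ins g v (b i) = g i.
  rewrite /ins; case: pickP => [j /eqP /bI -> //|/(_ i)]; by rewrite eqxx.
have insN g v p : p \notin B -> ins g v p = v p.
  move=> pB; rewrite /ins; case: pickP => // i /eqP ip.
  by move: pB; rewrite -ip bB.
have insP g v p : p \in B -> exists2 i, p = b i & ins g v p = g i.
  by move=> /(enum_set_surj t0 Bk)[i ->]; exists i => //; exact: insE.
transitivity (lint (enum 'I_k) Phi).
  rewrite -(lint_map _ Phi bI); apply: eq_lint => u; apply: eq_lint => v.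
  congr F; apply/funext => p; rewrite /mrg mapb mem_enum; case: (boolP (p \in B)) => pB.
    by have [i -> ->] := insP (u \o b) v p pB.
  by rewrite insN.
have Phi0 g : 0 <= Phi g by exact: lint_ge0.
have := lint_linear M0 Phi0 mPhi.
move=> /(congr1 (fun x => `|\det M|%:E * x)); rewrite muleA -EFinM mulfV ?normr_eq0// mul1e => <-.
congr (_ * _); apply: eq_lint => g.
pose c p := (\sum_c beta g c * walk_pt w p c)%R.
have mF' : measurable_fun [set: vec R T] (fun v => F (ins (mxact M g) v)).
  by apply: (measurable_precomp mF); apply: mins => //; exact: measurable_id.
rewrite /Phi -(lint_shift free_pts c)//; apply: eq_lint => y; congr F; apply/funext => p.
case: (boolP (p \in B)) => pB.
  by have [i -> ->] := insP (mxact M g) (fun i => if i \in free_pts then (y i + c i)%R else y i) p pB; rewrite HM /lifted /pinned bB.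
by rewrite insN// mem_filter pB mem_enum /lifted /pinned (negbTE pB).
Qed.

Variable c0 : R -> bool.

(** The upper condition in terms of residuals; [c0] is the condition on the level that the origin
    imposes when it is present. *)
Definition under_cond (r : R) (y : T -> R) : bool :=
  c0 r && [forall p, pinned B r y p <= r]%R.

(** The factor [sigma^-2] comes from the squared determinant, divided by [sigma be] before squaring
    when [tilt] is applied; the rest is the constant of [gauss_exp_tilt]. *)
Definition tilted_density (r : R) (be : 'I_d -> R) (y : T -> R) : R :=
  (sigma be ^- #|{: T}| / sigma be ^+ 2 * \prod_t phi (increments r y t / sigma be) *
   (under_cond r y)%:R)%R.

Hypothesis c0m : measurable_fun [set: R] c0.

Lemma measurable_under_cond dX (X : measurableType dX) (r : X -> R) (y : X -> vec R T) :
  measurable_fun [set: X] r -> measurable_fun [set: X] y ->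
  measurable_fun [set: X] (fun x => under_cond (r x) (y x)).
Proof.
move=> mr my; apply: measurable_and; first exact: (measurable_precomp c0m mr).
apply: measurable_forall => p; apply: measurable_fun_ler => //.
exact: (measurable_coord_comp p (measurable_pinned B my mr)).
Qed.

Lemma measurable_increments dX (X : measurableType dX) (r : X -> R) (y : X -> vec R T) p :
  measurable_fun [set: X] r -> measurable_fun [set: X] y ->
  measurable_fun [set: X] (fun x => increments (r x) (y x) p).
Proof.
move=> mr my; apply: measurable_funB.
  exact: (measurable_coord_comp p (measurable_pinned B my mr)).
exact: (measurable_prevpt p (measurable_pinned B my mr)).
Qed.

Lemma measurable_tilted_density dX (X : measurableType dX) (r : X -> R) (be : X -> vec R 'I_d)
    (y : X -> vec R T) :
  measurable_fun [set: X] r -> measurable_fun [set: X] be -> measurable_fun [set: X] y ->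
  measurable_fun [set: X] (fun x => tilted_density (r x) (be x) (y x)).
Proof.
move=> mr mbe my; apply: measurable_funM; last first.
  by apply: measurable_boolR; exact: measurable_under_cond.
apply: measurable_funM.
  apply: measurable_funM; first exact: (measurable_precomp (measurable_sigmaVX _) mbe).
  exact: (measurable_precomp (measurable_sigmaVX 2) mbe).
apply: measurable_prodr => t _; apply: measurable_phi; apply: measurable_funM.
  exact: measurable_increments.
exact: (measurable_precomp (measurable_sigmaVX 1) mbe).
Qed.

Lemma tilted_density_ge0 r be y : (0 <= tilted_density r be y)%R.
Proof.
have s0 := sigma_gt0 be; rewrite mulr_ge0// mulr_ge0//.
  by rewrite divr_ge0 ?invr_ge0 ?exprn_ge0// ltW.
by rewrite prodr_ge0// => t _; exact: phi_ge0.
Qed.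

Definition pinned_mass (r : R) : \bar R :=
  (c0 r)%:R%:E * \prod_(l < m) walkV (below r) r (pinmask B l) 0%R.

Lemma pinned_mass_ge0 r : 0 <= pinned_mass r.
Proof. by rewrite mule_ge0 ?lee_fin// prode_ge0// => l _; exact: walkV_ge0. Qed.

Lemma measurable_pinned_mass : measurable_fun [set: R] pinned_mass.
Proof.
apply: emeasurable_funM; first exact: measurable_boolE.
have mw l : measurable_fun [set: R] (fun r => walkV (below r) r (pinmask B l) 0%R).
  apply: measurable_walkV => //; apply: measurable_fun_ler; [exact: measurable_snd|exact: measurable_fst].
elim: (index_enum _) => [|l ls IH].
  by rewrite (_ : (fun _ => _) = cst 1)//; apply/funext => r; rewrite big_nil.
rewrite (_ : (fun _ => _) = (fun r => walkV (below r) r (pinmask B l) 0%R *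
  \prod_(l <- ls) walkV (below r) r (pinmask B l) 0%R)); last first.
  by apply/funext => r; rewrite big_cons.
exact: emeasurable_funM.
Qed.

Lemma lint_tilted_density r be :
  (forall x r : R, (0 < x)%R -> c0 (x * r)%R = c0 r) ->
  lint free_pts (fun y => (tilted_density (sigma be * r) be y)%:E) =
  (sigma be ^- (k + 2))%:E * pinned_mass r.
Proof.
move=> c0Z; have s0 := sigma_gt0 be; set s := sigma be in s0 *.
pose G (y : T -> R) : \bar R := (\prod_t phi (increments r y t) * (under_cond r y)%:R)%:E.
have G0 y : 0 <= G y.
  by rewrite lee_fin mulr_ge0// prodr_ge0// => t _; exact: phi_ge0.
have mG : measurable_fun [set: vec R T] G.
  apply/measurable_EFinP; apply: measurable_funM; last first.
    by apply: measurable_boolR; exact: (@measurable_under_cond _ (vec R T) (fun=> r) id).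
  apply: measurable_prodr => t _; apply: measurable_phi.
  exact: (@measurable_increments _ (vec R T) (fun=> r) id t).
have pinE y : pinned B (s * r) y = (fun p => s * pinned B r (fun i => s^-1 * y i) p)%R.
  apply/funext => p; rewrite /pinned; case: (p \in B) => //.
  by rewrite mulVKf// gt_eqF.
have tE y : (tilted_density (s * r) be y)%:E = (s ^- #|{: T}| / s ^+ 2)%:E * G (fun i => s^-1 * y i)%R.
  rewrite /G -EFinM /tilted_density -/s mulrA; congr (_ * _ * _%:R)%:E.
    apply: eq_bigr => t _; congr phi; rewrite /increments pinE prevptZ -mulrBr.
    by rewrite mulrAC mulfV ?mul1r// gt_eqF.
  rewrite /under_cond c0Z//; congr (nat_of_bool (_ && _)); apply: eq_forallb => p.
  by rewrite pinE ler_pM2l.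
transitivity ((s ^- #|{: T}| / s ^+ 2)%:E * lint free_pts (fun y => G (fun i => s^-1 * y i)%R)).
  rewrite -lint_Zl//; first last.
  - apply: (measurable_precomp mG); apply: measurable_vec => i.
    by apply: measurable_funM => //; exact: measurable_coord.
  - by rewrite lee_fin divr_ge0 ?invr_ge0 ?exprn_ge0// ltW.
  by apply: eq_lint => y; exact: tE.
rewrite lint_scale//; last by rewrite invr_eq0 gt_eqF.
rewrite muleA -EFinM; congr (_ %:E * _).
  rewrite ger0_norm ?invr_ge0 ?ltW// exprVn invrK -size_free_pts Bk.
  by rewrite !exprD; field; rewrite !gt_eqF ?exprn_gt0.
have mb : measurable_fun [set: R] (below r) by exact: measurable_below.
have br : below r r by rewrite /below lexx.
have W0 y : 0 <= (\prod_(p : T) (phi (pinned B r y p - prevpt (pinned B r y) p) * (below r (pinned B r y p))%:R))%:E :> \bar R.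
  by rewrite lee_fin prodr_ge0// => p _; rewrite mulr_ge0 ?phi_ge0.
have mW : measurable_fun [set: vec R T] (fun y => (\prod_(p : T) (phi (pinned B r y p - prevpt (pinned B r y) p) * (below r (pinned B r y p))%:R))%:E).
  apply/measurable_EFinP; apply: measurable_prodr => p _; apply: measurable_funM.
    by apply: measurable_phi; exact: (@measurable_increments _ (vec R T) (fun=> r) id p).
  apply: measurable_boolR; apply: (measurable_precomp mb).
  exact: (measurable_coord_comp p (@measurable_pinned _ _ _ B _ (vec R T) id (fun=> r) (@measurable_id _ _ _) (@measurable_cst _ _ _ _ _ r))).
rewrite /pinned_mass -lint_walks// -lint_Zl ?lee_fin//.
apply: eq_lint => y; rewrite /G -EFinM; congr EFin.
rewrite big_split /= mulrC /under_cond -mulnb natrM -mulrA mulrCA [in RHS]mulrC -!mulrA.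
rewrite [LHS]mulrC -mulrA mulrCA; congr (_ * _)%R; rewrite mulrC; congr (_ * _)%R.
rewrite -big_enum /= prod_boolR; congr (nat_of_bool _)%:R.
by apply/forallP/allP => h p; [move=> _; exact: h|apply: h; rewrite mem_enum].
Qed.

Variables (M : (T * 'I_d -> R) -> 'M[R]_k)
  (alpha : ('I_k -> R) -> R) (beta : ('I_k -> R) -> 'I_d -> R)
  (U : (T * 'I_d -> R) -> (T -> R) -> bool).
Hypothesis Mm : forall i j, measurable_fun [set: vec R (T * 'I_d)%type] (fun w => M w i j).
Hypothesis alpham : measurable_fun [set: vec R 'I_k] alpha.
Hypothesis betam : measurable_fun [set: vec R 'I_k] (fun g => beta g : vec R 'I_d).
Hypothesis HM : forall w g i,
  (mxact (M w) g i = alpha g + \sum_c beta g c * walk_pt w (b i) c)%R.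
Hypothesis Mtilt : forall g y z,
  (\det (M (tilt (beta g) (increments (alpha g) y) z)) = \det (M z) / sigma (beta g))%R.
Hypothesis Um : forall w, measurable_fun [set: vec R T] (U w).
Hypothesis HU : forall w g y, (\det (M w) != 0)%R ->
  U w (lifted (alpha g) (beta g) y w) = under_cond (alpha g) y.

Definition tilt_integrand w g y : R :=
  (\det (M w) ^+ 2 * \prod_t phi (increments (alpha g) y t + \sum_c beta g c * w (t, c)) *
  (under_cond (alpha g) y)%:R)%R.

Lemma tilt_integrand_ge0 w g y : (0 <= tilt_integrand w g y)%R.
Proof.
by rewrite mulr_ge0// mulr_ge0 ?sqr_ge0// prodr_ge0// => t _; exact: phi_ge0.
Qed.

Lemma measurable_det2 : measurable_fun [set: vec R (T * 'I_d)%type] (fun w => \det (M w) ^+ 2)%R.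
Proof. by apply: measurable_funX; exact: measurable_det. Qed.

Lemma measurable_tilt_integrand dX (X : measurableType dX) (w : X -> vec R (T * 'I_d)%type)
    (g : X -> vec R 'I_k) (y : X -> vec R T) :
  measurable_fun [set: X] w -> measurable_fun [set: X] g -> measurable_fun [set: X] y ->
  measurable_fun [set: X] (fun x => (tilt_integrand (w x) (g x) (y x))%:E).
Proof.
move=> mw mg my; have ma := measurable_precomp alpham mg; have mb := measurable_precomp betam mg.
apply/measurable_EFinP; apply: measurable_funM; last first.
  by apply: measurable_boolR; exact: measurable_under_cond.
apply: measurable_funM; first exact: (measurable_precomp measurable_det2 mw).
apply: measurable_prodr => t _; apply: measurable_phi; apply: measurable_funD.
  exact: measurable_increments.
apply: measurable_sumr => c _; apply: measurable_funM.
  exact: (measurable_coord_comp c mb).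
exact: (measurable_coord_comp (t, c) mw).
Qed.

(** One [|det|] belongs to the simplex volume, the other is the Jacobian of the face parameters,
    whence the square. For a singular matrix both sides vanish. *)
Lemma height_termE w : `|\det (M w)|%:E *
    lint (enum {: T}) (fun h => (step_density h * (U w h)%:R)%:E) =
  lint (enum 'I_k) (fun g => lint free_pts (fun y => (tilt_integrand w g y)%:E)).
Proof.
have [M0|M0] := eqVneq (\det (M w)) 0%R.
  rewrite M0 normr0 mul0e -[LHS](lint0 (enum 'I_k)); apply: eq_lint => g.
  by rewrite -[LHS](lint0 free_pts); apply: eq_lint => y; rewrite /tilt_integrand M0 expr0n /= !mul0r.
have mU : measurable_fun [set: vec R T] (fun h => (step_density h * (U w h)%:R)%:E).
  apply/measurable_EFinP; apply: measurable_funM; first exact: measurable_step_density.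
  exact: measurable_boolR.
have U0 h : 0 <= (step_density h * (U w h)%:R)%:E :> \bar R.
  by rewrite lee_fin mulr_ge0// step_density_ge0.
rewrite (lint_height_change (HM w) M0 U0 mU) muleA -EFinM -normrM -expr2 ger0_norm ?sqr_ge0//.
have mG : measurable_fun [set: vec R 'I_k * vec R T]
    (fun z => (step_density (lifted (alpha z.1) (beta z.1) z.2 w) * (U w (lifted (alpha z.1) (beta z.1) z.2 w))%:R)%:E).
  apply: (measurable_precomp mU); apply: measurable_vec => p; apply: measurable_funD.
    have ma : measurable_fun [set: vec R 'I_k * vec R T] (fun z => alpha z.1).
      exact: (measurable_precomp alpham measurable_fst).
    exact: (measurable_coord_comp p (measurable_pinned B measurable_snd ma)).
  apply: measurable_sumr => c _; apply: measurable_funM => //.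
  exact: (measurable_coord_comp c (measurable_precomp betam measurable_fst)).
rewrite -lint_Zl//; first last.
- exact: measurable_lint.
- by move=> g; exact: lint_ge0.
- by rewrite lee_fin sqr_ge0.
apply: eq_lint => g; rewrite -lint_Zl//; first last.
- exact: (@measurable_fixl _ _ _ (vec R 'I_k) (vec R T) _ (fun g y => (step_density (lifted (alpha g) (beta g) y w) * (U w (lifted (alpha g) (beta g) y w))%:R)%:E) g mG).
- by rewrite lee_fin sqr_ge0.
by apply: eq_lint => y; rewrite HU// step_density_lifted -EFinM mulrA.
Qed.

(** [U w] is only known to be measurable in the heights, for fixed [w]. Measurability in [w] is read
    off the other side of [height_termE], from which [U] has disappeared. *)
Lemma measurable_height_term : measurable_fun [set: vec R (T * 'I_d)%type]
  (fun w => `|\det (M w)|%:E *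
    lint (enum {: T}) (fun h => (step_density h * (U w h)%:R)%:E)).
Proof.
rewrite (_ : (fun _ => _) = (fun w => lint (enum 'I_k) (fun g => lint free_pts (fun y => (tilt_integrand w g y)%:E)))); last first.
  by apply/funext => w; exact: height_termE.
apply: measurable_lint => [w g|].
  by apply: lint_ge0 => y; rewrite lee_fin tilt_integrand_ge0.
apply: measurable_lint => [z y|]; first by rewrite lee_fin tilt_integrand_ge0.
apply: measurable_tilt_integrand.
+ exact: (measurable_precomp measurable_fst measurable_fst).
+ exact: (measurable_precomp measurable_snd measurable_fst).
+ exact: measurable_snd.
Qed.

(** For a fixed face and fixed residuals the steps are integrated through [tilt], after which they
    enter only through the second moment of the determinant. *)
Lemma gauss_exp_height_change :
  gauss_exp (fun w : T * 'I_d -> R => `|\det (M w)|%:E *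
    lint (enum {: T}) (fun h => (step_density h * (U w h)%:R)%:E)) =
  gauss_exp (fun z : T * 'I_d -> R => (\det (M z) ^+ 2)%:E) *
  lint (enum 'I_k) (fun g => lint free_pts (fun y => (tilted_density (alpha g) (beta g) y)%:E)).
Proof.
pose D w := (\det (M w) ^+ 2)%R.
have mD := measurable_det2.
transitivity (gauss_exp (fun w : T * 'I_d -> R => lint (enum 'I_k) (fun g => lint free_pts (fun y => (tilt_integrand w g y)%:E)))).
  by apply: eq_gint => w; exact: height_termE.
rewrite /gauss_exp gint_lint_swap ?enum_uniq//; first last.
- apply: measurable_lint => [z y|]; first by rewrite lee_fin tilt_integrand_ge0.
  apply: measurable_tilt_integrand.
  + exact: (measurable_precomp measurable_fst measurable_fst).
  + exact: (measurable_precomp measurable_snd measurable_fst).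
  + exact: measurable_snd.
- by move=> w g; apply: lint_ge0 => y; rewrite lee_fin tilt_integrand_ge0.
have mt : measurable_fun [set: vec R 'I_k * vec R T] (fun z => (tilted_density (alpha z.1) (beta z.1) z.2)%:E).
  apply/measurable_EFinP; apply: measurable_tilted_density => //.
  - exact: (measurable_precomp alpham measurable_fst).
  - exact: (measurable_precomp betam measurable_fst).
have G0 : 0 <= gint (enum {: T * 'I_d}) (fun z => (\det (M z) ^+ 2)%:E).
  by apply: gint_ge0 => z; rewrite lee_fin sqr_ge0.
rewrite -lint_Zl//; first last.
- by apply: measurable_lint => // g y; rewrite lee_fin tilted_density_ge0.
- by move=> g; apply: lint_ge0 => y; rewrite lee_fin tilted_density_ge0.
apply: eq_lint => g; rewrite gint_lint_swap ?enum_uniq//; first last.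
- by apply: measurable_tilt_integrand; [exact: measurable_fst|exact: measurable_cst|exact: measurable_snd].
- by move=> w y; rewrite lee_fin tilt_integrand_ge0.
rewrite -lint_Zl//; first last.
- exact: (@measurable_fixl _ _ _ (vec R 'I_k) (vec R T) _ (fun g y => (tilted_density (alpha g) (beta g) y)%:E) g mt).
- by move=> y; rewrite lee_fin tilted_density_ge0.
apply: eq_lint => y.
have s0 := sigma_gt0 (beta g).
pose u : R := (under_cond (alpha g) y)%:R%R.
pose Q w := (u * D w)%R.
have Q0 w : (0 <= Q w)%R by rewrite mulr_ge0 ?sqr_ge0.
have mQ : measurable_fun [set: vec R (T * 'I_d)%type] Q by exact: measurable_funM.
have := gauss_exp_tilt (beta g) (increments (alpha g) y) Q0 mQ.
rewrite /gauss_exp => e.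
transitivity (gint (enum {: T * 'I_d}) (fun w => (Q w * \prod_t phi (increments (alpha g) y t + \sum_c beta g c * w (t, c)))%:E)).
  by apply: eq_gint => w; congr EFin; rewrite /tilt_integrand /Q -/u mulrC mulrA.
rewrite e.
transitivity ((sigma (beta g) ^- #|{: T}| * \prod_t phi (increments (alpha g) y t / sigma (beta g)))%:E *
   ((u / sigma (beta g) ^+ 2)%:E * gint (enum {: T * 'I_d}) (fun z => (\det (M z) ^+ 2)%:E))).
  congr (_ * _); rewrite -gint_Zl ?enum_uniq//; first last.
  - exact/measurable_EFinP.
  - by move=> z; rewrite lee_fin sqr_ge0.
  - by rewrite lee_fin divr_ge0// exprn_ge0// ltW.
  apply: eq_gint => z; rewrite -EFinM; congr EFin.
  by rewrite /Q /D Mtilt expr_div_n mulrA mulrAC.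
rewrite muleA -EFinM muleC; congr (_ * _%:E).
by rewrite /tilted_density -/u; ring.
Qed.

End height_change.

(** * Integration over the level and the slope *)

Section height_integrals.
Context {R : realType}.
Local Notation mu := (@lebesgue_measure R).
Local Open Scope ereal_scope.
Variables (m : nat) (n : 'I_m -> nat) (d : nat).
Local Notation T := (PT n).
Variables (t0 : T) (B : {set T}) (c0 : R -> bool).
Hypothesis c0m : measurable_fun [set: R] c0.
Hypothesis c0Z : forall x r : R, (0 < x)%R -> c0 (x * r)%R = c0 r.

Lemma lint_ordS (K : R -> ('I_d -> R) -> \bar R) :
  lint (enum 'I_d.+1) (fun g => K (g ord0) (fun c => g (lift ord0 c))) =
  \int[mu]_a lint (enum 'I_d) (K a).
Proof.
rewrite enum_ordSl /=; apply: eq_integral => a _.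
rewrite -(lint_map _ (K a) (@lift_inj _ ord0)).
by apply: eq_lint => w; rewrite updE.
Qed.

(** With [k = d] and level [0], the exponent [k + 2] is already that of the slope integral. *)
Lemma lint_tilted_linear : #|B| = d ->
  lint (enum 'I_d) (fun be => lint (free_pts B) (fun y => (tilted_density B c0 0 be y)%:E)) =
  cauchy_integral d * pinned_mass B c0 0%R.
Proof.
move=> Bd.
have e (be : 'I_d -> R) : lint (free_pts B) (fun y => (tilted_density B c0 0 be y)%:E) =
    pinned_mass B c0 0 * (sigma be ^- d.+2)%:E.
  by rewrite -{1}(mulr0 (sigma be)) (lint_tilted_density Bd)// addn2 muleC.
rewrite (eq_lint _ e) lint_Zl; first by rewrite muleC.
- exact: pinned_mass_ge0.
- by move=> be; rewrite lee_fin invr_ge0 exprn_ge0// ltW// sigma_gt0.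
- by apply/measurable_EFinP; exact: measurable_sigmaVX.
Qed.

(** With [k = d+1] the exponent is [d+3]; substituting [sigma be * r] for the level gives one power
    back, so the slope integral is the same as for faces through the origin. *)
Lemma lint_tilted_affine : #|B| = d.+1 ->
  lint (enum 'I_d.+1) (fun g => lint (free_pts B)
    (fun y => (tilted_density B c0 (g ord0) (fun c => g (lift ord0 c)) y)%:E)) =
  cauchy_integral d * \int[mu]_r pinned_mass B c0 r.
Proof.
move=> Bd.
pose H a (be : 'I_d -> R) := lint (free_pts B) (fun y => (tilted_density B c0 a be y)%:E).
have H0 a be : 0 <= H a be.
  by apply: lint_ge0 => y; rewrite lee_fin tilted_density_ge0.
have mH : measurable_fun [set: R * vec R 'I_d] (fun z => H z.1 z.2).
  apply: measurable_lint => [z y|]; first by rewrite lee_fin tilted_density_ge0.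
  apply/measurable_EFinP; apply: measurable_tilted_density => //.
  - exact: (measurable_precomp measurable_fst measurable_fst).
  - exact: (measurable_precomp measurable_snd measurable_fst).
rewrite (lint_ordS H) lint_integral//.
have mP := measurable_pinned_mass B c0m; have P0 := pinned_mass_ge0 B c0.
have I0 : 0 <= \int[mu]_r pinned_mass B c0 r by exact: integral_ge0.
have e be : \int[mu]_a H a be = (\int[mu]_r pinned_mass B c0 r) * (sigma be ^- d.+2)%:E.
  have s0 := sigma_gt0 be.
  have mHb : measurable_fun [set: R] (H^~ be).
    exact: (@measurable_fixr _ _ _ R (vec R 'I_d) _ H be mH).
  have sn : (sigma be != 0)%R by rewrite gt_eqF.
  have := integral_affine 0 sn (H0^~ be) mHb.
  move=> /(congr1 (fun x => (sigma be)%:E * x)); rewrite muleA -EFinM ger0_norm ?ltW// mulfV// mul1e => <-.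
  transitivity ((sigma be)%:E * \int[mu]_r ((sigma be ^- d.+3)%:E * pinned_mass B c0 r)).
    congr (_ * _); apply: eq_integral => r _.
    by rewrite /H addr0 (lint_tilted_density Bd)// addn2.
  rewrite ge0_integralZl//; last by rewrite lee_fin invr_ge0 exprn_ge0// ltW.
  rewrite muleA -EFinM muleC; congr (_ * _%:E).
  by rewrite [X in (_ / X)%R]exprS invfM mulrA mulfV// mul1r.
rewrite (eq_lint _ e) lint_Zl; first by rewrite muleC.
- exact: I0.
- by move=> be; rewrite lee_fin invr_ge0 exprn_ge0// ltW// sigma_gt0.
- by apply/measurable_EFinP; exact: measurable_sigmaVX.
Qed.

End height_integrals.

(** * Expected volumes as sums over configurations *)

Section option_subsets.
Variables (T : finType).

Lemma enum_filter (J : finType) (A : {set J}) : enum A = [seq j <- enum {: J} | j \in A].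
Proof. by rewrite {1}/enum_mem -enumT; apply: eq_filter. Qed.

Lemma enum_option : enum {: option T} = None :: [seq Some t | t <- enum T].
Proof. by rewrite !enumT [in LHS]unlock. Qed.

Definition somes (B : {set T}) : {set option T} := [set Some t | t in B]%SET.

Lemma mem_somes B t : (Some t \in somes B) = (t \in B).
Proof. by rewrite mem_imset//; exact: Some_inj. Qed.

Lemma None_somes B : None \notin somes B.
Proof. by apply/negP => /imsetP[]. Qed.

Lemma enum_somes B : enum (somes B) = [seq Some t | t <- enum B].
Proof.
rewrite enum_filter enum_option /= (negbTE (None_somes B)) filter_map [enum B]enum_filter.
by congr map; apply: eq_filter => t /=; exact: mem_somes.
Qed.

(** [None] is enumerated first, so the origin supplies the first row [(1, 0, ..., 0)] of the matrix
    of a simplex. *)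
Lemma enum_Nsomes B : enum (None |: somes B)%SET = None :: [seq Some t | t <- enum B].
Proof.
rewrite enum_filter enum_option /= setU11 filter_map [enum B]enum_filter.
by congr (_ :: map _ _); apply: eq_filter => t /=; rewrite in_setU1 mem_somes.
Qed.

Lemma card_somes B : #|somes B| = #|B|.
Proof. by rewrite card_imset//; exact: Some_inj. Qed.

Lemma card_Nsomes B : #|(None |: somes B)%SET| = #|B|.+1.
Proof. by rewrite cardsU1 None_somes card_somes. Qed.

Lemma big_option_sets (R : Type) (idx : R) (op : Monoid.com_law idx) d (F : {set option T} -> R) :
  \big[op/idx]_(A : {set option T} | #|A| == d.+1) F A =
  op (\big[op/idx]_(B : {set T} | #|B| == d.+1) F (somes B))
     (\big[op/idx]_(B : {set T} | #|B| == d) F (None |: somes B)%SET).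
Proof.
pose un (A : {set option T}) : {set T} := [set t | Some t \in A]%SET.
have unE A t : (t \in un A) = (Some t \in A) by rewrite inE.
rewrite (bigID (fun A : {set option T} => None \notin A)) /=; congr (op _ _).
  rewrite (reindex_onto somes un) /= => [|A /andP[_ NA]].
    apply: eq_bigl => B; rewrite None_somes card_somes andbT.
    by rewrite (_ : un (somes B) = B) ?eqxx ?andbT//; apply/setP => t; rewrite unE mem_somes.
  apply/setP => -[t|]; first by rewrite mem_somes unE.
  by rewrite (negbTE NA) (negbTE (None_somes _)).
rewrite (reindex_onto (fun B => None |: somes B)%SET un) /= => [|A /andP[_ NA]].
  apply: eq_bigl => B; rewrite setU11 /= card_Nsomes eqSS.
  rewrite (_ : un _ = B) ?eqxx ?andbT//; apply/setP => t.
  by rewrite unE in_setU1 mem_somes.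
apply/setP => -[t|]; first by rewrite in_setU1 mem_somes unE.
by rewrite setU11; move: NA; rewrite negbK => ->.
Qed.

End option_subsets.

(** * Matrices and upper conditions of the faces *)

Section volume_formulas.
Context {R : realType}.
Local Notation mu := (@lebesgue_measure R).
Variables (m : nat) (n : 'I_m -> nat) (d : nat).
Local Notation T := (PT n).
Variable t0 : T.

Lemma interp_affine (J : finType) (P : J -> 'I_d -> R) (f : 'I_d.+1 -> J) H (g : 'I_d.+1 -> R) x :
  ptmx P f \in unitmx ->
  (forall i, H (f i) = g ord0 + \sum_c g (lift ord0 c) * P (f i) c) ->
  interp P H f x = g ord0 + \sum_c g (lift ord0 c) * x c.
Proof.
move=> fu Hf; have rowE y : g ord0 + \sum_c g (lift ord0 c) * y c = (extrow y *m \col_k g k) 0 0.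
  rewrite mxE big_ord_recl extrow0 mul1r mxE; congr (_ + _).
  by apply: eq_bigr => c _; rewrite extrowS mxE mulrC.
rewrite rowE -(bary_mul x fu) -mulmxA [RHS]mxE; apply: eq_bigr => i _; congr (_ * _).
rewrite Hf rowE !mxE; apply: eq_bigr => k _; by rewrite [ptmx _ _ _ _]mxE.
Qed.

Definition affmx (B : {set T}) (w : T * 'I_d -> R) : 'M[R]_d.+1 :=
  ptmx (walk_pt w) (enum_set t0 B).

(** For a simplex with the origin as a further vertex: the row of the origin and the column of ones
    are removed. *)
Definition linmx (B : {set T}) (w : T * 'I_d -> R) : 'M[R]_d :=
  \matrix_(i, c) walk_pt w (enum_set t0 B i) c.

Lemma affmxE B w i (g : 'I_d.+1 -> R) :
  mxact (affmx B w) g i = g ord0 + \sum_c g (lift ord0 c) * walk_pt w (enum_set t0 B i) c.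
Proof.
rewrite /mxact big_ord_recl ptmx0 mul1r; congr (_ + _).
by apply: eq_bigr => c _; rewrite mxE extrowS mulrC.
Qed.

Lemma linmxE B w i (g : 'I_d -> R) :
  mxact (linmx B w) g i = 0 + \sum_c g c * walk_pt w (enum_set t0 B i) c.
Proof. by rewrite add0r; apply: eq_bigr => c _; rewrite mxE mulrC. Qed.

Lemma measurable_affmx B i j :
  measurable_fun [set: vec R (T * 'I_d)%type] (fun w => affmx B w i j).
Proof.
rewrite (_ : (fun _ => _) = (fun w => extrow (walk_pt w (enum_set t0 B i)) 0 j)); last first.
  by apply/funext => w; rewrite mxE.
have mw : measurable_fun [set: vec R (T * 'I_d)%type] (fun w => walk_pt w (enum_set t0 B i) : vec R 'I_d).
  by apply: measurable_vec => c; apply: (@measurable_walk_pt _ _ _ _ _ (vec R (T * 'I_d)%type) id).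
exact: (measurable_extrow j mw).
Qed.

Lemma measurable_linmx B i j :
  measurable_fun [set: vec R (T * 'I_d)%type] (fun w => linmx B w i j).
Proof.
rewrite (_ : (fun _ => _) = (fun w => walk_pt w (enum_set t0 B i) j)); last first.
  by apply/funext => w; rewrite mxE.
exact: (@measurable_walk_pt _ _ _ _ _ (vec R (T * 'I_d)%type) id).
Qed.

(** At level [0] the translations of [tilt] add up to zero at the points of [B], so the matrix is
    multiplied by the transpose of [tiltmx]. *)
Lemma linmx_tilt (B : {set T}) (be : 'I_d -> R) y z : #|B| = d ->
  \det (linmx B (tilt be (increments B 0 y) z)) = \det (linmx B z) / sigma be.
Proof.
move=> Bd; rewrite -(det_tiltmx be) -(det_tr (tiltmx be)) -det_mulmx; congr (\det _).
apply/matrixP => i c; rewrite [LHS]mxE walk_pt_tilt; last exact: mem_enum_set.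
by rewrite mulr0 mul0r subr0 [RHS]mxE; apply: eq_bigr => j _; rewrite !mxE mulrC.
Qed.

(** At the points of [B] the translations add up to the same vector [- b * r / sigma^2], which is a
    multiple of the column of ones in each coordinate; [K] performs this column operation together
    with [tiltmx]. *)
Lemma affmx_tilt (B : {set T}) r (be : 'I_d -> R) y z : #|B| = d.+1 ->
  \det (affmx B (tilt be (increments B r y) z)) = \det (affmx B z) / sigma be.
Proof.
move=> Bd.
pose K : 'M[R]_d.+1 := \matrix_(k, k') if unlift ord0 k' is Some c then
  (if unlift ord0 k is Some j then tiltmx be c j else - (be c * r / sigma be ^+ 2))
  else (k == ord0)%:R.
have -> : \det (affmx B (tilt be (increments B r y) z)) = \det (affmx B z *m K).
  congr (\det _); apply/matrixP => i k; rewrite [RHS]mxE big_ord_recl ptmx0 mul1r.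
  case: (unliftP ord0 k) => [c ->|->]; last first.
    rewrite ptmx0 mxE unlift_none eqxx big1 ?addr0// => j _.
    by rewrite [X in _ * X]mxE unlift_none mulr0.
  rewrite [LHS]mxE extrowS walk_pt_tilt; last exact: mem_enum_set.
  rewrite [X in _ = X + _]mxE liftK unlift_none addrC; congr (_ + _).
  by apply: eq_bigr => j _; rewrite [X in _ = X * _]mxE extrowS [X in _ = _ * X]mxE !liftK mulrC.
rewrite det_mulmx; congr (_ * _).
rewrite (expand_det_col K ord0) big_ord_recl big1 ?addr0 => [|j _]; last first.
  by rewrite mxE unlift_none mul0r.
rewrite mxE unlift_none eqxx mul1r /cofactor expr0 mul1r -(det_tiltmx be) -det_tr.
by congr (\det _); apply/matrixP => i j; rewrite !mxE !liftK ?mxE.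
Qed.

(** Subtracting the affine function of the face leaves a condition on the residuals alone: the steps
    drop out. *)
Lemma upper_lifted (B : {set T}) (w : T * 'I_d -> R) (g : 'I_d.+1 -> R) y :
  #|B| = d.+1 -> affmx B w \in unitmx ->
  upper (walk_pt w) (heights Some (lifted B (g ord0) (fun c => g (lift ord0 c)) y w)) (enum_set t0 B) =
  under_cond B (fun=> true) (g ord0) y.
Proof.
move=> Bd Bu; apply: eq_forallb => p; rewrite (interp_affine (g := g))//.
  by rewrite /heights /lifted lerD2r.
by move=> i; rewrite /heights /lifted /pinned mem_enum_set.
Qed.

Lemma ptmx_somes (B : {set T}) (w : T * 'I_d -> R) : #|B| = d.+1 ->
  ptmx (walk_pt0 w) (@enum_set _ (Some t0) d.+1 (somes B)) = affmx B w.
Proof.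
move=> Bd; apply/row_matrixP => i; rewrite !row_ptmx; congr extrow.
by rewrite /enum_set enum_somes (nth_map t0) // -cardE Bd.
Qed.

Lemma enum_set_somes (B : {set T}) i : #|B| = d.+1 ->
  @enum_set _ (Some t0) d.+1 (somes B) i = Some (enum_set t0 B i).
Proof. by move=> Bd; rewrite /enum_set enum_somes (nth_map t0)// -cardE Bd. Qed.

Lemma enum_set_Nsomes (B : {set T}) i : #|B| = d ->
  @enum_set _ (Some t0) d.+1 (None |: somes B)%SET i =
  if unlift ord0 i is Some k then Some (@enum_set _ t0 d B k) else None.
Proof.
move=> Bd; rewrite /enum_set enum_Nsomes; case: unliftP => [k ->|->] //=.
by rewrite add0n (nth_map t0)// -cardE Bd.
Qed.

Lemma det_ptmx_Nsomes (B : {set T}) (w : T * 'I_d -> R) : #|B| = d ->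
  \det (ptmx (walk_pt0 w) (@enum_set _ (Some t0) d.+1 (None |: somes B)%SET)) = \det (linmx B w).
Proof.
move=> Bd; rewrite (expand_det_row _ ord0) big_ord_recl big1 ?addr0 => [|j _]; last first.
  by rewrite mxE extrowS enum_set_Nsomes// unlift_none mul0r.
rewrite ptmx0 mul1r /cofactor expr0 mul1r; congr (\det _); apply/matrixP => i j.
by rewrite !mxE liftK enum_set_Nsomes// liftK.
Qed.

(** The lifted origin has height [0] and the face has height [g ord0] above it, which adds the
    condition [0 <= r]. *)
Lemma upper_lifted0 (B : {set T}) (w : T * 'I_d -> R) (g : 'I_d.+1 -> R) y :
  #|B| = d.+1 -> affmx B w \in unitmx ->
  upper (walk_pt0 w) (heights id (lifted B (g ord0) (fun c => g (lift ord0 c)) y w))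
    (@enum_set _ (Some t0) d.+1 (somes B)) =
  under_cond B (fun r => 0 <= r) (g ord0) y.
Proof.
move=> Bd Bu.
have E j : interp (walk_pt0 w) (heights id (lifted B (g ord0) (fun c => g (lift ord0 c)) y w))
    (@enum_set _ (Some t0) d.+1 (somes B)) (walk_pt0 w j) =
    g ord0 + \sum_c g (lift ord0 c) * walk_pt0 w j c.
  apply: interp_affine; first by rewrite ptmx_somes.
  by move=> i; rewrite enum_set_somes// /heights /lifted /pinned mem_enum_set.
apply/forallP/andP => [h|[h0 /forallP h] [p|]].
- split.
    by have := h None; rewrite E /heights /= big1 ?addr0// => c _; rewrite mulr0.
  by apply/forallP => p; have := h (Some p); rewrite E /heights /lifted lerD2r.
- by rewrite E /heights /lifted lerD2r.
- by rewrite E /heights /= big1 ?addr0// => c _; rewrite mulr0.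
Qed.

(** A face through the lifted origin has level [0], and the condition at the origin is an
    equality. *)
Lemma upper_lifted_lin (B : {set T}) (w : T * 'I_d -> R) (g : 'I_d -> R) y :
  #|B| = d -> \det (linmx B w) != 0 ->
  upper (walk_pt0 w) (heights id (lifted B 0 g y w))
    (@enum_set _ (Some t0) d.+1 (None |: somes B)%SET) =
  under_cond B (fun=> true) 0 y.
Proof.
move=> Bd Bu.
pose g' k := if unlift ord0 k is Some c then g c else 0.
have E j : interp (walk_pt0 w) (heights id (lifted B 0 g y w))
    (@enum_set _ (Some t0) d.+1 (None |: somes B)%SET) (walk_pt0 w j) =
    0 + \sum_c g c * walk_pt0 w j c.
  rewrite (interp_affine (g := g')).
  - rewrite /g' unlift_none; congr (_ + _); apply: eq_bigr => c _; by rewrite liftK.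
  - by rewrite unitmxE det_ptmx_Nsomes// unitfE.
  move=> i; rewrite enum_set_Nsomes// {1}/g' unlift_none.
  case: unliftP => [k _|_].
    rewrite /heights /lifted /pinned mem_enum_set//; congr (_ + _).
    by apply: eq_bigr => c _; rewrite /g' liftK.
  by rewrite /heights /= add0r big1// => c _; rewrite mulr0.
apply/forallP/andP => [h|[_ /forallP h] [p|]].
- split => //; apply/forallP => p; have := h (Some p).
  by rewrite E /heights /lifted lerD2r.
- by rewrite E /heights /lifted lerD2r.
- by rewrite E /heights /= big1 ?addr0// => c _; rewrite mulr0.
Qed.

End volume_formulas.

(** * Expected volumes as sums over sets of vertices *)

Section volume_expectations.
Context {R : realType}.
Local Notation mu := (@lebesgue_measure R).
Local Open Scope ereal_scope.
Variables (m : nat) (n : 'I_m -> nat) (d : nat).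
Local Notation T := (PT n).
Variable t0 : T.

Definition aff_moment (B : {set T}) : \bar R :=
  gauss_exp (fun w : T * 'I_d -> R => (\det (affmx t0 B w) ^+ 2)%:E).

Definition lin_moment (B : {set T}) : \bar R :=
  gauss_exp (fun w : T * 'I_d -> R => (\det (linmx t0 B w) ^+ 2)%:E).

Definition aff_term (B : {set T}) (w : T * 'I_d -> R) (U : (T -> R) -> bool) : \bar R :=
  `|\det (affmx t0 B w)|%:E * lint (enum {: T}) (fun h => (step_density h * (U h)%:R)%:E).

Definition lin_term (B : {set T}) (w : T * 'I_d -> R) (U : (T -> R) -> bool) : \bar R :=
  `|\det (linmx t0 B w)|%:E * lint (enum {: T}) (fun h => (step_density h * (U h)%:R)%:E).

Let measurable_alpha : measurable_fun [set: vec R 'I_d.+1] (fun g : 'I_d.+1 -> R => g ord0).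
Proof. exact: measurable_coord. Qed.

Let measurable_beta : measurable_fun [set: vec R 'I_d.+1]
  (fun g => (fun c => g (lift ord0 c)) : vec R 'I_d).
Proof. by apply: measurable_vec => c; exact: measurable_coord. Qed.

Lemma aff_term_expectation (B : {set T}) (c0 : R -> bool) (U : (T * 'I_d -> R) -> (T -> R) -> bool) :
  #|B| = d.+1 -> measurable_fun [set: R] c0 ->
  (forall x r : R, (0 < x)%R -> c0 (x * r)%R = c0 r) ->
  (forall w, measurable_fun [set: vec R T] (U w)) ->
  (forall w g y, (\det (affmx t0 B w) != 0)%R ->
    U w (lifted B (g ord0) (fun c => g (lift ord0 c)) y w) = under_cond B c0 (g ord0) y) ->
  measurable_fun [set: vec R (T * 'I_d)%type] (fun w => aff_term B w (U w)) /\
  gauss_exp (fun w => aff_term B w (U w)) =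
    aff_moment B * (cauchy_integral d * \int[mu]_r pinned_mass B c0 r).
Proof.
move=> Bd c0m c0Z Um HU.
have HM w g i := @affmxE R m n d t0 B w i g.
have Mt (g : 'I_d.+1 -> R) y z := @affmx_tilt R m n d t0 B (g ord0) (fun c => g (lift ord0 c)) y z Bd.
have mM := @measurable_affmx R m n d t0 B.
split; first exact: (measurable_height_term Bd c0m mM measurable_alpha measurable_beta HM Um HU).
rewrite /aff_term (gauss_exp_height_change Bd c0m mM measurable_alpha measurable_beta HM Mt Um HU).
by rewrite lint_tilted_affine.
Qed.

Lemma lin_term_expectation (B : {set T}) (c0 : R -> bool) (U : (T * 'I_d -> R) -> (T -> R) -> bool) :
  #|B| = d -> measurable_fun [set: R] c0 ->
  (forall x r : R, (0 < x)%R -> c0 (x * r)%R = c0 r) ->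
  (forall w, measurable_fun [set: vec R T] (U w)) ->
  (forall w g y, (\det (linmx t0 B w) != 0)%R ->
    U w (lifted B 0 g y w) = under_cond B c0 0 y) ->
  measurable_fun [set: vec R (T * 'I_d)%type] (fun w => lin_term B w (U w)) /\
  gauss_exp (fun w => lin_term B w (U w)) =
    lin_moment B * (cauchy_integral d * pinned_mass B c0 0%R).
Proof.
move=> Bd c0m c0Z Um HU.
have HM w g i := @linmxE R m n d t0 B w i g.
have Mt (g : 'I_d -> R) y z := @linmx_tilt R m n d t0 B g y z Bd.
have mM := @measurable_linmx R m n d t0 B.
have ma : measurable_fun [set: vec R 'I_d] (fun=> 0%R : R) by [].
have mb : measurable_fun [set: vec R 'I_d] (fun g => g : vec R 'I_d) by exact: measurable_id.
split; first exact: (measurable_height_term Bd c0m mM ma mb HM Um HU).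
rewrite /lin_term (gauss_exp_height_change Bd c0m mM ma mb HM Mt Um HU).
by rewrite lint_tilted_linear.
Qed.

Lemma term_ge0 (x : R) (U : (T -> R) -> bool) : 0 <= `|x|%:E * 
  lint (enum {: T}) (fun h => (step_density h * (U h)%:R)%:E).
Proof.
rewrite mule_ge0 ?lee_fin// lint_ge0// => h.
by rewrite lee_fin mulr_ge0// step_density_ge0.
Qed.

Lemma EvolQ_sum : EvolQ R n d = \sum_(B : {set T} | #|B| == d.+1)
  (d`!%:R^-1)%:E * (aff_moment B * (cauchy_integral d * \int[mu]_r pinned_mass B (fun=> true) r)).
Proof.
pose U (B : {set T}) (w : T * 'I_d -> R) (h : T -> R) := upper (walk_pt w) (heights Some h) (@enum_set _ t0 d.+1 B).
have term (B : {set T}) : #|B| = d.+1 -> 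
  measurable_fun [set: vec R (T * 'I_d)%type] (fun w => aff_term B w (U B w)) /\
  gauss_exp (fun w => aff_term B w (U B w)) =
    aff_moment B * (cauchy_integral d * \int[mu]_r pinned_mass B (fun=> true) r).
  move=> Bd; apply: aff_term_expectation => //.
    move=> w; exact: (@measurable_upper _ _ _ _ _ _ _ _ (vec R T) id).
  move=> w g y M0; apply: upper_lifted => //; by rewrite unitmxE unitfE.
(* Terms of the wrong size are replaced by [0], because [gint_sum] asks for the measurability of
   every term. *)
transitivity (gauss_exp (fun w : T * 'I_d -> R => \sum_(B : {set T} | #|B| == d.+1)
    ((d`!%:R^-1)%:E * (if #|B| == d.+1 then aff_term B w (U B w) else 0)))).
  apply: eq_gint => w.
  have SI : injective (@Some T) by exact: Some_inj.
  rewrite (vol_hull_expansion t0 (walk_pt w) SI (@step_density_ge0 R m n)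
     (@measurable_step_density R m n) (@lint_step_density R m n)).
  by apply: eq_bigr => B Bd; rewrite Bd /aff_term muleA -EFinM mulrC.
have F0 (B : {set T}) w : 0 <= (if #|B| == d.+1 then aff_term B w (U B w) else 0).
  by case: ifP => // _; exact: term_ge0.
have mF (B : {set T}) : measurable_fun [set: vec R (T * 'I_d)%type]
    (fun w => if #|B| == d.+1 then aff_term B w (U B w) else 0).
  by case: eqP => // Bd; have [] := term B Bd.
rewrite /gauss_exp gint_sum ?enum_uniq//; last 2 first.
- by move=> B w; rewrite mule_ge0.
- by move=> B; exact: measurable_funeM.
apply: eq_bigr => B Bd; rewrite gint_Zl ?enum_uniq//; congr (_ * _).
by rewrite Bd; have [_ <-] := term B (eqP Bd).
Qed.

(** The first sum collects the simplices that avoid the origin, the second those that have it as a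
    vertex. *)
Lemma EvolQ0_sum : EvolQ0 R n d = \sum_(B : {set T} | #|B| == d.+1)
    (d`!%:R^-1)%:E * (aff_moment B * (cauchy_integral d * \int[mu]_r pinned_mass B (fun r => 0 <= r)%R r)) +
  \sum_(B : {set T} | #|B| == d)
    (d`!%:R^-1)%:E * (lin_moment B * (cauchy_integral d * pinned_mass B (fun=> true) 0%R)).
Proof.
pose U (A : {set option T}) (w : T * 'I_d -> R) (h : T -> R) := upper (walk_pt0 w) (heights id h) (@enum_set _ (Some t0) d.+1 A).
have Um A w : measurable_fun [set: vec R T] (U A w).
  exact: (@measurable_upper _ _ _ _ _ _ _ _ (vec R T) id).
have mpos : measurable_fun [set: R] (fun r : R => 0 <= r)%R by exact: measurable_fun_ler.
have terma (B : {set T}) : #|B| = d.+1 ->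
  measurable_fun [set: vec R (T * 'I_d)%type] (fun w => aff_term B w (U (somes B) w)) /\
  gauss_exp (fun w => aff_term B w (U (somes B) w)) =
    aff_moment B * (cauchy_integral d * \int[mu]_r pinned_mass B (fun r => 0 <= r)%R r).
  move=> Bd; apply: aff_term_expectation => //.
    by move=> x r x0; rewrite pmulr_rge0.
  move=> w g y M0; apply: upper_lifted0 => //; by rewrite unitmxE unitfE.
have terml (B : {set T}) : #|B| = d ->
  measurable_fun [set: vec R (T * 'I_d)%type] (fun w => lin_term B w (U (None |: somes B)%SET w)) /\
  gauss_exp (fun w => lin_term B w (U (None |: somes B)%SET w)) =
    lin_moment B * (cauchy_integral d * pinned_mass B (fun=> true) 0%R).
  move=> Bd; apply: lin_term_expectation => //.
  by move=> w g y M0; apply: upper_lifted_lin.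
pose G (A : {set option T}) (w : T * 'I_d -> R) := (d`!%:R^-1)%:E * (`|\det (ptmx (walk_pt0 w) (@enum_set _ (Some t0) d.+1 A))|%:E *
   lint (enum {: T}) (fun h => (step_density h * (U A w h)%:R)%:E)).
have Ga (B : {set T}) w : #|B| = d.+1 -> G (somes B) w = (d`!%:R^-1)%:E * aff_term B w (U (somes B) w).
  by move=> Bd; rewrite /G ptmx_somes.
have Gl (B : {set T}) w : #|B| = d -> G (None |: somes B)%SET w = (d`!%:R^-1)%:E * lin_term B w (U (None |: somes B)%SET w).
  by move=> Bd; rewrite /G det_ptmx_Nsomes.
transitivity (gauss_exp (fun w : T * 'I_d -> R =>
    \sum_(B : {set T}) (if #|B| == d.+1 then G (somes B) w else 0) +
    \sum_(B : {set T}) (if #|B| == d then G (None |: somes B)%SET w else 0))).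
  apply: eq_gint => w.
  have SI : injective (@id (option T)) by [].
  rewrite (vol_hull_expansion (Some t0) (walk_pt0 w) SI (@step_density_ge0 R m n)
     (@measurable_step_density R m n) (@lint_step_density R m n)).
  rewrite big_option_sets -!big_mkcond; congr (_ + _).
    by apply: eq_bigr => B _; rewrite /G muleA -EFinM mulrC.
  by apply: eq_bigr => B _; rewrite /G muleA -EFinM mulrC.
have G0 A w : 0 <= G A w by rewrite mule_ge0// term_ge0.
have Fa0 (B : {set T}) w : 0 <= (if #|B| == d.+1 then G (somes B) w else 0) by case: ifP.
have Fl0 (B : {set T}) w : 0 <= (if #|B| == d then G (None |: somes B)%SET w else 0) by case: ifP.
have mFa (B : {set T}) : measurable_fun [set: vec R (T * 'I_d)%type]
    (fun w => if #|B| == d.+1 then G (somes B) w else 0).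
  case: eqP => // Bd; rewrite (_ : (fun _ => _) = (fun w => (d`!%:R^-1)%:E * aff_term B w (U (somes B) w))).
    by apply: measurable_funeM; have [] := terma B Bd.
  by apply/funext => w; exact: Ga.
have mFl (B : {set T}) : measurable_fun [set: vec R (T * 'I_d)%type]
    (fun w => if #|B| == d then G (None |: somes B)%SET w else 0).
  case: eqP => // Bd; rewrite (_ : (fun _ => _) = (fun w => (d`!%:R^-1)%:E * lin_term B w (U (None |: somes B)%SET w))).
    by apply: measurable_funeM; have [] := terml B Bd.
  by apply/funext => w; exact: Gl.
rewrite /gauss_exp.
transitivity (gint (enum {: T * 'I_d}) (fun w => \sum_(b <- [:: true; false])
   (if b then \sum_(B : {set T}) (if #|B| == d.+1 then G (somes B) w else 0)
    else \sum_(B : {set T}) (if #|B| == d then G (None |: somes B)%SET w else 0)))).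
  by apply: eq_gint => w; rewrite 2!big_cons big_nil adde0.
rewrite gint_sum ?enum_uniq//; last 2 first.
- by move=> [] w; exact: sume_ge0.
- by move=> []; exact: measurable_sume.
rewrite 2!big_cons big_nil adde0; congr (_ + _).
  rewrite gint_sum ?enum_uniq// [RHS]big_mkcond; apply: eq_bigr => B _.
  case: eqP => [Bd|_]; last by rewrite gint_cst.
  have [mt <-] := terma B Bd; rewrite /gauss_exp -gint_Zl ?enum_uniq//.
    by apply: eq_gint => w; exact: Ga.
  by move=> w; exact: term_ge0.
rewrite gint_sum ?enum_uniq// [RHS]big_mkcond; apply: eq_bigr => B _.
case: eqP => [Bd|_]; last by rewrite gint_cst.
have [mt <-] := terml B Bd; rewrite /gauss_exp -gint_Zl ?enum_uniq//.
  by apply: eq_gint => w; exact: Gl.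
by move=> w; exact: term_ge0.
Qed.

End volume_expectations.

(** * Second moments of Gaussian determinants *)

Section quadratic_moments.
Context {R : realType}.
Local Notation mu := (@lebesgue_measure R).
Local Open Scope ereal_scope.

Lemma gint_quad (I : eqType) (s : seq I) (A : R) (a : I -> R) : uniq s ->
  gint s (fun w => ((A + \sum_(i <- s) a i * w i) ^+ 2)%:E) =
  (A ^+ 2 + \sum_(i <- s) a i ^+ 2)%:E.
Proof.
elim: s A => [|i s IH] A /=; first by rewrite !big_nil !addr0.
move=> /andP[ins us].
pose C := (\sum_(j <- s) a j ^+ 2)%R.
have C0 : (0 <= C)%R by rewrite sumr_ge0// => j _; exact: sqr_ge0.
transitivity (\int[mu]_x ((phi x * (A + a i * x) ^+ 2)%:E + (phi x * C)%:E)).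
  apply: eq_integral => x _; rewrite -EFinD -mulrDr EFinM; congr (_ * _).
  rewrite -IH//; apply: eq_gint => w; congr (_ ^+ 2)%:E.
  rewrite big_cons updE addrA; congr (_ + _)%R; apply: eq_big_seq => j js.
  by rewrite upd_neq//; apply: contraNneq ins => <-.
have mphi : measurable_fun [set: R] (fun x : R => phi x) by exact: measurable_phi.
rewrite ge0_integralD//; first last.
- by apply/measurable_EFinP; exact: measurable_funM.
- by move=> x _; rewrite lee_fin mulr_ge0 ?phi_ge0.
- apply/measurable_EFinP; apply: measurable_funM => //; apply: measurable_funX.
  by apply: measurable_funD => //; exact: measurable_funM.
- by move=> x _; rewrite lee_fin mulr_ge0 ?phi_ge0 ?sqr_ge0.
have eC : \int[mu]_x (phi x * C)%:E = C%:E.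
  have := @gint_cst R I [:: i] C%:E; rewrite /= lee_fin => <-//.
rewrite gauss_quad eC -EFinD; congr EFin.
by rewrite big_cons addrA.
Qed.

Variables (T : finType) (d : nat).
Local Notation Om := (T * 'I_d)%type.

Definition block_sum (b : {set T}) (c : 'I_d) (w : Om -> R) : R := (\sum_(t in b) w (t, c))%R.

Lemma measurable_block_sum b c : measurable_fun [set: vec R Om] (block_sum b c).
Proof. by apply: measurable_sumr => t _; exact: measurable_coord. Qed.

(** The steps in [b] are integrated first: neither [A] nor the cofactors depend on them, and the
    block sums are centred Gaussians of variance [#|b|], independent because [g] is injective. *)
Lemma row_moment k (g : 'I_k -> 'I_d) (b : {set T}) (A : (Om -> R) -> R) (cof : 'I_k -> (Om -> R) -> R) :
  injective g -> measurable_fun [set: vec R Om] A ->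
  (forall j, measurable_fun [set: vec R Om] (cof j)) ->
  (forall w w', (forall t c, t \notin b -> w (t, c) = w' (t, c)) -> A w = A w') ->
  (forall j w w', (forall t c, t \notin b -> w (t, c) = w' (t, c)) -> cof j w = cof j w') ->
  gauss_exp (fun w : Om -> R => ((A w + \sum_j block_sum b (g j) w * cof j w) ^+ 2)%:E) =
  gauss_exp (fun w : Om -> R => (A w ^+ 2 + #|b|%:R * \sum_j cof j w ^+ 2)%:E).
Proof.
move=> gI mA mcof Aw cofw.
pose s := [seq (t, g j) | t <- enum b, j <- enum 'I_k].
have us : uniq s.
  apply: allpairs_uniq; [exact: enum_uniq|exact: enum_uniq|].
  by move=> [t j] [t' j'] _ _ /= [-> /gI ->].
have bs p : p \in s -> p.1 \in b.
  by move=> /allpairsP[[t j] /= [tb _ ->]]; rewrite mem_enum in tb.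
rewrite /gauss_exp (gint_tower (t := s)) ?enum_uniq//; first last.
- apply/measurable_EFinP; apply: measurable_funX; apply: measurable_funD => //.
  by apply: measurable_sumr => j _; apply: measurable_funM => //; exact: measurable_block_sum.
- by move=> w; rewrite lee_fin sqr_ge0.
- by move=> p _; rewrite mem_enum.
apply: eq_gint => w.
pose a (p : Om) := (\sum_(j | g j == p.2) cof j w)%R.
have aE t j : a (t, g j) = cof j w.
  by rewrite /a (big_pred1 j)// => j' /=; exact: inj_eq.
transitivity (gint s (fun v => ((A w + \sum_(p <- s) a p * v p) ^+ 2)%:E)).
  apply: eq_gint => v; congr (_ ^+ 2)%:E.
  have mw t c : t \notin b -> mrg s v w (t, c) = w (t, c).
    by move=> tb; rewrite /mrg; case: ifP => // /bs /= tb'; rewrite tb' in tb.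
  rewrite (Aw _ w)//; congr (_ + _)%R; rewrite /s big_allpairs_dep exchange_big big_enum /=.
  apply: eq_bigr => j _; rewrite (cofw _ _ w)// /block_sum mulr_suml big_enum /=.
  apply: eq_bigr => t tb; rewrite aE mulrC; congr (_ * _)%R.
  rewrite /mrg ifT//; apply/allpairsP; exists (t, j); split => //; by rewrite mem_enum.
rewrite gint_quad//; congr (_ + _)%:E.
rewrite /s big_allpairs_dep (eq_bigr (fun=> \sum_j cof j w ^+ 2))%R; last first.
  by move=> t _; rewrite big_enum /=; apply: eq_bigr => j _; rewrite aE.
by rewrite big_enum /= sumr_const mulr_natl.
Qed.

Definition lin_rows k (b : 'I_k -> {set T}) (g : 'I_k -> 'I_d) (w : Om -> R) : 'M[R]_k :=
  (\matrix_(i, j) block_sum (b i) (g j) w)%R.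

Definition aff_rows k (e : 'I_k.+1 -> R) (b : 'I_k.+1 -> {set T}) (g : 'I_k -> 'I_d) (w : Om -> R) :
    'M[R]_k.+1 :=
  (\matrix_(i, j) if unlift ord0 j is Some c then block_sum (b i) (g c) w else e i)%R.

Lemma measurable_lin_rows k (b : 'I_k -> {set T}) g : measurable_fun [set: vec R Om]
  (fun w => \det (lin_rows b g w)).
Proof.
apply: measurable_det => i j; rewrite (_ : (fun _ => _) = block_sum (b i) (g j)).
  exact: measurable_block_sum.
by apply/funext => w; rewrite mxE.
Qed.

Lemma measurable_aff_rows k e (b : 'I_k.+1 -> {set T}) g : measurable_fun [set: vec R Om]
  (fun w => \det (aff_rows e b g w)).
Proof.
apply: measurable_det => i j.
rewrite (_ : (fun _ => _) = (fun w => if unlift ord0 j is Some c then block_sum (b i) (g c) w else e i)).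
  by case: unlift => // c; exact: measurable_block_sum.
by apply/funext => w; rewrite mxE.
Qed.

(** Expansion along the first row: the minors are determinants of the same kind in the remaining
    blocks, with columns chosen by [g], and the equal contributions build up the factorial. *)
Lemma lin_rows_moment k (b : 'I_k -> {set T}) (g : 'I_k -> 'I_d) : injective g ->
  (forall i j t, t \in b i -> t \in b j -> i = j) ->
  gauss_exp (fun w : Om -> R => (\det (lin_rows b g w) ^+ 2)%:E) =
  (k`!%:R * \prod_i #|b i|%:R)%:E.
Proof.
elim: k b g => [|k IH] b g gI bD.
  rewrite big_ord0 mulr1 -[RHS](@gint_cst R _ (enum {: Om})) ?lee_fin//; apply: eq_gint => w.
  by rewrite det_mx00 expr1n.
pose b' (i : 'I_k) := b (lift ord0 i); pose g' (j : 'I_k.+1) (i : 'I_k) := g (lift j i).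
have b'D i j t : t \in b' i -> t \in b' j -> i = j by move=> h /(bD _ _ _ h) /lift_inj.
have g'I j : injective (g' j) by move=> x y /gI /lift_inj.
pose cof (j : 'I_k.+1) (w : Om -> R) : R := ((-1) ^+ (0 + j) * \det (lin_rows b' (g' j) w))%R.
have cofE w j : cofactor (lin_rows b g w) ord0 j = cof j w.
  by rewrite /cofactor /cof; congr (_ * \det _)%R; apply/matrixP => x y; rewrite !mxE.
have b0' i t : t \in b' i -> t \notin b ord0.
  by move=> tb; apply/negP => /(bD _ _ _ tb).
transitivity (gauss_exp (fun w : Om -> R =>
    ((0 + \sum_j block_sum (b ord0) (g j) w * cof j w) ^+ 2)%:E)).
  apply: eq_gint => w; rewrite (expand_det_row _ ord0) add0r; congr (_ ^+ 2)%:E.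
  by apply: eq_bigr => j _; rewrite cofE mxE.
rewrite (row_moment (A := fun=> 0%R))//; first last.
- move=> j w w' ww'; congr (_ * \det _)%R; apply/matrixP => x y; rewrite !mxE.
  by apply: eq_bigr => t /b0' tb; exact: ww'.
- by move=> j; apply: measurable_funM => //; exact: measurable_lin_rows.
transitivity (gauss_exp (fun w : Om -> R =>
    \sum_j (#|b ord0|%:R%:E * (\det (lin_rows b' (g' j) w) ^+ 2)%:E))).
  apply: eq_gint => w; rewrite expr0n /= add0r mulr_sumr -sumEFin; apply: eq_bigr => j _.
  by rewrite -EFinM; congr (_ * _)%:E; rewrite /cof exprMn sqrr_sign mul1r.
rewrite /gauss_exp gint_sum ?enum_uniq//; last 2 first.
- by move=> j w; rewrite mule_ge0 ?lee_fin// sqr_ge0.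
- move=> j; apply: emeasurable_funM => //; apply/measurable_EFinP; apply: measurable_funX.
  exact: measurable_lin_rows.
transitivity (\sum_(j < k.+1) (#|b ord0|%:R * (k`!%:R * \prod_i #|b' i|%:R) : R)%:E).
  apply: eq_bigr => j _; rewrite gint_Zl ?enum_uniq ?lee_fin//; last 2 first.
  - by move=> w; rewrite lee_fin sqr_ge0.
  - by apply/measurable_EFinP; apply: measurable_funX; exact: measurable_lin_rows.
  by rewrite [RHS]EFinM; congr (_ * _); exact: IH.
rewrite sumEFin sumr_const card_ord; congr EFin.
by rewrite factS natrM big_ord_recl -mulr_natl; ring.
Qed.

(** Expansion along the first row: the constant entry leads to a determinant without constant
    column, the other entries to smaller determinants of the present kind. *)
Lemma aff_rows_moment k (e : 'I_k.+1 -> R) (b : 'I_k.+1 -> {set T}) (g : 'I_k -> 'I_d) : injective g ->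
  (forall i j t, t \in b i -> t \in b j -> i = j) ->
  gauss_exp (fun w : Om -> R => (\det (aff_rows e b g w) ^+ 2)%:E) =
  (\sum_i e i ^+ 2 * (k`!%:R * \prod_(i' | i' != i) #|b i'|%:R))%:E.
Proof.
elim: k e b g => [|k IH] e b g gI bD.
  rewrite big_ord1 big1 ?mulr1 => [|i]; last by rewrite (ord1 i).
  rewrite -[RHS](@gint_cst R _ (enum {: Om})) ?lee_fin ?sqr_ge0//; apply: eq_gint => w.
  by rewrite det_mx11 mxE unlift_none.
pose e' (i : 'I_k.+1) := e (lift ord0 i); pose b' (i : 'I_k.+1) := b (lift ord0 i); pose g' (j : 'I_k.+1) (i : 'I_k) := g (lift j i).
have b'D i j t : t \in b' i -> t \in b' j -> i = j by move=> h /(bD _ _ _ h) /lift_inj.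
have g'I j : injective (g' j) by move=> x y /gI /lift_inj.
pose A (w : Om -> R) : R := (e ord0 * \det (lin_rows b' g w))%R.
pose cof (j : 'I_k.+1) (w : Om -> R) : R := ((-1) ^+ (0 + lift ord0 j) * \det (aff_rows e' b' (g' j) w))%R.
have liftE (j : 'I_k.+1) (y : 'I_k) : lift (lift ord0 j) (lift ord0 y) = lift ord0 (lift j y).
  by apply: val_inj; rewrite /= /bump /= !add1n ltnS; case: leqP.
have cofE w j : cofactor (aff_rows e b g w) ord0 (lift ord0 j) = cof j w.
  rewrite /cofactor /cof; congr (_ * \det _)%R; apply/matrixP => x y; rewrite !mxE.
  case: (unliftP ord0 y) => [y' ->|->]; first by rewrite liftE liftK.
  suff -> : lift (lift ord0 j) ord0 = ord0 by rewrite unlift_none.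
  exact: val_inj.
have cof0 w : cofactor (aff_rows e b g w) ord0 ord0 = \det (lin_rows b' g w).
  rewrite /cofactor expr0 mul1r; congr (\det _); apply/matrixP => x y; rewrite !mxE.
  by rewrite liftK.
have b0' i t : t \in b' i -> t \notin b ord0.
  by move=> tb; apply/negP => /(bD _ _ _ tb).
transitivity (gauss_exp (fun w : Om -> R =>
    ((A w + \sum_j block_sum (b ord0) (g j) w * cof j w) ^+ 2)%:E)).
  apply: eq_gint => w; rewrite (expand_det_row _ ord0) big_ord_recl; congr ((_ + _) ^+ 2)%:E.
    by rewrite cof0 mxE unlift_none.
  by apply: eq_bigr => j _; rewrite cofE mxE liftK.
rewrite row_moment//; first last.
- move=> j w w' ww'; congr (_ * \det _)%R; apply/matrixP => x y; rewrite !mxE.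
  case: unlift => // c; by apply: eq_bigr => t /b0' tb; exact: ww'.
- move=> w w' ww'; congr (_ * \det _)%R; apply/matrixP => x y; rewrite !mxE.
  by apply: eq_bigr => t /b0' tb; exact: ww'.
- by move=> j; apply: measurable_funM => //; exact: measurable_aff_rows.
- by apply: measurable_funM => //; exact: measurable_lin_rows.
pose Z (o : option 'I_k.+1) (w : Om -> R) : \bar R :=
  if o is Some j then #|b ord0|%:R%:E * (\det (aff_rows e' b' (g' j) w) ^+ 2)%:E
  else (e ord0 ^+ 2)%:E * (\det (lin_rows b' g w) ^+ 2)%:E.
transitivity (gauss_exp (fun w : Om -> R => \sum_(o <- None :: [seq Some j | j <- enum 'I_k.+1]) Z o w)).
  apply: eq_gint => w; rewrite big_cons big_map big_enum /= -EFinM /A exprMn EFinD; congr (_ + _).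
  rewrite mulr_sumr -sumEFin; apply: eq_bigr => j _.
  by rewrite -EFinM; congr (_ * _)%:E; rewrite /cof exprMn sqrr_sign mul1r.
rewrite /gauss_exp gint_sum ?enum_uniq//; last 2 first.
- by move=> [j|] w; rewrite mule_ge0 ?lee_fin// sqr_ge0.
- move=> [j|]; apply: emeasurable_funM => //; apply/measurable_EFinP; apply: measurable_funX.
    exact: measurable_aff_rows.
  exact: measurable_lin_rows.
rewrite big_cons big_map big_enum /=.
have -> : gint (enum {: Om}) (Z None) = (e ord0 ^+ 2 * (k.+1`!%:R * \prod_i #|b' i|%:R))%:E.
  rewrite gint_Zl ?enum_uniq ?lee_fin ?sqr_ge0//; last 2 first.
  - by move=> w; rewrite lee_fin sqr_ge0.
  - by apply/measurable_EFinP; apply: measurable_funX; exact: measurable_lin_rows.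
  by rewrite [RHS]EFinM; congr (_ * _); exact: lin_rows_moment.
transitivity ((e ord0 ^+ 2 * (k.+1`!%:R * \prod_i #|b' i|%:R))%:E +
   \sum_(j < k.+1) (#|b ord0|%:R * \sum_i e' i ^+ 2 * (k`!%:R * \prod_(i' | i' != i) #|b' i'|%:R) : R)%:E).
  congr (_ + _); apply: eq_bigr => j _; rewrite gint_Zl ?enum_uniq ?lee_fin//; last 2 first.
  - by move=> w; rewrite lee_fin sqr_ge0.
  - by apply/measurable_EFinP; apply: measurable_funX; exact: measurable_aff_rows.
  by rewrite [RHS]EFinM; congr (_ * _); exact: IH.
rewrite sumEFin sumr_const card_ord -EFinD; congr EFin.
rewrite [RHS]big_ord_recl; congr (_ + _)%R.
  by congr (_ * (_ * _))%R; rewrite [RHS]big_mkcond [RHS]big_ord_recl /= mul1r.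
rewrite -[LHS]mulr_natl mulrA mulr_sumr; apply: eq_bigr => i _.
have -> : (\prod_(i' | i' != lift ord0 i) #|b i'|%:R =
    #|b ord0|%:R * \prod_(i' | i' != i) #|b' i'|%:R :> R)%R.
  by rewrite big_mkcond big_ord_recl /= [in RHS]big_mkcond.
by rewrite factS natrM /e'; ring.
Qed.

End quadratic_moments.

(** * Steps grouped by the points of a configuration *)

Section block_decomposition.
Context {R : realType}.
Local Open Scope ereal_scope.
Variables (m : nat) (n : 'I_m -> nat) (d : nat).
Local Notation T := (PT n).
Local Notation pt i := (Tagged (fun l => 'I_(n l)) i).
Variables (t0 : T) (B : {set T}).

Definition stepno (p : T) : nat := nat_of_ord (tagged p).

(* The steps between [p] and the previous point of [B] in the same walk. *)
Definition gap (p : T) : {set T} :=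
  [set t : T | [&& tag t == tag p, (stepno t <= stepno p)%N &
    [forall q : T, (q \in B) && (tag q == tag p) && (stepno q < stepno p)%N ==> (stepno q < stepno t)%N]]]%SET.

Definition first_in (p : T) : bool :=
  [forall q : T, (q \in B) && (tag q == tag p) ==> (stepno p <= stepno q)%N].

Lemma gap_inj p q t : p \in B -> q \in B -> t \in gap p -> t \in gap q -> p = q.
Proof.
rewrite !inE => pB qB /and3P[/eqP tp tlp /forallP hp] /and3P[/eqP tq tlq /forallP hq].
have pq : tag p = tag q by rewrite -tp tq.
have := hp q; have := hq p; rewrite pB qB (introT eqP pq) (introT eqP (esym pq)) /= => h1 h2.
apply: (eq_PT pq); apply/eqP; rewrite eqn_leq; apply/andP; split.
  by rewrite leqNgt; apply/negP => qp; move: h2; rewrite qp /= ltnNge tlq.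
by rewrite leqNgt; apply/negP => lpq; move: h1; rewrite lpq /= ltnNge tlp.
Qed.

Lemma gap_cover t p : p \in B -> tag t = tag p -> (stepno t <= stepno p)%N ->
  exists2 q, q \in B & [/\ tag q = tag p, (stepno q <= stepno p)%N & t \in gap q].
Proof.
move=> pB tp tlp.
pose Q q := [&& q \in B, tag q == tag p & (stepno t <= stepno q)%N].
have Qp : Q p by rewrite /Q pB eqxx.
have [q /and3P[qB /eqP qp tq] qmin] := @arg_minnP _ p Q stepno Qp.
exists q => //; split => //; first exact: qmin.
rewrite inE tq qp tp eqxx /=; apply/forallP => q'; apply/implyP => /andP[/andP[q'B q'p] q'q].
rewrite ltnNge; apply/negP => tq'.
have := qmin q'; rewrite /Q q'B q'p tq' => /(_ isT); by rewrite leqNgt q'q.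
Qed.

(** The gaps of the points of [B] up to [p] partition the steps of its walk up to [p], which makes a
    point of [B] a sum of independent gap sums. *)
Lemma sum_gaps (V : nmodType) (F : T -> V) p : p \in B ->
  (\sum_(t | (tag t == tag p) && (stepno t <= stepno p)%N) F t =
   \sum_(q in B | (tag q == tag p) && (stepno q <= stepno p)%N) \sum_(t in gap q) F t)%R.
Proof.
move=> pB.
pose Q q := (q \in B) && ((tag q == tag p) && (stepno q <= stepno p)%N).
pose nx t := odflt p [pick q | Q q && (t \in gap q)].
have nxP t : (tag t == tag p) && (stepno t <= stepno p)%N -> Q (nx t) /\ t \in gap (nx t).
  move=> /andP[/eqP tp tlp]; rewrite /nx; case: pickP => [q /andP[]//|].
  have [q qB [qp qlp tq]] := gap_cover pB tp tlp.
  by move=> /(_ q); rewrite /Q qB qp eqxx qlp tq.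
rewrite (partition_big nx Q) => [|t /nxP[]//]; apply: eq_bigr => q Qq.
apply: eq_bigl => t; apply/andP/idP => [[tp /eqP <-]|tq]; first by have [] := nxP t tp.
move: Qq => /and3P[qB /eqP qp qlp].
have tp : (tag t == tag p) && (stepno t <= stepno p)%N.
  move: (tq); rewrite inE => /and3P[/eqP -> tlq _].
  by rewrite qp eqxx (leq_trans tlq).
split => //; have [/andP[nB _] tn] := nxP t tp.
by apply/eqP; exact: (gap_inj nB qB tn tq).
Qed.

(** This writes the column of ones as [prec_mx] applied to the indicator of the first points. *)
Lemma sum_first p : p \in B ->
  (\sum_(q in B | (tag q == tag p) && (stepno q <= stepno p)%N) (first_in q)%:R = 1 :> R)%R.
Proof.
move=> pB.
pose Q q := (q \in B) && (tag q == tag p).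
have Qp : Q p by rewrite /Q pB eqxx.
have [q /andP[qB /eqP qp] qmin] := @arg_minnP _ p Q stepno Qp.
have fq : first_in q.
  by apply/forallP => q'; apply/implyP => /andP[q'B q'q]; apply: qmin; rewrite /Q q'B -qp.
rewrite (bigD1 q) /=; last by rewrite qB qp eqxx qmin.
rewrite fq big1 ?addr0// => q' /andP[/andP[q'B /andP[q'p _]] q'q].
case: (boolP (first_in q')) => // /forallP/(_ q).
rewrite qB qp (eqP q'p) eqxx /= => h; case/eqP: q'q; apply: eq_PT; first by rewrite qp (eqP q'p).
by apply/eqP; rewrite eqn_leq h qmin// /Q q'B.
Qed.

Lemma enum_PT_eq : enum {: T} = flatten [seq [seq pt i | i <- enum 'I_(n l)] | l <- enum 'I_m].
Proof.
rewrite enumT [in LHS]unlock /= /tag_enum -enumT.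
by congr flatten; apply: eq_map => l; rewrite -enumT.
Qed.

(** The order that the enumeration of [T] respects: steps of one walk are increasing, and nothing is
    asked between different walks. *)
Definition ltPT (p q : T) : bool := (tag p == tag q) ==> (stepno p < stepno q)%N.

Lemma pairwise_enum_PT : pairwise ltPT (enum {: T}).
Proof.
rewrite enum_PT_eq; have := enum_uniq 'I_m; elim: (enum 'I_m) => //= l ls IH /andP[lls uls].
rewrite pairwise_cat IH// andbT; apply/andP; split.
  apply/allrelP => p q /mapP[i _ ->] /flatten_mapP[k kls /mapP[j _ ->]].
  by rewrite /ltPT /=; case: eqP => // lk; rewrite lk kls in lls.
rewrite pairwise_map; apply: (sub_pairwise (r := relpre val ltn)).
  by move=> i j /= ij; rewrite /ltPT /= eqxx.
by rewrite -pairwise_map val_enum_ord -sorted_pairwise ?iota_ltn_sorted//; exact: ltn_trans.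
Qed.

Lemma pairwise_enum_set : pairwise ltPT (enum B).
Proof.
rewrite enum_filter; apply: subseq_pairwise pairwise_enum_PT; exact: filter_subseq.
Qed.

Variable k : nat.
Hypothesis Bk : #|B| = k.
Let b : 'I_k -> T := enum_set t0 B.

Let bB i : b i \in B. Proof. exact: mem_enum_set. Qed.
Let bI : injective b. Proof. exact: enum_set_inj. Qed.

(** Passage from the gap sums to the points of [B]; lower triangular with unit diagonal in the order
    of the enumeration. *)
Definition prec_mx : 'M[R]_k :=
  (\matrix_(i, j) ((tag (b j) == tag (b i)) && (stepno (b j) <= stepno (b i))%N)%:R)%R.

Lemma det_prec_mx : (\det prec_mx = 1)%R.
Proof.
rewrite det_trig; first by rewrite big1// => i _; rewrite mxE eqxx leqnn.
apply/is_trig_mxP => i j ij; rewrite mxE.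
have := pairwiseP t0 pairwise_enum_set i j; rewrite !inE -!cardE Bk !ltn_ord => /(_ isT isT ij).
rewrite -[nth t0 (enum B) i]/(b i) -[nth t0 (enum B) j]/(b j) /ltPT.
by rewrite eq_sym; case: eqP => //= _; rewrite ltnNge => /negbTE ->.
Qed.

Lemma big_enum_set (S : Type) (idx : S) (op : Monoid.com_law idx) (Q : pred T) (F : T -> S) :
  \big[op/idx]_(q in B | Q q) F q = \big[op/idx]_(j < k | Q (b j)) F (b j).
Proof. by rewrite -big_enum_cond -(map_enum_set t0 Bk) big_map big_enum_cond. Qed.

Lemma gap_enum_inj i j t : t \in gap (b i) -> t \in gap (b j) -> i = j.
Proof. by move=> ti tj; apply: bI; exact: (gap_inj (bB i) (bB j) ti tj). Qed.

End block_decomposition.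

Section walk_moments.
Context {R : realType}.
Local Open Scope ereal_scope.
Variables (m : nat) (n : 'I_m -> nat) (d : nat).
Local Notation T := (PT n).
Variables (t0 : T) (B : {set T}).

Lemma walk_pt_gaps (w : T * 'I_d -> R) k i c (Bk : #|B| = k) (b : 'I_k -> T := enum_set t0 B) :
  (walk_pt w (b i) c = \sum_j (prec_mx t0 B k : 'M[R]_k) i j * block_sum (gap B (b j)) c w)%R.
Proof.
rewrite /walk_pt (sum_gaps (B := B) (fun t => w (t, c))); last exact: mem_enum_set.
rewrite (big_enum_set t0 Bk) big_mkcond; apply: eq_bigr => j _.
by rewrite mxE -/(b _) -/(b _); case: ifP => _; rewrite ?mul1r ?mul0r.
Qed.

(** The matrix of the points is [prec_mx], of determinant one, times a matrix whose rows are
    independent gap sums. *)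
Lemma lin_momentE : #|B| = d ->
  lin_moment d t0 B = (d`!%:R * \prod_(p in B) #|gap B p|%:R : R)%:E.
Proof.
move=> Bd; rewrite /lin_moment.
transitivity (gauss_exp (fun w : T * 'I_d -> R =>
    (\det (lin_rows (fun i => gap B (@enum_set _ t0 d B i)) id w) ^+ 2)%:E)).
  apply: eq_gint => w; congr (_ ^+ 2)%:E.
  rewrite -[RHS]mul1r -(det_prec_mx t0 Bd) -det_mulmx; congr (\det _).
  apply/matrixP => i c; rewrite [LHS]mxE (walk_pt_gaps _ _ _ Bd) [RHS]mxE.
  by apply: eq_bigr => j _; rewrite [X in _ = (_ * X)%R]mxE.
rewrite lin_rows_moment//; last by move=> i j t; exact: gap_enum_inj.
by have := @big_enum_set _ _ t0 B d Bd R 1%R *%R xpredT (fun p => #|gap B p|%:R); rewrite big_andbC /= => ->.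
Qed.

(** The same factorization puts the constant column on the first points only, so only a first point
    can be left out of the product of gap sizes. *)
Lemma aff_momentE : #|B| = d.+1 ->
  aff_moment d t0 B = (d`!%:R * \sum_(p in B | first_in B p)
     \prod_(q in B | q != p) #|gap B q|%:R : R)%:E.
Proof.
move=> Bd; rewrite /aff_moment.
pose b := @enum_set _ t0 d.+1 B.
transitivity (gauss_exp (fun w : T * 'I_d -> R =>
    (\det (aff_rows (fun i => (first_in B (b i))%:R) (fun i => gap B (b i)) id w) ^+ 2)%:E)).
  apply: eq_gint => w; congr (_ ^+ 2)%:E.
  rewrite -[RHS]mul1r; move: (det_prec_mx (R := R) t0 Bd) => {1}<-; rewrite -det_mulmx; congr (\det _).
  apply/matrixP => i c; rewrite [RHS]mxE; case: (unliftP ord0 c) => [c' ->|->].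
    rewrite [LHS]mxE extrowS (walk_pt_gaps _ _ _ Bd).
    by apply: eq_bigr => j _; rewrite [X in _ = (_ * X)%R]mxE liftK.
  have := @sum_first R _ _ B _ (@mem_enum_set _ t0 _ B i Bd).
  rewrite ptmx0 => {1}<-; rewrite (big_enum_set t0 Bd) big_mkcond.
  apply: eq_bigr => j _; rewrite [X in _ = (_ * X)%R]mxE unlift_none mxE.
  by case: ifP => _; rewrite ?mul1r ?mul0r.
rewrite aff_rows_moment//; last by move=> i j t; exact: gap_enum_inj.
congr EFin; rewrite mulr_sumr (big_enum_set t0 Bd) [RHS]big_mkcond; apply: eq_bigr => i _.
rewrite -/(b i); case: (first_in _ _); last by rewrite expr0n mul0r.
rewrite expr1n mul1r (big_enum_set t0 Bd); congr (_ * _)%R; apply: eq_bigl => j.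
by rewrite (inj_eq (enum_set_inj Bd)).
Qed.

End walk_moments.

(** * Evaluation of the configurations *)

Section mask_positions.
Implicit Types b : seq bool.

Definition mask_pos b : seq nat := [seq j.+1 | j <- iota 0 (size b) & nth false b j].

Definition mask_gaps b : seq nat := pairmap (fun x y => y - x)%N 0%N (mask_pos b).

(** The size of the gap ending at [j], counted by the same condition as [gap] so that the two can be
    matched. *)
Definition run_length b j : nat :=
  count (fun i => (i <= j)%N && all (fun i' => ~~ nth false b i') (iota i (j - i))) (iota 0 (size b)).

(** Induction from one marked position to the next, in the shape of [walkV_cat]. *)
Lemma mask_ind (P : seq bool -> Prop) : (forall a, P (nseq a false)) ->
  (forall a b, P b -> P (nseq a false ++ true :: b)) -> forall b, P b.
Proof.
move=> P0 P1 b; rewrite -[b]/(nseq 0 false ++ b).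
elim: b 0%N => [|[] b IH] a; first by rewrite cats0.
  by apply: P1; exact: (IH 0%N).
by have := IH a.+1; rewrite -addn1 nseqD -catA.
Qed.

Lemma nth_prefix a b j : nth false (nseq a false ++ true :: b) j =
  if (j < a)%N then false else if j == a then true else nth false b (j - a.+1).
Proof.
rewrite nth_cat size_nseq nth_nseq; case: ltnP => // aj.
have [->|ja] := eqVneq j a; first by rewrite subnn.
have {}ja : (a < j)%N by rewrite ltn_neqAle eq_sym ja.
by rewrite -(subnSK ja).
Qed.

Lemma nth_prefixS a b j : nth false (nseq a false ++ true :: b) (a.+1 + j) = nth false b j.
Proof.
rewrite nth_prefix (_ : (a.+1 + j < a)%N = false); last by apply/negbTE; lia.
by rewrite (_ : (a.+1 + j == a)%N = false) ?addKn//; apply/negbTE; lia.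
Qed.

Lemma iota_prefix a k : iota 0 (a + k.+1) = iota 0 a ++ a :: [seq (a.+1 + j)%N | j <- iota 0 k].
Proof. by rewrite iotaD add0n /= -iotaDl addn0. Qed.

Lemma size_nseq_true a b : size (nseq a false ++ true :: b) = (a + (size b).+1)%N.
Proof. by rewrite size_cat size_nseq. Qed.

Lemma filter_prefix a b : [seq j <- iota 0 (size (nseq a false ++ true :: b)) |
    nth false (nseq a false ++ true :: b) j] =
  a :: [seq (a.+1 + j)%N | j <- iota 0 (size b) & nth false b j].
Proof.
rewrite size_nseq_true iota_prefix filter_cat /= nth_prefix ltnn eqxx.
rewrite (eq_in_filter (a2 := pred0)) ?filter_pred0 /=; last first.
  by move=> j; rewrite mem_iota /= add0n nth_prefix => ->.
rewrite filter_map; congr (_ :: map _ _); apply: eq_filter => j /=.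
exact: nth_prefixS.
Qed.

Lemma mask_pos_nseq a : mask_pos (nseq a false) = [::].
Proof.
rewrite /mask_pos (eq_in_filter (a2 := pred0)) ?filter_pred0// => j _.
by rewrite nth_nseq if_same.
Qed.

Lemma mask_pos_prefix a b :
  mask_pos (nseq a false ++ true :: b) = a.+1 :: [seq (a.+1 + x)%N | x <- mask_pos b].
Proof.
rewrite /mask_pos filter_prefix /= -!map_comp; congr (_ :: _).
by apply: eq_map => j /=; rewrite addnS.
Qed.

Lemma pairmap_shift k x s :
  pairmap (fun x y => y - x)%N (k + x)%N [seq (k + y)%N | y <- s] = pairmap (fun x y => y - x)%N x s.
Proof. by elim: s x => //= y s IH x; rewrite IH subnDl. Qed.

Lemma mask_gaps_prefix a b :
  mask_gaps (nseq a false ++ true :: b) = a.+1 :: mask_gaps b.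
Proof. by rewrite /mask_gaps mask_pos_prefix /= subn0 -[X in pairmap _ X](addn0 a.+1) pairmap_shift. Qed.

Lemma last_pos_prefix a b :
  last 0%N (mask_pos (nseq a false ++ true :: b)) = (a.+1 + last 0%N (mask_pos b))%N.
Proof. by rewrite mask_pos_prefix /= -[X in last X _](addn0 a.+1) last_map. Qed.

Lemma run_length_prefix0 a b : run_length (nseq a false ++ true :: b) a = a.+1.
Proof.
rewrite /run_length size_nseq_true iota_prefix count_cat /= leqnn subnn /=.
rewrite (eq_in_count (a2 := predT)) ?count_predT ?size_iota; last first.
  move=> i; rewrite mem_iota /= add0n => ia; rewrite (ltnW ia) /=.
  by apply/allP => j; rewrite mem_iota nth_prefix => /andP[_]; rewrite subnKC ?(ltnW ia)// => ->.
rewrite (eq_in_count (a2 := pred0)) ?count_pred0 ?addn1// => j /mapP[i _ ->].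
by rewrite leqNgt ltnS leq_addr.
Qed.

Lemma run_length_prefixS a b j :
  run_length (nseq a false ++ true :: b) (a.+1 + j) = run_length b j.
Proof.
rewrite /run_length size_nseq_true iota_prefix count_cat /= count_map.
have bad i : (i <= a)%N -> all (fun i' => ~~ nth false (nseq a false ++ true :: b) i') (iota i (a.+1 + j - i)) = false.
  move=> ia; apply/negbTE/allPn; exists a; last by rewrite negbK nth_prefix ltnn eqxx.
  by rewrite mem_iota ia /=; lia.
rewrite (eq_in_count (a2 := pred0)) ?count_pred0; last first.
  by move=> i; rewrite mem_iota /= add0n => ia; rewrite bad ?andbF// ltnW.
rewrite bad// andbF /= !add0n; apply: eq_count => i /=.
rewrite leq_add2l subnDl; congr andb; rewrite [iota (_ + _) _]iotaDl all_map.
by apply: eq_all => i'; rewrite /= nth_prefixS.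
Qed.

Lemma run_lengthE b :
  [seq run_length b j | j <- iota 0 (size b) & nth false b j] = mask_gaps b.
Proof.
elim/mask_ind: b => [a|a b IH].
  rewrite /mask_gaps mask_pos_nseq (eq_in_filter (a2 := pred0)) ?filter_pred0// => j _.
  by rewrite nth_nseq if_same.
rewrite filter_prefix mask_gaps_prefix /= run_length_prefix0 -IH -map_comp; congr (_ :: _).
by apply: eq_map => j /=; rewrite run_length_prefixS.
Qed.

Lemma mask_gaps_gt0 b x : x \in mask_gaps b -> (0 < x)%N.
Proof.
elim/mask_ind: b => [a|a b IH]; first by rewrite /mask_gaps mask_pos_nseq.
by rewrite mask_gaps_prefix in_cons => /orP[/eqP ->|/IH].
Qed.

End mask_positions.

(** * The mass of a walk with a given mask *)

Section mask_walks.
Context {R : realType}.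
Local Open Scope ereal_scope.
Let kappa : R := (Num.sqrt (2 * pi))^-1%R.

Lemma normal_sqrtE (k : nat) (r : R) : (0 < k)%N ->
  normal_pdf 0 (Num.sqrt k%:R) r = (kappa / Num.sqrt k%:R * expR (- r ^+ 2 / (2 * k%:R)))%R.
Proof.
move=> k0; have k0R : (0 < k%:R :> R)%R by rewrite ltr0n.
by rewrite normal_pdf0E ?sqrtr_gt0// invfM sqr_sqrtr// ltW.
Qed.

(** A gap of [x] steps is a bridge: the density [kappa / sqrt x] of a return to [0] times the
    probability [1 / x] of staying nonpositive. The stretch after the last mark is a free walk. *)
Lemma walkV_mask (b : seq bool) : walkV (below 0) 0%R b 0%R =
  (kappa ^+ size (mask_pos b) * \prod_(x <- mask_gaps b) (x%:R * Num.sqrt x%:R)^-1 *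
   dratio R (size b - last 0%N (mask_pos b)))%:E.
Proof.
elim/mask_ind: b => [a|a b IH].
  by rewrite /mask_gaps mask_pos_nseq big_nil expr0 !mul1r subn0 size_nseq walkV_sparre_andersen.
have mb : measurable_fun [set: R] (below (0 : R)) by exact: measurable_below.
rewrite walkV_cat// IH walkV_bridge normal_sqrtE// last_pos_prefix mask_gaps_prefix big_cons.
rewrite mask_pos_prefix /= size_map size_nseq_true -EFinM; congr EFin.
rewrite (_ : (a + (size b).+1 - _)%N = (size b - last 0%N (mask_pos b))%N); last lia.
have -> : (- 0 ^+ 2 / (2 * a.+1%:R) = 0 :> R)%R by rewrite expr0n oppr0 mul0r.
rewrite expR0 mulr1 [in RHS]exprS [in RHS]invfM.
set u := a.+1%:R; set P := (\prod_(_ <- _) _)%R; set D := dratio _ _; ring.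
Qed.

(** Only the first gap sees the level [r]; from the first contact on, the walk is translated to
    level [0]. *)
Lemma walkV_mask_pinned (a : nat) (b : seq bool) (r : R) :
  walkV (below r) r (nseq a false ++ true :: b) 0%R =
  (pers_q a.+1 r * expR (- r ^+ 2 / (2 * a.+1%:R)) * (kappa / Num.sqrt a.+1%:R *
   (kappa ^+ size (mask_pos b) * \prod_(x <- mask_gaps b) (x%:R * Num.sqrt x%:R)^-1 *
   dratio R (size b - last 0%N (mask_pos b)))))%:E.
Proof.
have mb : measurable_fun [set: R] (below r) by exact: measurable_below.
rewrite walkV_cat// -pers_qE.
have -> : walkV (below r) r b r = walkV (below 0) 0%R b 0%R.
  by rewrite -{1 2 3}(add0r r) walkV_translate.
rewrite walkV_mask -EFinM normal_sqrtE//; congr EFin; ring.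
Qed.

End mask_walks.

(** * Masks and the indices of a configuration *)

Section configurations.
Context {R : realType}.
Variables (m : nat) (n : 'I_m -> nat).
Local Notation T := (PT n).
Local Notation pt i := (Tagged (fun l => 'I_(n l)) i).
Variable B : {set T}.

(** Both sides are sorted lists without repetition, so comparing their elements suffices. *)
Lemma cidx_mask l : cidx B l = mask_pos (pinmask B l).
Proof.
have sm : sorted leq (mask_pos (pinmask B l)).
  rewrite sorted_map; apply: sorted_filter; first exact: leq_trans.
  exact: iota_sorted.
rewrite -(sorted_sort leq_trans sm) /cidx; apply/eqP.
have perm : perm_eq [seq (nat_of_ord (tagged p)).+1 | p : T <- enum B & tag p == l] (mask_pos (pinmask B l)).
  apply: uniq_perm.
  - rewrite map_inj_in_uniq; first by apply: filter_uniq; exact: enum_uniq.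
    move=> p q; rewrite !mem_filter => /andP[/eqP pl _] /andP[/eqP ql _] [pq].
    by apply: eq_PT => //; rewrite pl ql.
  - rewrite map_inj_uniq ?filter_uniq ?iota_uniq//; exact: succn_inj.
  move=> x; apply/mapP/mapP => [[p]|[j]].
    rewrite mem_filter mem_enum => /andP[/eqP pl pB] ->.
    case: p pl pB => k i /= kl; subst k => iB; exists (nat_of_ord i) => //.
    by rewrite mem_filter nth_pinmask iB mem_iota size_pinmask /= ltn_ord.
  rewrite mem_filter mem_iota /= add0n size_pinmask => /andP[jB jn] ->.
  exists (pt (Ordinal jn)) => //; rewrite mem_filter eqxx mem_enum /=.
  by rewrite -nth_pinmask.
by rewrite (perm_sortP leq_total leq_trans anti_leq _ _ perm).
Qed.

Lemma big_walk (S : Type) (idx : S) (op : Monoid.com_law idx) l (F : nat -> S) :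
  \big[op/idx]_(p in B | tag p == l) F (stepno p) =
  \big[op/idx]_(j <- [seq j <- iota 0 (n l) | nth false (pinmask B l) j]) F j.
Proof.
rewrite big_filter -[X in iota 0 X]subn0 -/(index_iota 0 (n l)) big_mkord.
transitivity (\big[op/idx]_(p : T | (tag p == l) && (pt (tagged p) \in B)) F (tagged p)).
  by apply: eq_big => -[k i] //=; rewrite andbC.
rewrite -(sig_big_dep (fun k => k == l) (fun k (i : 'I_(n k)) => pt i \in B) (fun k (i : 'I_(n k)) => F i)) /=.
by rewrite big_pred1_eq; apply: eq_bigl => i; rewrite nth_pinmask.
Qed.

Lemma card_gap (p : T) : #|gap B p| = run_length (pinmask B (tag p)) (stepno p).
Proof.
case: p => l i; rewrite /stepno /=.
pose Q (j : nat) := (j <= i)%N && all (fun j' => ~~ nth false (pinmask B l) j') (iota j (i - j)).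
have -> : gap B (pt i) = [set (pt j : T) | j in [set j : 'I_(n l) | Q j]%SET]%SET.
  apply/setP => -[k j]; apply/idP/imsetP.
    rewrite inE /stepno /= => /and3P[/eqP kl ji /forallP h]; subst k; exists j => //.
    rewrite inE /Q ji; apply/allP => j'; rewrite mem_iota subnKC// => /andP[jj' j'i].
    have j'n : (j' < n l)%N by apply: ltn_trans j'i (ltn_ord i).
    have := h (pt (Ordinal j'n)); rewrite -nth_pinmask /= eqxx j'i andbT.
    by case: (nth false (pinmask B l) j') => //=; rewrite ltnNge jj'.
  move=> [j' + e]; have := congr1 tag e => /= kl; subst k.
  have -> : j = j' by move/eqP: (e); rewrite -tag_eqE /tag_eq eqxx tagged_asE /= => /eqP.
  rewrite !inE /stepno /= eqxx => /andP[-> /allP h] /=.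
  apply/forallP => -[k q]; apply/implyP => /andP[/andP[qB /eqP /= kl] qi]; subst k.
  rewrite ltnNge; apply/negP => j'q; have := h q.
  by rewrite mem_iota j'q subnKC ?(leq_trans j'q (ltnW qi))// qi => /(_ isT); rewrite nth_pinmask qB.
rewrite card_imset; last by move=> x y /eqP; rewrite -tag_eqE /tag_eq eqxx tagged_asE /= => /eqP.
rewrite /run_length size_pinmask -val_enum_ord count_map cardE -size_filter.
by congr size; rewrite enum_filter; apply: eq_filter => j; rewrite inE.
Qed.

Lemma big_gaps (S : Type) (idx : S) (op : Monoid.com_law idx) l (F : nat -> S) :
  \big[op/idx]_(p in B | tag p == l) F #|gap B p| =
  \big[op/idx]_(x <- mask_gaps (pinmask B l)) F x.
Proof.
rewrite -run_lengthE big_map size_pinmask -big_walk; apply: eq_bigr => p /andP[_ /eqP pl].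
by rewrite card_gap pl.
Qed.

Lemma ck_mask l : ck B l = size (mask_pos (pinmask B l)).
Proof. by rewrite /ck cidx_mask. Qed.

Lemma sum_ck : (\sum_(l < m) ck B l = #|B|)%N.
Proof.
rewrite -sum1_card (partition_big (fun p : T => tag p) predT)//=; apply: eq_bigr => l _.
rewrite ck_mask /mask_pos size_map -sum1_size.
rewrite size_pinmask; exact/esym/(@big_walk _ _ addn l (fun=> 1%N)).
Qed.

Lemma mask_pinned l : (0 < ck B l)%N -> exists a b,
  [/\ pinmask B l = nseq a false ++ true :: b, ci1 B l = a.+1 &
      cDelta B l = (\prod_(x <- mask_gaps b) x)%N].
Proof.
rewrite ck_mask /ci1 /cDelta /ci1 cidx_mask; elim/mask_ind: (pinmask B l) => [a|a b _ _].
  by rewrite mask_pos_nseq.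
exists a, b; split => //; rewrite mask_pos_prefix//=.
by rewrite -[X in pairmap _ X](addn0 a.+1) pairmap_shift.
Qed.

Lemma mask_unpinned l : ck B l = 0%N -> pinmask B l = nseq (n l) false.
Proof.
rewrite ck_mask -(size_pinmask B l); elim/mask_ind: (pinmask B l) => [a|a b _].
  by rewrite size_nseq.
by rewrite mask_pos_prefix.
Qed.

Lemma prod_gaps l : (0 < ck B l)%N ->
  \prod_(p in B | tag p == l) #|gap B p|%:R = (ci1 B l)%:R * (cDelta B l)%:R :> R.
Proof.
move=> /mask_pinned[a [b [bE -> ->]]].
rewrite (@big_gaps _ _ _ l (fun x => x%:R)) bE mask_gaps_prefix big_cons; congr (_ * _).
by rewrite natr_prod.
Qed.

Lemma first_inP p : p \in B -> first_in B p = (stepno p == (ci1 B (tag p)).-1).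
Proof.
move=> pB; have := pB; case: p pB => l i /= iB; rewrite -nth_pinmask => bi.
have k0 : (0 < ck B l)%N.
  rewrite ck_mask /mask_pos size_map size_filter -has_count; apply/hasP; exists (nat_of_ord i) => //.
  by rewrite mem_iota size_pinmask ltn_ord.
have [a [b [bE c1 _]]] := mask_pinned k0; rewrite c1 /= /stepno /=.
have an : (a < n l)%N by rewrite -(size_pinmask B l) bE size_nseq_true; lia.
have aB : pt (Ordinal an) \in B by rewrite -nth_pinmask bE nth_prefix ltnn eqxx.
have ge q : q \in B -> tag q = l -> (a <= stepno q)%N.
  case: q => k q + /= kl; subst k; rewrite -nth_pinmask bE nth_prefix /stepno /=.
  by case: ltnP.
apply/forallP/eqP => [/(_ (pt (Ordinal an)))|ia q].
  rewrite aB eqxx /= => ia; apply/eqP; rewrite eqn_leq ia /=; exact: (ge (pt i)).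
by apply/implyP => /andP[qB /eqP ql]; rewrite /stepno /= ia; exact: ge.
Qed.

(** The gap of a first point consists of all steps up to it and has size [ci1 B l]; summed over [l]
    this gives [s]. *)
Lemma sum_first_gaps l :
  \sum_(p in B | (tag p == l) && first_in B p) (#|gap B p|%:R)^-1 =
  (if (0 < ck B l)%N then ((ci1 B l)%:R)^-1 else 0) :> R.
Proof.
rewrite (eq_bigl (fun p => (p \in B) && (tag p == l) && (stepno p == (ci1 B l).-1))); last first.
  move=> p; case: (boolP (p \in B)) => //= pB; case: eqP => //= pl.
  by rewrite first_inP// pl.
rewrite big_mkcondr (eq_bigr (fun p => if stepno p == (ci1 B l).-1
    then ((run_length (pinmask B l) (stepno p))%:R)^-1 else 0)); last first.
  by move=> p /andP[_ /eqP pl]; rewrite card_gap pl.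
rewrite (@big_walk _ _ _ l (fun j => if j == (ci1 B l).-1
    then ((run_length (pinmask B l) j)%:R)^-1 else 0)).
case: ifPn => [/mask_pinned[a [b [bE -> _]]]|]; last first.
  rewrite -eqn0Ngt => /eqP /mask_unpinned ->; rewrite (eq_in_filter (a2 := pred0)) ?filter_pred0 ?big_nil//.
  by move=> j _; rewrite nth_nseq if_same.
rewrite -(size_pinmask B l) bE filter_prefix big_cons /= eqxx run_length_prefix0 big1_seq ?addr0//.
move=> j /andP[_ /mapP[i _ ->]]; by rewrite gtn_eqF// ltnS leq_addr.
Qed.

End configurations.

(** * The contribution of one configuration *)

Section configuration_terms.
Context {R : realType}.
Local Notation mu := (@lebesgue_measure R).
Variables (m : nat) (n : 'I_m -> nat).
Local Notation T := (PT n).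
Variable B : {set T}.
Let kappa : R := (Num.sqrt (2 * pi))^-1.
Let weight l : R := Num.sqrt (ci1 B l)%:R / Num.sqrt (cDelta B l)%:R * cc R B l.
Let gaps l : R := (ci1 B l)%:R * (cDelta B l)%:R.

Lemma dratio_gt0 k : 0 < dratio R k.
Proof.
have dfact0 j : (0 < dfact j)%N /\ (0 < dfact j.+1)%N.
  by elim: j => // j [j0 j1]; split => //; rewrite muln_gt0.
by rewrite divr_gt0 ?ltr0n ?(dfact0 _).1.
Qed.

Lemma ci1_gt0 l : (0 < ck B l)%N -> (0 < ci1 B l)%N.
Proof. by move=> /mask_pinned[a [b [_ -> _]]]. Qed.

Lemma cDelta_gt0 l : (0 < ck B l)%N -> (0 < cDelta B l)%N.
Proof.
move=> /mask_pinned[a [b [_ _ ->]]]; rewrite big_seq prodn_cond_gt0// => x.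
exact: mask_gaps_gt0.
Qed.

Lemma gaps_gt0 l : (0 < ck B l)%N -> 0 < gaps l.
Proof. by move=> k0; rewrite mulr_gt0 ?ltr0n ?ci1_gt0 ?cDelta_gt0. Qed.

Lemma weight_gt0 l : (0 < ck B l)%N -> 0 < weight l.
Proof.
move=> k0; rewrite mulr_gt0 ?dratio_gt0// divr_gt0// sqrtr_gt0 ltr0n; [exact: ci1_gt0|exact: cDelta_gt0].
Qed.

Lemma prod_gap_sqrt (s : seq nat) :
  \prod_(x <- s) (x%:R * Num.sqrt x%:R)^-1 =
  ((\prod_(x <- s) x)%N%:R * Num.sqrt (\prod_(x <- s) x)%N%:R)^-1 :> R.
Proof.
elim: s => [|x s IH]; first by rewrite !big_nil sqrtr1 mulr1 invr1.
by rewrite !big_cons IH natrM sqrtrM ?ler0n// -invfM; congr (_^-1); ring.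
Qed.

Lemma cilast_mask l a b : pinmask B l = nseq a false ++ true :: b ->
  (size b - last 0 (mask_pos b) = n l - cilast B l)%N.
Proof.
move=> bE; rewrite /cilast cidx_mask -(size_pinmask B l) bE last_pos_prefix size_nseq_true; lia.
Qed.

(** The product [gaps l] is split off because the moment of the determinant cancels it. The first
    gap carries only the density factor [1 / sqrt i_1], so [weight] receives [sqrt i_1] in its
    numerator. *)
Lemma walkV_pinmask l (r : R) : walkV (below r) r (pinmask B l) 0 =
  (kappa ^+ ck B l * if (0 < ck B l)%N
   then pers_q (ci1 B l) r * expR (- (r ^+ 2 / 2 * (ci1 B l)%:R^-1)) * ((gaps l)^-1 * weight l)
   else pers_p (n l) r)%:E.
Proof.
case: ifPn => [k0|]; last first.
  by rewrite -eqn0Ngt => /eqP k0; rewrite k0 expr0 mul1r mask_unpinned// pers_pE.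
have D0 : (0 < (cDelta B l)%:R :> R) by rewrite ltr0n cDelta_gt0.
have c0 : (0 < (ci1 B l)%:R :> R) by rewrite ltr0n ci1_gt0.
rewrite ck_mask /weight /gaps /cc.
have [a [b [bE c1 DE]]] := mask_pinned k0.
rewrite [in LHS]bE walkV_mask_pinned prod_gap_sqrt -DE (cilast_mask bE) -c1 bE mask_pos_prefix /= size_map.
have -> : - r ^+ 2 / (2 * (ci1 B l)%:R) = - (r ^+ 2 / 2 * (ci1 B l)%:R^-1) :> R.
  by rewrite invfM; ring.
move: (expR _) => E; rewrite -/kappa [kappa ^+ _.+1]exprS !invfM; congr EFin.
have -> : ((ci1 B l)%:R)^-1 = (Num.sqrt (ci1 B l)%:R)^-1 * (Num.sqrt (ci1 B l)%:R)^-1 :> R.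
  by rewrite -invfM -expr2 sqr_sqrtr// ltW.
have : Num.sqrt (ci1 B l)%:R != 0 :> R by rewrite gt_eqF// sqrtr_gt0.
move: (Num.sqrt (ci1 B l)%:R) (kappa ^+ _) (dratio _ _) => u K D u0.
rewrite -[LHS](mulr1) -(divff u0); ring.
Qed.

Lemma walkV_pinmask0 l : walkV (below 0) 0 (pinmask B l) 0 =
  (kappa ^+ ck B l * ((if (0 < ck B l)%N then (gaps l)^-1 else 1) * ce R B l))%:E.
Proof.
rewrite walkV_mask -/kappa -ck_mask -mulrA; congr (_ * _)%:E; rewrite /ce.
case: ifPn => [k0|]; last first.
  by rewrite -eqn0Ngt => /eqP k0; rewrite mask_unpinned// /mask_gaps mask_pos_nseq big_nil size_nseq subn0.
rewrite /gaps /cc -natrM.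
have [a [b [bE c1 DE]]] := mask_pinned k0.
rewrite prod_gap_sqrt bE size_nseq_true last_pos_prefix.
rewrite -(cilast_mask bE) (_ : (_ + _ - (a.+1 + _))%N = (size b - last 0%N (mask_pos b))%N); last lia.
rewrite mask_gaps_prefix big_cons -DE -c1 invfM.
by rewrite -[LHS]mulrA.
Qed.

Definition persistence_density (r : R) : R := expR (- (cs R B * r ^+ 2) / 2) *
  \prod_(l < m | ck B l == 0%N) pers_p (n l) r *
  \prod_(l < m | (0 < ck B l)%N) pers_q (ci1 B l) r.

Let scale : R := kappa ^+ #|B| * \prod_(l < m | (0 < ck B l)%N) ((gaps l)^-1 * weight l).

Lemma scale_gt0 : 0 < scale.
Proof.
rewrite mulr_gt0 ?exprn_gt0 ?invr_gt0 ?sqrtr_gt0 ?mulr_gt0 ?pi_gt0//.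
by apply: prodr_gt0 => l k0; rewrite mulr_gt0 ?invr_gt0 ?gaps_gt0 ?weight_gt0.
Qed.

Lemma pinned_massE (c0 : R -> bool) (r : R) : pinned_mass B c0 r =
  (scale * ((c0 r)%:R * persistence_density r))%:E.
Proof.
rewrite /pinned_mass (eq_bigr _ (fun l _ => walkV_pinmask l r)) prodEFin -EFinM; congr EFin.
rewrite big_split /= -expr_sum sum_ck /scale /persistence_density.
rewrite (bigID (fun l => 0 < ck B l)%N) /= (eq_bigr (fun l => pers_q (ci1 B l) r *
    expR (- (r ^+ 2 / 2 * (ci1 B l)%:R^-1)) * ((gaps l)^-1 * weight l))); last by move=> l ->.
have -> : \prod_(l < m | ~~ (0 < ck B l)%N) (if (0 < ck B l)%N
    then pers_q (ci1 B l) r * expR (- (r ^+ 2 / 2 * (ci1 B l)%:R^-1)) * ((gaps l)^-1 * weight l)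
    else pers_p (n l) r) = \prod_(l < m | ck B l == 0%N) pers_p (n l) r.
  by apply: eq_big => l; [rewrite -eqn0Ngt|move=> /negbTE ->].
rewrite 2!big_split /= -expR_sum sumrN -mulr_sumr -/(cs R B).
have -> : - (r ^+ 2 / 2 * cs R B) = - (cs R B * r ^+ 2) / 2 by ring.
ring.
Qed.

(** Read off [pinned_mass], of which it is a positive multiple, instead of the factors [pers_p] and
    [pers_q]. *)
Lemma measurable_persistence_density : measurable_fun [set: R] persistence_density.
Proof.
rewrite (_ : persistence_density = fun r => scale^-1 * fine (pinned_mass B (fun=> true) r)).
  apply: measurable_funM => //; apply: measurableT_comp => //; exact: measurable_pinned_mass.
by apply/funext => r; rewrite pinned_massE /= mul1r mulKf// gt_eqF// scale_gt0.
Qed.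

Lemma persistence_density_ge0 r : 0 <= persistence_density r.
Proof.
have := pinned_mass_ge0 B (fun=> true) r.
by rewrite pinned_massE lee_fin pmulr_rge0 ?scale_gt0// mul1r.
Qed.

Lemma integral_pinned_mass (c0 : R -> bool) : measurable_fun [set: R] c0 ->
  (\int[mu]_r pinned_mass B c0 r =
   scale%:E * \int[mu]_r ((c0 r)%:R * persistence_density r)%:E)%E.
Proof.
move=> mc; under eq_integral => r _ do rewrite pinned_massE EFinM.
rewrite ge0_integralZl_EFin ?ltW ?scale_gt0//.
- by move=> r _; rewrite lee_fin mulr_ge0 ?persistence_density_ge0.
- apply/measurable_EFinP; apply: measurable_funM; last exact: measurable_persistence_density.
  exact: measurable_boolR.
Qed.

Lemma integral_pinned_massT :
  (\int[mu]_r pinned_mass B (fun=> true) r = scale%:E * cJ B setT)%E.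
Proof.
rewrite integral_pinned_mass//; congr (_ * _)%E.
by apply: eq_integral => r _; rewrite mul1r.
Qed.

(** The origin imposes [0 <= r], while [J] is taken over the open half line; one point makes no
    difference. *)
Lemma integral_pinned_mass_pos :
  (\int[mu]_r pinned_mass B (fun r => 0 <= r)%R r = scale%:E * cJ B `]0%R, +oo[%classic)%E.
Proof.
rewrite integral_pinned_mass; last exact: measurable_fun_ler.
congr (_ * _)%E; rewrite /cJ integral_itv_obnd_cbnd; last first.
  apply: (measurable_funS measurableT) => //; apply/measurable_EFinP.
  exact: measurable_persistence_density.
rewrite [RHS]integral_mkcond; apply: eq_integral => r _.
rewrite patchE mem_setE in_itv /= andbT; case: ifPn => _.
  by rewrite mul1r.
by rewrite mul0r.
Qed.

Lemma prod_gaps_set : \prod_(p in B) #|gap B p|%:R = \prod_(l < m | (0 < ck B l)%N) gaps l.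
Proof.
rewrite (partition_big (fun p : T => tag p) predT)//= (bigID (fun l => 0 < ck B l)%N) /=.
rewrite [X in _ * X]big1 ?mulr1; last first.
  move=> l; rewrite -eqn0Ngt => /eqP k0.
  by rewrite (@big_gaps _ _ _ _ _ _ l (fun x => x%:R)) mask_unpinned// /mask_gaps mask_pos_nseq big_nil.
by apply: eq_bigr => l k0; rewrite prod_gaps.
Qed.

(** Leaving out a first point divides the product of all gap sizes by its own gap; the factor [s]
    arises here. *)
Lemma sum_first_prod : \sum_(p in B | first_in B p) \prod_(q in B | q != p) #|gap B q|%:R =
  cs R B * \prod_(l < m | (0 < ck B l)%N) gaps l.
Proof.
have g0 p : p \in B -> #|gap B p|%:R != 0 :> R.
  move=> pB; rewrite pnatr_eq0 -lt0n; apply/card_gt0P; exists p.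
  by rewrite inE eqxx leqnn /=; apply/forallP => q; apply/implyP => /andP[/andP[]]; lia.
rewrite -prod_gaps_set /cs [X in X * _]big_mkcond /= -(eq_bigr _ (fun l _ => sum_first_gaps B l)).
rewrite (eq_bigr (fun p => (#|gap B p|%:R)^-1 * \prod_(q in B) #|gap B q|%:R)); last first.
  by move=> p /andP[pB _]; rewrite [X in _ * X](bigD1 p)//= mulKf ?g0.
rewrite -mulr_suml (partition_big (fun p : T => tag p) predT)//=; congr (_ * _).
by apply: eq_bigr => l _; apply: eq_bigl => p; rewrite andbAC andbA.
Qed.

(** The [d!] of the simplex volume cancels that of the moment, and the product of the gaps cancels
    the one inside [scale]. *)
Lemma aff_configuration (d : nat) (t0 : T) : #|B| = d.+1 ->
  ((d`!%:R^-1)%:E * (aff_moment d t0 B * (cauchy_integral d * scale%:E)) =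
   cauchy_integral d * (kappa ^+ d.+1 * cs R B * \prod_(l < m | (0 < ck B l)%N) weight l)%:E)%E.
Proof.
move=> Bd; rewrite aff_momentE// sum_first_prod muleCA muleA -EFinM muleCA -EFinM; congr (_ * _%:E)%E.
rewrite /scale Bd [X in _ * (_ * X) = _]big_split /= prodfV.
have : \prod_(l < m | (0 < ck B l)%N) gaps l != 0 by apply/prodf_neq0 => l k0; rewrite gt_eqF ?gaps_gt0.
have : d`!%:R != 0 :> R by rewrite pnatr_eq0 -lt0n fact_gt0.
by move: (\prod_(_ < _ | _) gaps _) => P P0 f0; field; rewrite P0 f0.
Qed.

Lemma aff_configurationT (d : nat) (t0 : T) : #|B| = d.+1 ->
  ((d`!%:R^-1)%:E * (aff_moment d t0 B * (cauchy_integral d *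
     \int[mu]_r pinned_mass B (fun=> true) r)) =
   cauchy_integral d * (kappa ^+ d.+1 * cs R B * \prod_(l < m | (0 < ck B l)%N) weight l)%:E *
   cJ B setT)%E.
Proof. by move=> Bd; rewrite integral_pinned_massT -(aff_configuration t0 Bd) !muleA. Qed.

Lemma aff_configuration_pos (d : nat) (t0 : T) : #|B| = d.+1 ->
  ((d`!%:R^-1)%:E * (aff_moment d t0 B * (cauchy_integral d *
     \int[mu]_r pinned_mass B (fun r => 0 <= r)%R r)) =
   cauchy_integral d * (kappa ^+ d.+1 * cs R B * \prod_(l < m | (0 < ck B l)%N) weight l)%:E *
   cJ B `]0%R, +oo[%classic)%E.
Proof. by move=> Bd; rewrite integral_pinned_mass_pos -(aff_configuration t0 Bd) !muleA. Qed.

(** The same cancellation at level [0]; the exponent of [kappa] is [d] because [d] positions are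
    pinned. *)
Lemma lin_configuration (d : nat) (t0 : T) : #|B| = d ->
  ((d`!%:R^-1)%:E * (lin_moment d t0 B * (cauchy_integral d * pinned_mass B (fun=> true) 0%R)) =
   cauchy_integral d * (kappa ^+ d * \prod_(l < m) ce R B l)%:E)%E.
Proof.
move=> Bd; rewrite lin_momentE// prod_gaps_set /pinned_mass mul1e.
rewrite (eq_bigr _ (fun l _ => walkV_pinmask0 l)) prodEFin.
rewrite muleCA muleA -EFinM muleCA -EFinM; congr (_ * _%:E)%E.
rewrite [X in _ * X = _]big_split /= -expr_sum sum_ck Bd [X in _ * (_ * X) = _]big_split /=.
rewrite -big_mkcond /= prodfV.
have : \prod_(l < m | (0 < ck B l)%N) gaps l != 0 by apply/prodf_neq0 => l k0; rewrite gt_eqF ?gaps_gt0.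
have : d`!%:R != 0 :> R by rewrite pnatr_eq0 -lt0n fact_gt0.
by move: (\prod_(_ < _ | _) gaps _) => P P0 f0; field; rewrite P0 f0.
Qed.

End configuration_terms.

(** * Normalizing constants *)

Section normalization.
Context {R : realType}.
Let kappa : R := (Num.sqrt (2 * pi))^-1.

(** [c = pi^(d/2) / ((d/2) * Gamma(d/2))] meets one factor [kappa = (2 * pi)^(-1/2)] for each pinned
    position. Dividing the first identity by [kappa] gives the second, hence [sqrt (2 * pi)] in the
    terms of faces through the origin. *)
Lemma cauchy_integral_normalized (d : nat) : (0 < d)%N ->
  let pref : R := Gamma (d.+1%:R / 2) / (d%:R * Num.sqrt pi * Gamma (d%:R / 2)) in
  let den : R := powR 2 (d.+1%:R / 2 - 1) * Gamma (d.+1%:R / 2) in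
  exists2 c : R, cauchy_integral d = c%:E &
  [/\ 0 < pref, 0 < den, c * kappa ^+ d.+1 = pref / den &
      c * kappa ^+ d = pref * (Num.sqrt (2 * pi) / den)].
Proof.
move=> d0 pref den.
have [c cE [c0 Gd cG]] := cauchy_integral_Gamma (R := R) d0.
(* Gives the positivity of [Gamma((d+1)/2)], which cancels between [pref] and [den]. *)
have [_ _ [_ Gd1 _]] := cauchy_integral_Gamma (R := R) (ltn0Sn d).
have pi0 : 0 < pi :> R := pi_gt0 R.
have s20 : 0 < Num.sqrt 2 :> R by rewrite sqrtr_gt0.
have sp0 : 0 < Num.sqrt pi :> R by rewrite sqrtr_gt0.
have dR0 : 0 < d%:R :> R by rewrite ltr0n.
have pref0 : 0 < pref by rewrite divr_gt0 ?mulr_gt0.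
have den0 : 0 < den by rewrite mulr_gt0 ?powR_gt0.
have powE : powR 2 (d.+1%:R / 2 - 1) = Num.sqrt 2 ^+ d.+1 / 2 :> R.
  rewrite powRB ?pnatr_eq0 ?implybT// powRr1//; congr (_ / _).
  by rewrite mulrC powRrM powR12_sqrt// powR_mulrn// ltW.
have kE : kappa = (Num.sqrt 2)^-1 * (Num.sqrt pi)^-1 by rewrite /kappa sqrtrM// invfM.
have k0 : kappa != 0 by rewrite kE mulf_neq0// invr_eq0 gt_eqF.
have main : c * kappa ^+ d.+1 = pref / den.
  have {}cG : c = Num.sqrt pi ^+ d / (d%:R / 2 * Gamma (d%:R / 2)).
    by rewrite -cG mulfK// gt_eqF// mulr_gt0// divr_gt0.
  rewrite /den powE cG kE exprMn !exprVn 2!exprS /pref.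
  have := gt_eqF sp0; have := gt_eqF s20; have := gt_eqF Gd; have := gt_eqF Gd1.
  have := gt_eqF dR0; move: (Gamma _) (Gamma _) (Num.sqrt pi) (Num.sqrt 2) => g g1 p s.
  move=> d1 h1 h2 h3 h4.
  have : p ^+ d != 0 by rewrite expf_neq0// h4.
  have : s ^+ d != 0 by rewrite expf_neq0// h3.
  move: (p ^+ d) (s ^+ d) => P S S0 P0.
  by field; rewrite S0 P0 d1 h1 h2 h3 h4.
exists c => //; split=> //; rewrite -[LHS](mulfK k0) -[_ * _ * kappa]mulrA -exprSr main.
by rewrite /kappa invrK; ring.
Qed.

End normalization.

Theorem theorem5 (R : realType) (m : nat) (n : 'I_m -> nat) (d : nat) :
  (0 < m)%N -> (forall l, (0 < n l)%N) -> (1 <= d)%N ->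
  let pref : R := Gamma (d.+1%:R / 2) /
                  (d%:R * Num.sqrt pi * Gamma (d%:R / 2)) in
  let den : R := powR 2 (d.+1%:R / 2 - 1) * Gamma (d.+1%:R / 2) in
  EvolQ R n d =
    (pref%:E * \sum_(A : {set PT n} | #|A| == d.+1)
      ((cs R A / den * \prod_(l < m | (0 < ck A l)%N)
          (Num.sqrt (ci1 A l)%:R / Num.sqrt (cDelta A l)%:R * cc R A l))%:E
       * cJ A setT))%E /\
  EvolQ0 R n d =
    (pref%:E * (\sum_(A : {set PT n} | #|A| == d.+1)
      ((cs R A / den * \prod_(l < m | (0 < ck A l)%N)
          (Num.sqrt (ci1 A l)%:R / Num.sqrt (cDelta A l)%:R * cc R A l))%:E
       * cJ A `]0%R, +oo[%classic)
     + \sum_(A : {set PT n} | #|A| == d)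
      (Num.sqrt (2 * pi) / den * \prod_(l < m) ce R A l)%:E))%E.
Proof.
move=> m0 n0 d0 pref den.
(* A default point for [enum_set]: the first step of the first walk. *)
pose t0 : PT n := Tagged (fun l => 'I_(n l)) (Ordinal (n0 (Ordinal m0))).
have [c cE [pref0 den0 cd1 cd]] := cauchy_integral_normalized (R := R) d0.
rewrite -/pref -/den in pref0 den0 cd1 cd.
pose W (A : {set PT n}) : R := \prod_(l < m | (0 < ck A l)%N)
  (Num.sqrt (ci1 A l)%:R / Num.sqrt (cDelta A l)%:R * cc R A l).
have W0 A : 0 <= W A.
  by apply: prodr_ge0 => l k0; exact: ltW (weight_gt0 k0).
have cs0 A : 0 <= cs R A by apply: sumr_ge0 => l _; rewrite invr_ge0.
have J0 (A : {set PT n}) (D : set R) : (0 <= cJ A D)%E.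
  by apply: integral_ge0 => r _; rewrite lee_fin; exact: persistence_density_ge0.
have ce0 (A : {set PT n}) l : 0 <= ce R A l.
  rewrite /ce; case: ifP => _; last exact/ltW/dratio_gt0.
  by rewrite mulr_ge0 ?invr_ge0 ?sqrtr_ge0//; exact/ltW/dratio_gt0.
have term0 (A : {set PT n}) (D : set R) : (0 <= (cs R A / den * W A)%:E * cJ A D)%E.
  by rewrite mule_ge0// lee_fin !mulr_ge0// invr_ge0 ltW.
have lin0 (A : {set PT n}) : (0 <= (Num.sqrt (2 * pi) / den * \prod_(l < m) ce R A l)%:E)%E.
  by rewrite lee_fin !mulr_ge0 ?sqrtr_ge0 ?invr_ge0 ?prodr_ge0// ltW.
have coefE (A : {set PT n}) : c * ((Num.sqrt (2 * pi))^-1 ^+ d.+1 * cs R A * W A) =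
    pref * (cs R A / den * W A).
  by rewrite !mulrA cd1; ring.
split.
  rewrite (EvolQ_sum _ t0) ge0_sume_distrr//; apply: eq_bigr => A /eqP Ad.
  by rewrite aff_configurationT// cE -EFinM coefE EFinM muleA.
rewrite (EvolQ0_sum _ t0) ge0_muleDr ?sume_ge0// !ge0_sume_distrr//; congr (_ + _)%E.
  apply: eq_bigr => A /eqP Ad.
  by rewrite aff_configuration_pos// cE -EFinM coefE EFinM muleA.
apply: eq_bigr => A /eqP Ad; rewrite lin_configuration// cE -!EFinM; congr EFin.
by rewrite mulrA cd; ring.
Qed.
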